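(* Let $n\ge 3$ and $\ell\ge 1$ be integers and put $\mu=\frac{1}{2(n-1)\ell}$. There exist positive real numbers $X_0=X_0(n,\ell)$ and $c=c(n,\ell)$ such that for every $X>X_0$ there are at least $cX^{\mu}$ pairwise non-isomorphic number fields of degree $n$ whose discriminant does not exceed $X$ in absolute value and whose class number is divisible by $\ell$. Moreover, these fields can be chosen so that the class group of each of them contains an element of exact order $\ell$. *)

(* Defs.v *)
From HB Require Import structures.
From mathcomp Require Import all_boot all_order all_algebra all_field.
From mathcomp Require Import reals exp.
Set Implicit Arguments. Unset Strict Implicit. Unset Printing Implicit Defensive.
Import Order.TTheory GRing.Theory Num.Theory.
Local Open Scope ring_scope.

Section NumberField.
Variable L : fieldExtType rat.

Definition integral (x : L) : Prop :=
  exists p : {poly int}, p \is monic /\ root (map_poly (fun z : int => z%:~R) p) x.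

Definition ideal (I : L -> Prop) : Prop :=
  [/\ (forall x, I x -> integral x), I 0,
      (forall x y, I x -> I y -> I (x + y)),
      (forall a x, integral a -> I x -> I (a * x)) &
      exists x, I x /\ x != 0].

Definition ideal_mul (I J : L -> Prop) : L -> Prop := fun z =>
  exists m (x y : 'I_m -> L), (forall i, I (x i)) /\ (forall i, J (y i)) /\
    z = \sum_(i < m) x i * y i.

Definition ideal_exp (I : L -> Prop) (k : nat) : L -> Prop :=
  iter k (ideal_mul I) integral.

Definition principal (I : L -> Prop) : Prop :=
  exists a : L, forall x, I x <-> exists y, integral y /\ x = a * y.

Definition ideal_equiv (I J : L -> Prop) : Prop :=
  exists a b : L, [/\ integral a, integral b, a != 0, b != 0 &
    forall x, (exists y, I y /\ x = a * y) <-> (exists y, J y /\ x = b * y)].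

Definition class_number (h : nat) : Prop :=
  exists rep : 'I_h -> (L -> Prop),
    [/\ (forall i, ideal (rep i)),
        (forall i j, ideal_equiv (rep i) (rep j) -> i = j) &
        (forall I, ideal I -> exists i, ideal_equiv I (rep i))].

Definition has_class_of_order (l : nat) : Prop :=
  exists I, [/\ ideal I, principal (ideal_exp I l) &
    forall k, (0 < k < l)%N -> ~ principal (ideal_exp I k)].

(* absolute trace L -> Q: trace of multiplication by a *)
Definition trace (a : L) : rat :=
  \sum_(i < \dim {:L}) coord (vbasis {:L}) i (a * tnth (vbasis {:L}) i).

Definition is_disc (d : rat) : Prop :=
  exists b : 'I_(\dim {:L}) -> L,
    [/\ (forall i, integral (b i)),
        (forall x, integral x -> exists z : 'I_(\dim {:L}) -> int,
            x = \sum_i (z i)%:~R * b i) &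
        d = \det (\matrix_(i, j) trace (b i * b j))].
End NumberField.

Definition nf_iso (L1 L2 : fieldExtType rat) : Prop :=
  exists f : {rmorphism L1 -> L2}, bijective f.

(* Main.v *)
(**
Fix [m = n - 1] suitable integers [a_i] with product [A] and let [K_t = Q(theta)] for a root [theta]
of [f = prod_i (X - a_i) * (X - b) + (-1) ^ n], where [b = (t ^ l - 1) / A] and [t = 1 mod A].

The conjugates of [theta] are within [2 / b] of [a_1, ..., a_m] and [b], one each.  Hence [f] is
irreducible, its discriminant is [O (b ^ (2 * m))], and if [K_t] and [K_t'] are isomorphic with
matching conjugates, for [t] and [t'] of the same size, then the norm of [theta - theta'] is
[O (b * b ^ (- m))], which is less than 1 as [m >= 2], so [t = t'].  A positive proportion of the
[t] up to [X ^ mu] therefore gives pairwise non-isomorphic fields.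

All [theta - a_i] are units, and [theta] has norm [± t ^ l]; the ideal [I = (theta, t)] satisfies
[I ^ l = (theta)].  If a smaller power of [I] were principal, then for some prime [q] dividing [l]
and some [k'] prime to [q], [theta ^ k'] would be a unit [e] times a [q]-th power.  The [n] units
[theta - a_i] and [e] are multiplicatively dependent, since the logarithms of the conjugates of
units span a space of dimension at most [n - 1].  So a nontrivial product of [theta ^ k'] and the
[theta - a_i], with exponents less than [q], is up to sign a [q]-th power.  The [a_i] and [t] are
chosen by the Chinese remainder theorem so that power residue characters modulo [n] primes congruent
to 1 modulo [4 * l] forbid this.  Finally, multiplication by [I] permutes the finitely many ideal
classes in cycles of length [l], which gives the divisibility of the class number.
*)

Require Import Defs.
From HB Require Import structures.
From mathcomp Require Import all_boot all_order all_algebra all_field.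
From mathcomp Require Import reals exp.
From mathcomp Require Import boolp perm cyclic.
From mathcomp Require Import ring lra zify.
Set Implicit Arguments. Unset Strict Implicit. Unset Printing Implicit Defensive.
Import Order.TTheory GRing.Theory Num.Theory.
Local Open Scope ring_scope.

(** * Algebraic integers and embeddings *)

(** The sign in [f] gives [f (0) = (-1) ^ n * (A * b + 1)]; asking that [theta] have norm [± t ^ l]
    then forces the formula for [b]. As [b] grows like [t ^ l], the discriminant is
    [O (t ^ (2 * m * l))], and [mu] is the inverse of this exponent.

    The obstacle is the unit [e], known only through [theta ^ k'] being [e] times a [q]-th power.
    There are already [m = n - 1] units [theta - a_i], so one more exceeds the rank and has to enter
    a relation, where [theta ^ k'] can replace it. What remains is explicit in [Z[theta]] and can be
    evaluated at a root of [f] modulo a prime, with one prime for each of the [n] exponents. As the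
    relation holds only up to sign, [-1] must be a [q]-th power modulo these primes; this is the
    role of the 4 in [4 * l].

    An isomorphism may permute the conjugates, and two generators can be compared only when their
    conjugates are distributed in the same way. So up to [n ^ n] values of [t] may share a field,
    and this factor is lost in the constant [c]. *)

Section Integral.
Variable L : fieldExtType rat.
Local Notation integral := (@integral L).

Lemma integralE (x : L) : integral x <-> integralOver (intr : int -> L) x.
Proof. by split=> [[p [mp rp]]|[p mp rp]]; exists p. Qed.

Lemma integral_int (z : int) : integral z%:~R.
Proof. exact/integralE/integral_id. Qed.

Lemma integral_nat (k : nat) : integral k%:R.
Proof. exact: (integral_int k). Qed.

Lemma integral0 : integral 0. Proof. exact: (integral_int 0). Qed.
Lemma integral1 : integral 1. Proof. exact: (integral_int 1). Qed.

Lemma integralD x y : integral x -> integral y -> integral (x + y).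
Proof. by move=> /integralE hx /integralE hy; apply/integralE/integral_add. Qed.

Lemma integralN x : integral x -> integral (- x).
Proof. by move=> /integralE hx; apply/integralE/integral_opp. Qed.

Lemma integralB x y : integral x -> integral y -> integral (x - y).
Proof. by move=> hx hy; apply/integralD/integralN. Qed.

Lemma integralM x y : integral x -> integral y -> integral (x * y).
Proof. by move=> /integralE hx /integralE hy; apply/integralE/integral_mul. Qed.

Lemma integralX x k : integral x -> integral (x ^+ k).
Proof.
move=> hx; elim: k => [|k IH]; first by rewrite expr0; apply: integral1.
by rewrite exprS; apply: integralM.
Qed.

Lemma integral_sum (I : Type) (r : seq I) (P : pred I) (F : I -> L) :
  (forall i, P i -> integral (F i)) -> integral (\sum_(i <- r | P i) F i).
Proof. by move=> h; elim/big_ind: _ => //; [apply: integral0 | apply: integralD]. Qed.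

Lemma integral_prod (I : Type) (r : seq I) (P : pred I) (F : I -> L) :
  (forall i, P i -> integral (F i)) -> integral (\prod_(i <- r | P i) F i).
Proof. by move=> h; elim/big_ind: _ => //; [apply: integral1 | apply: integralM]. Qed.

Lemma integral_horner (p : {poly int}) x :
  integral x -> integral (map_poly intr p).[x].
Proof.
move=> hx; rewrite horner_coef; apply: integral_sum => i _.
by rewrite coef_map; apply: integralM; [apply: integral_int | apply: integralX].
Qed.

Lemma integral_root_exp x k : (0 < k)%N -> integral (x ^+ k) -> integral x.
Proof.
move=> k0 [p [mp rp]]; exists (p \Po 'X^k); split.
  rewrite monicE lead_coef_comp; last by rewrite size_polyXn.
  by rewrite (monicP mp) mul1r lead_coefXn expr1n.
by rewrite map_comp_poly rootE horner_comp map_polyXn hornerXn -rootE.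
Qed.

Lemma integral_Aint (s : {rmorphism L -> algC}) x : integral x -> s x \in Aint.
Proof.
case=> p [mp rp]; apply: (@root_monic_Aint (map_poly intr p)).
- have ->: map_poly intr p = map_poly s (map_poly intr p) :> {poly algC}.
    by rewrite -map_poly_comp; apply: eq_map_poly => z /=; rewrite rmorph_int.
  by rewrite fmorph_root.
- exact: monic_map.
- by apply/polyOverP => i; rewrite coef_map /=; apply: intr_int.
Qed.

(* Strip powers of the variable off a monic relation: the constant term is then nonzero and
   divisible by [x]. *)
Lemma integral_dvd_int x : integral x -> x != 0 ->
  exists (y : L) (k : nat), [/\ integral y, (0 < k)%N & x * y = k%:R].
Proof.
move=> hx x0; have [p [mp rp]] := hx.
have [n] := ubnP (size p); elim: n p mp rp => // n IH p mp rp szp.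
have hp : p = (p`_0)%:P + 'X * (Poly (behead p)).
  apply/polyP=> i; rewrite coefD coefC coefXM; case: i => [|i] /=.
    by rewrite addr0.
  by rewrite add0r coef_Poly nth_behead.
set r := Poly _ in hp.
have [c0|c0] := eqVneq p`_0 0.
  have hp' : p = r * 'X by rewrite {1}hp c0 add0r mulrC.
  apply: (IH r).
  - by move: mp; rewrite hp' monicMr ?monicX.
  - move: rp; rewrite hp' rmorphM /= map_polyX rootM => /orP[//|].
    by rewrite rootE hornerX (negPf x0).
  - have r0 : r != 0 by apply/eqP => r0; move: (monic_neq0 mp); rewrite hp' r0 mul0r eqxx.
    by move: szp; rewrite {1}hp' size_mulX.
have e : x * (map_poly intr r).[x] = - (p`_0)%:~R.
  apply/eqP; rewrite -addr_eq0; move: rp; rewrite {1}hp rmorphD rmorphM /= map_polyC map_polyX.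
  by rewrite rootE hornerD hornerM hornerX hornerC addrC.
have hr : integral (map_poly intr r).[x] by apply: integral_horner.
case: (intP p`_0) e c0 => [|k|k] e //= _.
- by exists (- (map_poly intr r).[x]), k.+1; split=> //; [apply: integralN | rewrite mulrN e opprK].
- by exists (map_poly intr r).[x], k.+1; split=> //; rewrite e mulrNz opprK.
Qed.

End Integral.

(** * Matrices of conjugates *)

Section Embeddings.
Variables (L : fieldExtType rat) (N : nat).
Hypothesis dimL : \dim {:L} = N.
Variables (sg : 'I_N -> {rmorphism L -> algC}) (th : L).
Hypothesis inj_th : injective (fun k => sg k th).

Definition embmx (M : nat) (b : 'I_M -> L) : 'M[algC]_(M, N) := \matrix_(i, k) sg k (b i).

Lemma embmx_powers_unit : embmx (fun i : 'I_N => th ^+ i) \in unitmx.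
Proof.
rewrite unitmxE; set V := embmx _.
have -> : V = Vandermonde N (\row_k sg k th).
  by apply/matrixP => i k; rewrite !mxE rmorphXn.
rewrite det_Vandermonde unitfE; apply/prodf_neq0 => i _.
apply/prodf_neq0 => j ij; rewrite !mxE subr_eq0.
by apply: contraTneq ij => /inj_th ->; rewrite ltnn.
Qed.

Lemma emb_scale (r : rat) (x : L) (s : {rmorphism L -> algC}) : s (r *: x) = ratr r * s x.
Proof.
rewrite -[r *: x]mulr_algl rmorphM; congr (_ * _).
have := fmorph_eq_rat (GRing.RMorphism.clone _ _ (s \o (in_alg L)) _) r.
by move=> /= <-.
Qed.

Lemma embmx_comb (M : nat) (b : 'I_M -> L) (c : 'I_M -> rat) k :
  sg k (\sum_i c i *: b i) = \sum_i ratr (c i) * embmx b i k.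
Proof. by rewrite rmorph_sum; apply: eq_bigr => i _; rewrite emb_scale mxE. Qed.

(** The embeddings carry a rational relation between the [b i] to a relation between the rows of an
    invertible matrix; so the [b i] are free, and there are [N] of them. *)
Lemma embmx_basis (b : 'I_N -> L) : embmx b \in unitmx ->
  forall x, exists c : 'I_N -> rat, x = \sum_i c i *: b i.
Proof.
move=> ub x.
have fr : free [tuple b i | i < N].
  apply/freeP => c; set s := \sum_i _ => s0.
  have s1 : \sum_i c i *: b i = 0.
    by rewrite -[RHS]s0; apply: eq_bigr => i _; rewrite -tnth_nth tnth_mktuple.
  have : (\row_i ratr (c i)) *m embmx b = 0.
    apply/rowP => k; have := congr1 (sg k) s1; rewrite embmx_comb rmorph0 !mxE => s2.
    by rewrite -[RHS]s2; apply: eq_bigr => i _; rewrite !mxE.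
  move/(congr1 (mulmx^~ (invmx (embmx b)))); rewrite mulmxK // mul0mx => /rowP h i.
  by have := h i; rewrite !mxE => /eqP; rewrite fmorph_eq0 => /eqP.
have bs : basis_of fullv [tuple b i | i < N].
  by rewrite basisEfree fr subvf /= dimL size_map size_enum_ord.
exists (fun i => coord [tuple b i | i < N] i x).
rewrite {1}(coord_basis bs (memvf x)); apply: eq_bigr => i _.
by rewrite -tnth_nth tnth_mktuple.
Qed.

End Embeddings.

(** * Trace, norm and integral bases *)

(** [A] and [S] share the cofactors of row [i], and against these the rows of [S] other than the
    [i]-th vanish. It serves to exchange one element of a basis. *)
Lemma det_row_comb (F : comRingType) (n : nat) (A S : 'M[F]_n) (i : 'I_n) (c : 'I_n -> F) :
  (forall j k, j != i -> A j k = S j k) -> (forall k, A i k = \sum_j c j * S j k) ->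
  \det A = c i * \det S.
Proof.
move=> hA hi; rewrite (expand_det_row A i).
have hc k : cofactor A i k = cofactor S i k.
  rewrite /cofactor; congr (_ * \det _); apply/matrixP => j m.
  by rewrite !mxE hA // eq_sym neq_lift.
transitivity (\sum_j c j * (S *m \adj S) j i).
  under eq_bigr => k _ do rewrite hi hc mulr_suml.
  rewrite exchange_big /=; apply: eq_bigr => j _; rewrite mxE mulr_sumr.
  by apply: eq_bigr => k _; rewrite mulrA !mxE.
rewrite mul_mx_adj (bigD1 i) //= big1 => [|j ji]; last by rewrite mxE (negPf ji) mulr0.
by rewrite mxE eqxx addr0.
Qed.

Section TraceNorm.
Variables (L : fieldExtType rat) (N : nat).
Hypothesis dimL : \dim {:L} = N.
Variables (sg : 'I_N -> {rmorphism L -> algC}) (th : L).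
Hypothesis inj_th : injective (fun k => sg k th).

Let emb := embmx sg.

(** Multiplication by [x] is diagonalised by the embeddings: the conjugates of a basis under [sg k]
    form an eigenvector for the eigenvalue [sg k x]. Trace and norm are read off from this. *)
Lemma mulmx_emb x : exists (M : 'M[rat]_N) (S : 'M[algC]_N),
  [/\ S \in unitmx, map_mx ratr M = S *m diag_mx (\row_k sg k x) *m invmx S & \tr M = trace x].
Proof.
pose vb := vbasis {:L}.
have comb y : y = \sum_(j < \dim {:L}) coord vb j y *: tnth vb j.
  rewrite {1}(coord_vbasis (memvf y)); apply: eq_bigr => j _.
  by rewrite (tnth_nth 0).
pose M := \matrix_(i, j) coord vb j (x * tnth vb i).
pose S := embmx sg (tnth vb).
pose T := \matrix_(i < N, j < \dim {:L}) ratr (coord vb j (th ^+ i)) : 'M[algC]_(_, _).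
have hT : emb (fun i : 'I_N => th ^+ i) = T *m S.
  apply/matrixP => i k; rewrite !mxE {1}(comb (th ^+ i)) embmx_comb.
  by apply: eq_bigr => j _; rewrite [T _ _]mxE.
have hM : map_mx ratr M *m S = S *m diag_mx (\row_k sg k x).
  rewrite mul_mx_diag; apply/matrixP => i k.
  have := embmx_comb sg (tnth vb) (fun j => M i j) k.
  have -> : \sum_j M i j *: tnth vb j = x * tnth vb i.
    by rewrite [RHS]comb; apply: eq_bigr => j _; rewrite [M _ _]mxE.
  rewrite rmorphM => h; rewrite [RHS]mxE [S _ _]mxE [X in _ * X]mxE mulrC h mxE.
  by apply: eq_bigr => j _; rewrite [X in X * _]mxE.
have trM : \tr M = trace x by apply: eq_bigr => i _; rewrite mxE.
have uT := embmx_powers_unit inj_th.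
rewrite -/emb hT in uT.
(* The matrices are indexed by [\dim {:L}]; once the basis is forgotten, [dimL] turns them into
   matrices of size [N]. *)
clear comb hT; clearbody M S T; clear vb; move: M S T hM trM uT.
rewrite dimL => M S T hM trM uT; exists M, S.
have uS : S \in unitmx by move: uT; rewrite unitmx_mul => /andP[].
by split=> //; rewrite -hM mulmxK.
Qed.

Lemma trace_emb (x : L) : ratr (trace x) = \sum_k sg k x :> algC.
Proof.
have [M [S [uS hM <-]]] := mulmx_emb x.
rewrite -trace_map_mx hM mxtrace_mulC mulmxA mulVmx // mul1mx mxtrace_diag.
by apply: eq_bigr => k _; rewrite mxE.
Qed.

Definition Nm (x : L) : algC := \prod_k sg k x.

Lemma NmM x y : Nm (x * y) = Nm x * Nm y.
Proof. by rewrite /Nm -big_split; apply: eq_bigr => k _; rewrite rmorphM. Qed.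

Lemma Nm_eq0 x : (Nm x == 0) = (x == 0).
Proof.
have N0 : (0 < N)%N by rewrite -dimL adim_gt0.
apply/idP/eqP => [/prodf_eq0 [k _]|->]; first by rewrite fmorph_eq0 => /eqP.
by rewrite /Nm (bigD1 (Ordinal N0)) //= rmorph0 mul0r.
Qed.

Lemma Nm_rat x : Nm x \in Crat.
Proof.
have [M [S [uS hM _]]] := mulmx_emb x.
apply/CratP; exists (\det M); rewrite -det_map_mx hM !det_mulmx mulrAC -det_mulmx.
rewrite mulmxV // det1 mul1r det_diag.
by apply: eq_bigr => k _; rewrite mxE.
Qed.

Lemma Nm_int (x : L) : integral x -> Nm x \in Num.int.
Proof.
move=> hx; apply: Cint_rat_Aint; first exact: Nm_rat.
by apply: rpred_prod => k _; apply: integral_Aint.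
Qed.

Lemma trace_int (x : L) : integral x -> trace x \in Num.int.
Proof.
move=> hx; have : ratr (trace x) \in (Num.int : {pred algC}).
  apply: Cint_rat_Aint; first by apply: Crat_rat.
  by rewrite trace_emb; apply: rpred_sum => k _; apply: integral_Aint.
by case/intrP => z; rewrite -[z%:~R](rmorph_int (@ratr algC)) => /fmorph_inj ->; apply: intr_int.
Qed.

Lemma integral_small (x : L) : integral x -> `|Nm x| < 1 -> x = 0.
Proof.
move=> hx h; apply/eqP; rewrite -Nm_eq0; have := Nm_int hx.
case/intrP => z hz; move: h; rewrite hz -intr_norm -[1]/(1%:~R) ltr_int intr_eq0.
by case: z {hz} => [[|k]|k].
Qed.

Lemma integral_Nm_ge1 (x : L) : integral x -> x != 0 -> 1 <= `|Nm x|.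
Proof.
move=> hx x0; rewrite real_leNgt ?realE ?normr_ge0 ?ler01 //.
by apply: contra x0 => /(integral_small hx) ->.
Qed.

Definition tracemx (b : 'I_N -> L) := \matrix_(i, j) trace (b i * b j).

Lemma tracemx_emb b : ratr (\det (tracemx b)) = \det (emb b) ^+ 2.
Proof.
rewrite -det_map_mx expr2 -[X in _ = _ * X]det_tr -det_mulmx; congr (\det _).
apply/matrixP => i j; rewrite !mxE -[LHS]/(ratr (trace _)) trace_emb; apply: eq_bigr => k _.
by rewrite !mxE rmorphM.
Qed.

(** Descent on [|\det (emb b)| ^+ 2], which is a natural number. If an integral [x] has a coordinate
    [r i] that is not an integer, replacing [b0 i] by [x - floor (r i) * b0 i] multiplies the
    determinant by the fractional part of [r i], strictly between 0 and 1. *)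
Lemma integral_basis (b0 : 'I_N -> L) :
    (forall i, integral (b0 i)) -> emb b0 \in unitmx ->
  exists b : 'I_N -> L, [/\ forall i, integral (b i), emb b \in unitmx,
    forall x, integral x -> exists z : 'I_N -> int, x = \sum_i (z i)%:~R * b i &
    `|\det (emb b)| ^+ 2 <= `|\det (emb b0)| ^+ 2].
Proof.
move=> hb0 ub0.
have disc_int b : (forall i, integral (b i)) -> {k : nat | `|\det (emb b)| ^+ 2 = k%:R}.
  move=> hb; apply: cid; rewrite -normrX -tracemx_emb.
  have /intrP[z ->] : \det (tracemx b) \in Num.int.
    rewrite /determinant rpred_sum // => s _; rewrite rpredMsign rpred_prod // => i _.
    by rewrite mxE; apply: trace_int; apply: integralM.
  by exists `|z|%N; rewrite rmorph_int natr_absz intr_norm.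
have [k hk] := disc_int _ hb0.
have [n] := ubnP k; elim: n k b0 hb0 ub0 hk => // n IH k b0 hb0 ub0 hk lekn.
have [?|] := pselect (forall x, integral x -> exists z : 'I_N -> int, x = \sum_i (z i)%:~R * b0 i).
  by exists b0; split.
move/existsNP => [x /not_implyP[hx hz]].
have [r hr] := embmx_basis dimL ub0 x.
have [i hi] : exists i, r i \isn't a Num.int.
  apply: contrapT => h; apply: hz.
  have h2 i : exists z : int, r i = z%:~R.
    apply/intrP; apply: contrapT => /negP h3; by apply: h; exists i.
  have [z hz] := choice h2; exists z; rewrite hr; apply: eq_bigr => i _.
  by rewrite hz scaler_int mulrzl.
set f := Num.floor (r i).
pose b1 j := if j == i then x - f%:~R * b0 i else b0 j.
have hb1 j : integral (b1 j).
  rewrite /b1; case: eqP => _ //; apply: integralB => //.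
  by apply: integralM => //; apply: integral_int.
have det1 : \det (emb b1) = ratr (r i - f%:~R) * \det (emb b0).
  pose c j : algC := ratr (r j - (f *+ (j == i))%:~R).
  have := @det_row_comb _ _ (emb b1) (emb b0) i c.
  rewrite /c eqxx mulr1n; apply => [j m ji|m].
    by rewrite !mxE /b1 (negPf ji).
  rewrite mxE /b1 eqxx rmorphB rmorphM hr embmx_comb rmorph_int.
  under [RHS]eq_bigr => j _ do rewrite rmorphB mulrBl.
  rewrite sumrB; congr (_ - _); rewrite (bigD1 i) //= eqxx mulr1n big1 => [|j ji].
    by rewrite addr0 !mxE rmorph_int.
  by rewrite (negPf ji) mulr0n rmorph0 mul0r.
have lo : 0 < r i - f%:~R.
  rewrite subr_gt0 lt_neqAle floor_le andbT.
  by apply: contra hi => /eqP <-; apply: intr_int.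
have hi1 : r i - f%:~R < 1.
  by rewrite ltrBlDr addrC -{2}[1]/(1%:~R) -intrD floorD1_gt.
have ub1 : emb b1 \in unitmx.
  rewrite unitmxE det1 unitfE mulf_neq0 //; first by rewrite fmorph_eq0 lt0r_neq0.
  by rewrite -unitfE -unitmxE.
have [k1 hk1] := disc_int _ hb1.
have le1 : `|\det (emb b1)| ^+ 2 < `|\det (emb b0)| ^+ 2.
  rewrite det1 normrM exprMn gtr_pMl; last first.
    by rewrite exprn_gt0 // normr_gt0 -unitfE -unitmxE.
  by rewrite ger0_norm ?ler0q ?ltW // exprn_ilt1 ?ler0q ?ltW // -[X in _ < X](rmorph1 (@ratr algC)) ltr_rat.
have ltk : (k1 < n)%N.
  by apply: (@leq_trans k) => //; rewrite -(ltr_nat algC) -hk -hk1.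
have [b [hb ub spb leb]] := IH _ _ hb1 ub1 hk1 ltk.
by exists b; split=> //; apply: (le_trans leb); apply: ltW.
Qed.

End TraceNorm.

Lemma is_disc_exists (L : fieldExtType rat) (N : nat) (sg : 'I_N -> {rmorphism L -> algC})
    (th : L) (b0 : 'I_N -> L) :
  \dim {:L} = N -> injective (fun k => sg k th) ->
  (forall i, integral (b0 i)) -> embmx sg b0 \in unitmx ->
  exists d : rat, is_disc L d /\ `|ratr d| <= `|\det (embmx sg b0)| ^+ 2 :> algC.
Proof.
move=> dimL inj_th hb0 ub0.
have [b [hb ub spb leb]] := integral_basis dimL inj_th hb0 ub0.
move: leb; rewrite -(normrX _ (\det (embmx sg b))) -(tracemx_emb dimL inj_th) => leb.
exists (\det (tracemx b)); split=> //.
(* [is_disc] indexes its bases by [\dim {:L}], so [N] is replaced by that expression. *)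
by case: N / dimL sg inj_th b0 hb0 ub0 b hb ub spb leb => sg _ b0 _ _ b hb _ spb _; exists b; split.
Qed.

(** * Ideals and ideal classes *)

Section Ideals.
Variable L : fieldExtType rat.
Local Notation integral := (@integral L).
Implicit Types I J K : L -> Prop.

Definition smul (a : L) I : L -> Prop := fun x => exists y, I y /\ x = a * y.

Lemma pred_ext I J : (forall x, I x <-> J x) -> I = J.
Proof. by move=> h; apply: funext => x; apply: propext. Qed.

Lemma principalE I : principal I <-> exists a, I = smul a integral.
Proof. by split=> -[a h]; exists a; [apply: pred_ext | rewrite h]. Qed.

Lemma ideal_equivE I J : ideal_equiv I J <->
  exists a b, [/\ integral a, integral b, a != 0, b != 0 & smul a I = smul b J].
Proof.
split=> -[a [b [ha hb a0 b0 h]]]; exists a, b; split=> //; first exact: pred_ext.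
by move=> x; rewrite -[X in X <-> _]/(smul a I x) h.
Qed.

Lemma smulM a b I : smul a (smul b I) = smul (a * b) I.
Proof.
apply: pred_ext => x; split=> [[_ [[y [hy ->]] ->]]|[y [hy ->]]].
  by exists y; rewrite mulrA.
by exists (b * y); split; [exists y | rewrite mulrA].
Qed.

Lemma smul1 I : smul 1 I = I.
Proof.
by apply: pred_ext => x; split=> [[y [hy ->]]|h]; [rewrite mul1r | exists x; rewrite mul1r].
Qed.

Lemma smulV a I J : a != 0 -> smul a I = J <-> I = smul a^-1 J.
Proof.
by move=> a0; split=> [<-|->]; rewrite smulM ?mulVf ?mulfV // smul1.
Qed.

Lemma mul_mem I J x y : I x -> J y -> ideal_mul I J (x * y).
Proof. by move=> hx hy; exists 1, (fun=> x), (fun=> y); rewrite big_ord1. Qed.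

Lemma mul_mem0 I J : ideal_mul I J 0.
Proof. by exists 0, (fun=> 0), (fun=> 0); rewrite big_ord0; split=> [[]|] //; split=> [[]|]. Qed.

Lemma mul_memD I J x y : ideal_mul I J x -> ideal_mul I J y -> ideal_mul I J (x + y).
Proof.
move=> [m [u [v [hu [hv ->]]]]] [m' [u' [v' [hu' [hv' ->]]]]].
pose c (f : 'I_m -> L) (f' : 'I_m' -> L) (i : 'I_(m + m')) :=
  match split i with inl j => f j | inr j => f' j end.
exists (m + m')%N, (c u u'), (c v v'); split; first by move=> i; rewrite /c; case: split.
split; first by move=> i; rewrite /c; case: split.
rewrite big_split_ord /=; congr (_ + _); apply: eq_bigr => i _.
  by rewrite /c (unsplitK (inl i)).
by rewrite /c (unsplitK (inr i)).
Qed.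

Lemma mul_ind I J (P : L -> Prop) :
  P 0 -> (forall x y, P x -> P y -> P (x + y)) -> (forall x y, I x -> J y -> P (x * y)) ->
  forall z, ideal_mul I J z -> P z.
Proof.
by move=> P0 PD PM z [m [u [v [hu [hv ->]]]]]; elim/big_ind: _ => // i _; apply: PM.
Qed.

Lemma ideal_mulC I J : ideal_mul I J = ideal_mul J I.
Proof.
by apply: pred_ext => x; split; apply: mul_ind; try exact: mul_mem0; try exact: mul_memD;
  move=> u v hu hv; rewrite mulrC; apply: mul_mem.
Qed.

Lemma ideal_mulA I J K : ideal_mul I (ideal_mul J K) = ideal_mul (ideal_mul I J) K.
Proof.
apply: pred_ext => x; split.
  apply: mul_ind; [exact: mul_mem0|exact: mul_memD|move=> u v hu].
  elim/mul_ind: v / => [|v v' h h'|v v' hv hv']; first by rewrite mulr0; apply: mul_mem0.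
    by rewrite mulrDr; apply: mul_memD.
  by rewrite mulrA; do 2!apply: mul_mem => //.
apply: mul_ind; [exact: mul_mem0|exact: mul_memD|move=> v u hv hu].
move: hv; elim/mul_ind: v / => [|v v' h h'|v v' hv hv'].
- by rewrite mul0r; apply: mul_mem0.
- by rewrite mulrDl; apply: mul_memD.
- by rewrite -mulrA; do 2!apply: mul_mem => //.
Qed.

Lemma smul_mul a I J : smul a (ideal_mul I J) = ideal_mul (smul a I) J.
Proof.
apply: pred_ext => x; split.
  case=> y [hy ->{x}]; elim/mul_ind: y / hy => [|u v h h'|u v hu hv].
  - by rewrite mulr0; apply: mul_mem0.
  - by rewrite mulrDr; apply: mul_memD.
  - by rewrite mulrA; apply: mul_mem => //; exists u.
apply: mul_ind.
- by exists 0; rewrite mulr0; split=> //; apply: mul_mem0.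
- move=> _ _ [u [hu ->]] [v [hv ->]]; exists (u + v); rewrite mulrDr; split=> //.
  exact: mul_memD.
- move=> _ v [u [hu ->]] hv; exists (u * v); rewrite mulrA; split=> //; exact: mul_mem.
Qed.

Lemma ideal_integral : ideal integral.
Proof.
split; [by []|exact: integral0|exact: integralD|exact: integralM|].
by exists 1; split; [exact: integral1 | exact: oner_neq0].
Qed.

Lemma ideal_mulO I : ideal I -> ideal_mul I integral = I.
Proof.
case=> sI I0 ID IM _; apply: pred_ext => x; split.
  by apply: mul_ind => // u v hu hv; rewrite mulrC; apply: IM.
by move=> hx; rewrite -[x]mulr1; apply: mul_mem => //; apply: integral1.
Qed.

Lemma ideal_mul_ideal I J : ideal I -> ideal J -> ideal (ideal_mul I J).
Proof.
case=> sI I0 ID IM [x [hx x0]] [sJ J0 JD JM [y [hy y0]]]; split.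
- apply: (@mul_ind _ _ integral); [exact: integral0|exact: integralD|].
  by move=> u v hu hv; apply: integralM; [apply: sI | apply: sJ].
- exact: mul_mem0.
- exact: mul_memD.
- move=> a z ha; elim/mul_ind: z / => [|u v h h'|u v hu hv].
  + by rewrite mulr0; apply: mul_mem0.
  + by rewrite mulrDr; apply: mul_memD.
  + by rewrite mulrA; apply: mul_mem => //; apply: IM.
- by exists (x * y); rewrite mulf_neq0 //; split=> //; apply: mul_mem.
Qed.

Lemma ideal_exp_ideal I k : ideal I -> ideal (ideal_exp I k).
Proof.
move=> hI; elim: k => [|k IH]; first exact: ideal_integral.
exact: ideal_mul_ideal.
Qed.

Lemma ideal_expS I k : ideal_exp I k.+1 = ideal_mul I (ideal_exp I k).
Proof. by []. Qed.

Lemma ideal_expD I j k : ideal I ->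
  ideal_exp I (j + k) = ideal_mul (ideal_exp I j) (ideal_exp I k).
Proof.
move=> hI; elim: j => [|j IH]; last by rewrite addSn !ideal_expS IH ideal_mulA.
by rewrite add0n ideal_mulC ideal_mulO //; apply: ideal_exp_ideal.
Qed.

Lemma ideal_expM_smul I j k a : ideal I -> ideal_exp I j = smul a integral ->
  ideal_exp I (j * k) = smul (a ^+ k) integral.
Proof.
move=> hI hj; elim: k => [|k IH]; first by rewrite muln0 expr0 smul1.
rewrite mulnS ideal_expD // IH hj -smul_mul ideal_mulC -smul_mul smulM.
by rewrite ideal_mulO ?exprS //; apply: ideal_integral.
Qed.

Lemma ideal_equiv_refl I : ideal_equiv I I.
Proof.
by apply/ideal_equivE; exists 1, 1; split; rewrite ?oner_neq0 //; apply: integral1.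
Qed.

Lemma ideal_equiv_sym I J : ideal_equiv I J -> ideal_equiv J I.
Proof. by move=> /ideal_equivE[a [b [*]]]; apply/ideal_equivE; exists b, a. Qed.

Lemma ideal_equiv_trans J I K : ideal_equiv I J -> ideal_equiv J K -> ideal_equiv I K.
Proof.
move=> /ideal_equivE[a [b [ha hb a0 b0 h]]] /ideal_equivE[c [d [hc hd c0 d0 h']]].
apply/ideal_equivE; exists (c * a), (b * d); split; rewrite ?mulf_neq0 //; try exact: integralM.
by rewrite -smulM h smulM mulrC -!smulM h'.
Qed.

Lemma ideal_equiv_mul I J K : ideal_equiv J K -> ideal_equiv (ideal_mul I J) (ideal_mul I K).
Proof.
move=> /ideal_equivE[a [b [ha hb a0 b0 h]]]; apply/ideal_equivE; exists a, b; split=> //.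
by rewrite ![ideal_mul I _]ideal_mulC !smul_mul h.
Qed.

Lemma smul_ideal a I : ideal I -> a != 0 -> (forall x, I x -> integral (a * x)) ->
  ideal (smul a I).
Proof.
case=> sI I0 ID IM [x [hx x0]] a0 h; split.
- by move=> _ [y [hy ->]]; apply: h.
- by exists 0; rewrite mulr0.
- by move=> _ _ [u [hu ->]] [v [hv ->]]; exists (u + v); rewrite mulrDr; split=> //; apply: ID.
- by move=> b _ hb [u [hu ->]]; exists (b * u); rewrite mulrCA; split=> //; apply: IM.
- by exists (a * x); rewrite mulf_neq0 //; split=> //; exists x.
Qed.

Lemma idealN I x : ideal I -> I x -> I (- x).
Proof.
case=> _ _ _ IM _ hx; rewrite -mulN1r; apply: IM => //; apply: integralN; exact: integral1.
Qed.

Lemma ideal_nat I : ideal I -> exists k, (0 < k)%N /\ I k%:R.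
Proof.
case=> sI I0 ID IM [x [hx x0]]; have [y [k [hy k0 e]]] := integral_dvd_int (sI _ hx) x0.
by exists k; split=> //; rewrite -e mulrC; apply: IM.
Qed.

End Ideals.

Lemma pigeonhole (T T' : finType) (f : T -> T') : (#|T'| < #|T|)%N ->
  exists x y, x != y /\ f x = f y.
Proof.
move=> h; have /injectivePn[x [y xy e]] : ~~ injectiveb f.
  by apply: contraL h => /injectiveP/leq_card; rewrite leqNgt.
by exists x, y.
Qed.

(** Equal codes imply equivalence, so the codes attained on [P], each with a chosen preimage [f c],
    meet all classes. The map [r] sends a code to a canonical equivalent one, and its fixed points
    index the representatives. It is applied to ideals and again to the fields of the family. *)
Lemma finite_classes (X : Type) (E : X -> X -> Prop) (P : X -> Prop) (T : finType) (code : X -> T) :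
  (forall x, E x x) -> (forall x y, E x y -> E y x) ->
  (forall y x z, E x y -> E y z -> E x z) ->
  (forall x y, P x -> P y -> code x = code y -> E x y) ->
  exists (h : nat) (rep : 'I_h -> X),
    [/\ forall i, P (rep i), forall i j, E (rep i) (rep j) -> i = j &
        forall x, P x -> exists i, E x (rep i)].
Proof.
move=> Er Es Et hcode.
have [[x0 Px0]|nP] := pselect (exists x, P x); last first.
  have f0 : 'I_0 -> X by case.
  by exists 0, f0; split=> [[]|[]|x Px] //; case: nP; exists x.
pose A := [set c | `[< exists x, P x /\ code x = c >]].
have hf c : exists x, P x /\ (c \in A -> code x = c).
  rewrite inE; case: asboolP => [[x [Px <-]]|_]; first by exists x.
  by exists x0.
have {hf} [f hf] := choice hf.
pose r c := odflt c [pick c' in A | `[< E (f c) (f c') >]].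
have rA c : c \in A -> r c \in A /\ E (f c) (f (r c)).
  move=> cA; rewrite /r; case: pickP => [c' /andP[c'A /asboolP] //|/(_ c)].
  by rewrite cA; move/asboolP.
have rE c c' : c \in A -> E (f c) (f c') -> r c = r c'.
  move=> cA e; rewrite /r.
  rewrite (@eq_pick _ _ (fun d => (d \in A) && `[< E (f c') (f d) >])).
    by case: pickP => // /(_ c); rewrite cA /=; move/asboolP; case; apply: Es.
  move=> d /=; congr (_ && _); apply/asboolP/asboolP; last exact: Et.
  by apply: Et; apply: Es.
pose R := [set c in A | r c == c].
exists #|R|, (fun i => f (enum_val i)); split.
- by move=> i; case: (hf (enum_val i)).
- move=> i j e; have := enum_valP i; rewrite [in X in X -> _]inE => /andP[iA /eqP ri].
  have := enum_valP j; rewrite [in X in X -> _]inE => /andP[jA /eqP rj].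
  by apply: enum_val_inj; rewrite -ri -rj; apply: rE.
- move=> x Px; have cA : code x \in A by rewrite inE; apply/asboolP; exists x.
  have [rcA rcE] := rA _ cA.
  have cR : r (code x) \in R by rewrite inE rcA -(rE _ _ cA rcE) eqxx.
  exists (enum_rank_in cR (r (code x))); rewrite enum_rankK_in //.
  apply: Et rcE; have [Pf cf] := hf (code x).
  by apply: hcode => //; rewrite cf.
Qed.

(** * Finiteness of the class number *)

Lemma ext_natr_eq0 (L : fieldExtType rat) (k : nat) : (k%:R == 0 :> L) = (k == 0%N).
Proof. by rewrite -(rmorph_nat (in_alg L)) fmorph_eq0 pnatr_eq0. Qed.

Lemma absz_modz_lt (z : int) (F : nat) : (0 < F)%N -> (`|(z %% F%:Z)%Z| < F)%N.
Proof. by move=> F0; have := @ltz_mod z F%:Z; have := @modz_ge0 z F%:Z; lia. Qed.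

Lemma integral_stable (L : fieldExtType rat) (r : nat) (j : 'I_r -> L) (x : L)
    (c : 'I_r -> 'I_r -> int) :
  (exists i, j i != 0) -> (forall i, x * j i = \sum_k (c i k)%:~R * j k) -> integral x.
Proof.
move=> [i0 hi0] hc; pose C := \matrix_(k, i) c i k.
exists (char_poly C); split; first exact: char_poly_monic.
rewrite map_char_poly -eigenvalue_root_char; apply/eigenvalueP.
exists (\row_i j i); last by apply/eqP => /rowP/(_ i0)/eqP; rewrite !mxE (negPf hi0).
apply/rowP => i; rewrite !mxE hc; apply: eq_bigr => k _.
by rewrite !mxE mulrC.
Qed.

(* Nakayama: [det (1 - C)] kills [j] and is congruent to [1] modulo [B]. *)
Lemma ideal_mul_eq_one (L : fieldExtType rat) (r : nat) (j : 'I_r -> L) (B : L -> Prop)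
    (c : 'I_r -> 'I_r -> L) :
  ideal B -> (exists i, j i != 0) -> (forall i k, B (c i k)) ->
  (forall i, j i = \sum_k c i k * j k) -> B 1.
Proof.
move=> hB [i0 hi0] hc hj; have [sB B0 BD BM _] := hB.
pose A := \matrix_(i, k) ((i == k)%:R - c i k).
pose v := \col_i j i.
have Av : A *m v = 0.
  apply/colP => i; rewrite !mxE; under eq_bigr => k _ do rewrite !mxE mulrBl.
  rewrite sumrB -hj (bigD1 i) //= eqxx mul1r big1 ?addr0 ?subrr // => k.
  by rewrite eq_sym => /negPf ->; rewrite mul0r.
have detA : \det A = 0.
  have : \adj A *m A *m v = 0 by rewrite -mulmxA Av mulmx0.
  rewrite mul_adj_mx mul_scalar_mx => /colP/(_ i0).
  by rewrite !mxE => /eqP; rewrite mulf_eq0 (negPf hi0) orbF => /eqP.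
(* Congruence modulo [B] between integral elements: it respects sums and products, so a determinant
   may be reduced entry by entry. *)
pose R x y := [/\ integral x, integral y & B (x - y)].
have Rx x : integral x -> R x x by split=> //; rewrite subrr.
have RD x1 x2 y1 y2 : R x1 x2 -> R y1 y2 -> R (x1 + y1) (x2 + y2).
  move=> [a1 a2 a] [b1 b2 b]; split; try exact: integralD.
  by rewrite opprD addrACA; apply: BD.
have RM x1 x2 y1 y2 : R x1 x2 -> R y1 y2 -> R (x1 * y1) (x2 * y2).
  move=> [a1 a2 a] [b1 b2 b]; split; try exact: integralM.
  have -> : x1 * y1 - x2 * y2 = y1 * (x1 - x2) + x2 * (y1 - y2) by ring.
  by apply: BD; apply: BM.
have : R (\det A) (\det (1%:M : 'M[L]_r)).
  rewrite /determinant; apply: (big_ind2 R) => [|x1 x2 y1 y2|s _]; first exact/Rx/integral0.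
    exact: RD.
  apply: (RM); first by apply/Rx/integralX/integralN/integral1.
  apply: (big_ind2 R) => [|x1 x2 y1 y2|i _]; [exact/Rx/integral1|exact: RM|].
  rewrite !mxE; split; [apply: integralB|exact: integral_nat|].
  - exact: integral_nat.
  - exact/sB/hc.
  - by rewrite addrAC subrr add0r; apply: idealN.
by rewrite detA det1 => -[_ _]; rewrite sub0r => /(idealN hB); rewrite opprK.
Qed.

Section ClassNumber.
Variables (L : fieldExtType rat) (N : nat).
Hypothesis dimL : \dim {:L} = N.
Variables (sg : 'I_N -> {rmorphism L -> algC}) (th : L).
Hypothesis inj_th : injective (fun k => sg k th).
Variable w : 'I_N -> L.
Hypothesis int_w : forall i, integral (w i).
Hypothesis unit_w : embmx sg w \in unitmx.
Hypothesis span_w : forall x, integral x -> exists z : 'I_N -> int, x = \sum_i (z i)%:~R * w i.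

Lemma emb_bound : exists C : nat, forall k, \sum_i `|sg k (w i)| <= C%:R.
Proof.
pose u (k i : 'I_N) := (Num.truncn `|sg k (w i)|).+1.
exists (\sum_k \sum_i u k i)%N => k.
rewrite natr_sum [X in _ <= X](bigD1 k) //= natr_sum; apply: ler_wpDr.
  by apply: sumr_ge0.
by apply: ler_sum => i _; apply: ltW; apply: real_truncnS_gt; apply: normr_real.
Qed.

(** Among [m ^ N + 1] multiples of [g], two have coordinates whose fractional parts lie in the same
    cube of side [1 / m]. Their difference [s * g] is then close to an integral [o], and each
    conjugate of [s * g - o] is at most [C / m], less than 1 since [m = C + 1]. *)
Lemma small_multiple : exists M : nat, forall g : L,
  exists (s : nat) (o : L), [/\ (0 < s <= M)%N, integral o & `|Nm sg (s%:R * g - o)| < 1].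
Proof.
have [C hC] := emb_bound; pose m := C.+1.
exists (m ^ N)%N => g; have [r ->] := embmx_basis dimL unit_w g.
pose fr (x : rat) := x - (Num.floor x)%:~R.
have fr_ge x : 0 <= fr x by rewrite subr_ge0 floor_le.
have fr_lt x : fr x < 1 by rewrite ltrBlDr addrC -[X in _ + X]/(1%:~R) -intrD floorD1_gt.
have cell_lt (x : rat) : (Num.truncn (m%:R * fr x) < m)%N.
  by rewrite truncn_lt_nat ?mulr_ge0 // gtr_pMr ?ltr0n.
pose cell (s : 'I_(m ^ N).+1) : {ffun 'I_N -> 'I_m} := [ffun i => Ordinal (cell_lt (s%:R * r i))].
have [s1 [s2 [s12 e12]]] : exists s1 s2, s1 != s2 /\ cell s1 = cell s2.
  by apply: pigeonhole; rewrite card_ffun !card_ord.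
wlog lt12 : s1 s2 s12 e12 / (s1 < s2)%N.
  move=> W; case: (ltngtP s1 s2) => [|l|/val_inj e]; first exact: W.
    by apply: (W s2 s1) => //; rewrite eq_sym.
  by rewrite e eqxx in s12.
pose d i := fr (s2%:R * r i) - fr (s1%:R * r i).
have hd i : `|d i| <= m%:R^-1.
  have := congr1 (fun f : {ffun 'I_N -> 'I_m} => val (f i)) e12; rewrite /cell !ffunE /= => e.
  have m0 : 0 < m%:R :> rat by rewrite ltr0n.
  have [a1 a2] : (Num.truncn (m%:R * fr (s1%:R * r i)))%:R <= m%:R * fr (s1%:R * r i) /\
     m%:R * fr (s1%:R * r i) < (Num.truncn (m%:R * fr (s1%:R * r i))).+1%:R.
    by split; [rewrite truncn_le ?mulr_ge0 | apply: truncnS_gt].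
  have [b1 b2] : (Num.truncn (m%:R * fr (s2%:R * r i)))%:R <= m%:R * fr (s2%:R * r i) /\
     m%:R * fr (s2%:R * r i) < (Num.truncn (m%:R * fr (s2%:R * r i))).+1%:R.
    by split; [rewrite truncn_le ?mulr_ge0 | apply: truncnS_gt].
  rewrite -(ler_pM2l m0) mulfV ?gt_eqF // -{1}(ger0_norm (ltW m0)) -normrM /d mulrBr.
  rewrite -e in b1 b2; rewrite -natr1 in a2 b2.
  by rewrite ler_norml; apply/andP; split; lra.
pose o := \sum_i (Num.floor (s2%:R * r i) - Num.floor (s1%:R * r i))%:~R * w i.
exists (s2 - s1)%N, o; split.
- by rewrite subn_gt0 lt12 /=; apply: leq_trans (leq_subr _ _) _; rewrite -ltnS.
- by apply: integral_sum => i _; apply: integralM => //; apply: integral_int.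
have -> : (s2 - s1)%:R * (\sum_i r i *: w i) - o = \sum_i d i *: w i.
  rewrite mulr_sumr -sumrB; apply: eq_bigr => i _.
  rewrite -[r i *: w i]mulr_algl mulrA -mulrBl -[RHS]mulr_algl; congr (_ * _).
  rewrite -(rmorph_nat (in_alg L)) -rmorphM -(rmorph_int (in_alg L)) -rmorphB; congr (in_alg L _).
  by rewrite /d /fr natrB ?(ltnW lt12) // intrD intrN; ring.
rewrite /Nm normr_prod.
have hk k : `|sg k (\sum_i d i *: w i)| <= C%:R / m%:R.
  rewrite embmx_comb; apply: le_trans (ler_norm_sum _ _ _) _.
  apply: le_trans (_ : \sum_i m%:R^-1 * `|sg k (w i)| <= _); last first.
    by rewrite -mulr_sumr mulrC ler_pM2r ?invr_gt0 ?ltr0n.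
  apply: ler_sum => i _; rewrite normrM mxE ler_wpM2r //.
  by have := hd i; rewrite -(ler_rat algC) fmorphV rmorph_nat ratr_norm.
apply: le_lt_trans (_ : \prod_(k < N) (C%:R / m%:R) < _).
  by apply: ler_prod => k _; rewrite normr_ge0 hk.
rewrite prodr_const card_ord exprn_ilt1 //; first by rewrite -lt0n -dimL adim_gt0.
  by rewrite divr_ge0.
by rewrite ltr_pdivrMr ?ltr0n // mul1r ltr_nat.
Qed.

(* Hurwitz: if [be] has minimal norm in [J], then [M`! * J] is contained in [(be)]. *)
Lemma ideal_equiv_bounded : exists F : nat, (0 < F)%N /\ forall J, ideal J ->
  exists B : L -> Prop, [/\ ideal B, B F%:R & ideal_equiv J B].
Proof.
have [M hM] := small_multiple; exists (M`!)%N; split=> [|J hJ]; first exact: fact_gt0.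
have [sJ J0 JD JM [x0 [hx0 nx0]]] := hJ.
have Nm_nat x : exists k : nat, J x -> `|Nm sg x| = k%:R.
  have [hx|] := pselect (J x); last by exists 0.
  have /intrP[z hz] := Nm_int dimL inj_th (sJ _ hx).
  by exists `|z|%N; rewrite hz natr_absz intr_norm.
have {Nm_nat} [nm hnm] := choice Nm_nat.
have [b [hb nb minb]] : exists b, [/\ J b, b != 0 & forall x, J x -> x != 0 -> (nm b <= nm x)%N].
  have [n] := ubnP (nm x0); elim: n x0 hx0 nx0 => // n IH x hx nx ltn.
  have [?|] := pselect (forall y, J y -> y != 0 -> (nm x <= nm y)%N); first by exists x.
  move/existsNP => [y /not_implyP[hy /not_implyP[ny /negP]]]; rewrite -ltnNge => lt.
  by apply: (IH y) => //; apply: leq_trans lt _.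
have F0 : (M`!)%:R != 0 :> L by rewrite ext_natr_eq0 -lt0n fact_gt0.
have hdiv x : J x -> integral ((M`!)%:R / b * x).
  move=> hx; have [s [o [/andP[s0 sM] ho lt1]]] := hM (x / b).
  have e : s%:R * x - o * b = (s%:R * (x / b) - o) * b by rewrite mulrBl -!mulrA mulVf ?mulr1.
  have hJ' : J (s%:R * x - o * b).
    apply: JD; first by apply: JM => //; exact: integral_nat.
    by apply: idealN => //; apply: JM.
  have z0 : s%:R * x - o * b = 0.
    apply/eqP; apply: contraT => nz; have := minb _ hJ' nz.
    rewrite leqNgt -(ltr_nat algC) -hnm // -hnm // e NmM normrM.
    by rewrite gtr_pMl ?lt1 // normr_gt0 Nm_eq0.
  have -> : (M`!)%:R / b * x = (M`! %/ s)%:R * o.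
    have /eqP := z0; rewrite subr_eq0 => /eqP z1.
    have -> : x = o * b / s%:R by rewrite -z1 mulrAC mulfV ?mul1r // ext_natr_eq0 -lt0n.
    have -> : (M`!)%:R = (M`! %/ s)%:R * s%:R :> L.
      by rewrite -natrM divnK // dvdn_fact // s0.
    by field; rewrite nb ext_natr_eq0 -lt0n s0.
  by apply: integralM => //; exact: integral_nat.
exists (smul ((M`!)%:R / b) J); split.
- by apply: smul_ideal => //; rewrite mulf_neq0 ?invr_eq0.
- by exists b; rewrite divfK.
- apply/ideal_equivE; exists (M`!)%:R, b; split=> //; first exact: integral_nat.
    exact: sJ.
  by rewrite smulM mulrCA mulfV ?mulr1.
Qed.

(** With coordinates below [F], these elements represent all residue classes of integral elements
    modulo [F]. *)
Definition intcomb (F : nat) (c : {ffun 'I_N -> 'I_F}) : L := \sum_i (c i)%:R * w i.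

Lemma intcomb_mod (F : nat) x : (0 < F)%N -> integral x ->
  exists (c : {ffun 'I_N -> 'I_F}) (y : 'I_N -> int), x = intcomb c + F%:R * \sum_i (y i)%:~R * w i.
Proof.
move=> F0 hx; have [z ->] := span_w hx.
have lt i := absz_modz_lt (z i) F0.
exists [ffun i => Ordinal (lt i)], (fun i => (z i %/ F%:Z)%Z).
rewrite /intcomb mulr_sumr -big_split; apply: eq_bigr => i _; rewrite ffunE /= mulrA -mulrDl.
congr (_ * _); rewrite !pmulrn gez0_abs; last by rewrite modz_ge0 // eqz_nat -lt0n.
by rewrite {1}(divz_eq (z i) F%:Z) intrD intrM addrC [X in _ + X]mulrC.
Qed.

(** [J] contains some positive integer [F], hence every [F * w i]; modulo these, the finitely many
    residues [intcomb c] that lie in [J] suffice. Residues outside [J] are replaced by the harmless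
    generator 0. *)
Lemma ideal_fg J : ideal J -> exists (r : nat) (j : 'I_r -> L), (forall i, J (j i)) /\
  forall x, J x -> exists z : 'I_r -> int, x = \sum_i (z i)%:~R * j i.
Proof.
move=> hJ; have [sJ J0 JD JM _] := hJ; have [F [F0 JF]] := ideal_nat hJ.
pose T : finType := ('I_N + {ffun 'I_N -> 'I_F})%type.
pose gen (u : T) := match u with
  | inl i => F%:R * w i
  | inr c => if `[< J (intcomb c) >] then intcomb c else 0 end.
have Jgen u : J (gen u).
  by case: u => [i|c] /=; [rewrite mulrC; apply: JM | case: asboolP].
exists #|T|, (fun i => gen (enum_val i)); split=> // x hx.
have [c [y hc]] := intcomb_mod F0 (sJ _ hx).
have Jc : J (intcomb c).
  have -> : intcomb c = x - F%:R * \sum_i (y i)%:~R * w i by rewrite hc addrK.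
  apply: JD => //; apply: idealN => //; rewrite mulrC; apply: JM => //.
  by apply: integral_sum => i _; apply: integralM => //; exact: integral_int.
pose z (u : T) : int := match u with inl i => y i | inr c' => (c' == c)%:Z end.
exists (fun i => z (enum_val i)).
transitivity (\sum_(u in T) (z u)%:~R * gen u); last exact: big_enum_val.
rewrite big_sumType /= hc [LHS]addrC mulr_sumr; congr (_ + _).
  by apply: eq_big => // i _; rewrite mulrCA.
rewrite (bigD1 c) //= eqxx asboolT // mul1r big1 ?addr0 // => c' /negPf ->.
by rewrite mul0r.
Qed.

(** With [q = a / b] the hypothesis reads [J = (q B) J]. As [J] is finitely generated and stable
    under [q B], the elements of [q B] are integral, and [ideal_mul_eq_one] puts 1 in [q B]. Hence
    [q^-1] lies in [B] and generates it. *)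
Lemma principal_cancel (B J : L -> Prop) : ideal B -> ideal J ->
  ideal_equiv (ideal_mul B J) J -> principal B.
Proof.
move=> hB hJ /ideal_equivE[a [b [ha hb a0 b0 e]]].
have [sJ J0 JD JM [x0 [hx0 nx0]]] := hJ.
have [r [j [Jj spj]]] := ideal_fg hJ.
have nzj : exists i, j i != 0.
  apply: contrapT => h; move/eqP: nx0; apply; have [z ->] := spj _ hx0.
  rewrite big1 // => i _; suff -> : j i = 0 by rewrite mulr0.
  by apply/eqP; apply: contrapT => /negP hi; apply: h; exists i.
pose q := a / b.
have q0 : q != 0 by rewrite mulf_neq0 ?invr_eq0.
have eJ : J = ideal_mul (smul q B) J.
  rewrite -smul_mul; apply/esym/smulV => //; move: e; rewrite smulV // smulM => ->.
  by rewrite /q invf_div mulrC.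
have iB : ideal (smul q B).
  apply: smul_ideal => // x hx.
  have st i : J (q * x * j i).
    by rewrite [J]eJ; apply: mul_mem => //; exists x.
  have [c hc] := choice (fun i => spj _ (st i)).
  exact: (integral_stable (c := c) nzj).
have : smul q B 1.
  have hj i : exists c : 'I_r -> L, (forall k, smul q B (c k)) /\ j i = \sum_k c k * j k.
    have := Jj i; rewrite {1}eJ; elim/mul_ind: (j i) / => [|x y [c [hc ->]] [d [hd ->]]|x y hx hy].
    - exists (fun=> 0); split=> [k|]; first by case: iB.
      by rewrite big1 // => k _; rewrite mul0r.
    - exists (fun k => c k + d k); split=> [k|]; first by case: iB => _ _ h _ _; apply: h.
      by rewrite -big_split; apply: eq_bigr => k _; rewrite mulrDl.
    - have [z ->] := spj _ hy; exists (fun k => (z k)%:~R * x); split=> [k|].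
        by case: iB => _ _ _ h _; apply: h => //; exact: integral_int.
      by rewrite mulr_sumr; apply: eq_bigr => k _; rewrite mulrA [x * _]mulrC.
  have [c hc] := choice hj.
  by apply: (ideal_mul_eq_one (c := c) iB nzj) => [i k|i]; case: (hc i).
case=> y [hy e1]; apply/principalE; exists y; apply: pred_ext => x.
have [sB B0 BD BM _] := hB.
have yq : y = q^-1 by rewrite -[RHS]mulr1 e1 mulKf.
split=> [hx|[z [hz ->]]]; last by rewrite mulrC; apply: BM.
exists (q * x); split; first by case: iB => h _ _ _ _; apply: h; exists x.
by rewrite yq mulKf.
Qed.

(** Each class contains an ideal through one fixed integer [F]. Such an ideal is determined by the
    residues modulo [F] that it contains, and this finite set is its code. *)
Lemma class_number_exists : exists h, class_number L h.
Proof.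
have [F [F0 hF]] := ideal_equiv_bounded.
have hB J : exists B : L -> Prop, ideal J -> [/\ ideal B, B F%:R & ideal_equiv J B].
  by have [/hF[B hB]|nJ] := pselect (ideal J); [exists B | exists J].
have {hB} [B hB] := choice hB.
pose code J : {set {ffun 'I_N -> 'I_F}} := [set c | `[< B J (intcomb c) >]].
have [] := @finite_classes _ (@ideal_equiv L) (@ideal L) _ code.
- exact: ideal_equiv_refl.
- exact: ideal_equiv_sym.
- move=> J I K; exact: ideal_equiv_trans.
- have sub I J : ideal I -> ideal J -> code I = code J -> forall x, B I x -> B J x.
    move=> hI hJ e x hx; have [iI FI _] := hB _ hI; have [iJ FJ _] := hB _ hJ.
    have [c [y ex]] := intcomb_mod F0 (let: And5 h _ _ _ _ := iI in h _ hx).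
    have hz K : ideal K -> K F%:R -> K (F%:R * (\sum_i (y i)%:~R * w i)).
      move=> [_ _ _ KM _] KF; rewrite mulrC; apply: KM => //.
      by apply: integral_sum => i _; apply: integralM => //; exact: integral_int.
    have : c \in code I.
      rewrite inE; apply/asboolP.
      have -> : intcomb c = x - F%:R * (\sum_i (y i)%:~R * w i) by rewrite ex addrK.
      have [_ _ D _ _] := iI; apply: D => //; apply: idealN => //; exact: hz.
    rewrite e inE => /asboolP hc; rewrite ex.
    have [_ _ D _ _] := iJ; apply: D => //; exact: hz.
  move=> I J hI hJ e; have [_ _ eI] := hB _ hI; have [_ _ eJ] := hB _ hJ.
  apply: ideal_equiv_trans eI _; apply: ideal_equiv_sym.
  suff -> : B I = B J by [].
  by apply: pred_ext => x; split; apply: sub.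
by move=> h [rep [*]]; exists h, rep.
Qed.

(* Multiplication by an ideal of order [l] permutes the classes in cycles of length [l]. *)
Lemma dvdn_class_number (h l : nat) (I : L -> Prop) :
    class_number L h -> ideal I -> (0 < l)%N -> principal (ideal_exp I l) ->
    (forall k, (0 < k < l)%N -> ~ principal (ideal_exp I k)) ->
  (l %| h)%N.
Proof.
move=> [rep [hrep inj_rep cov]] hI l0 pl npk.
have hmu i : exists i', ideal_equiv (ideal_mul I (rep i)) (rep i').
  by apply: cov; apply: ideal_mul_ideal.
have {hmu} [mu hmu] := choice hmu.
have iter_mu k i : ideal_equiv (ideal_mul (ideal_exp I k) (rep i)) (rep (iter k mu i)).
  elim: k => [|k IH].
    by rewrite ideal_mulC ideal_mulO //; apply: ideal_equiv_refl.
  rewrite ideal_expS -ideal_mulA iterS; apply: ideal_equiv_trans (hmu _).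
  exact: ideal_equiv_mul.
have iter_l i : iter l mu i = i.
  apply: inj_rep; apply: (ideal_equiv_trans (ideal_equiv_sym (iter_mu l i))).
  have [a ea] := (principalE _).1 pl.
  have a0 : a != 0.
    have [_ _ _ _ [x [hx nx]]] := ideal_exp_ideal l hI.
    by apply: contra nx => /eqP a0; move: hx; rewrite ea a0 => -[y [_ ->]]; rewrite mul0r.
  apply/ideal_equivE; exists 1, a; split; rewrite ?oner_neq0 //; first exact: integral1.
    have [s _ _ _ _] := ideal_exp_ideal l hI; apply: s; rewrite ea.
    by exists 1; rewrite mulr1; split=> //; exact: integral1.
  by rewrite smul1 ea -smul_mul ideal_mulC ideal_mulO.
have free_mu k i : (0 < k < l)%N -> iter k mu i != i.
  move=> hk; apply/eqP => e; apply: (npk _ hk); apply: (principal_cancel (J := rep i)) => //.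
    exact: ideal_exp_ideal.
  by rewrite -[X in ideal_equiv _ (rep X)]e.
have inj_mu : injective mu.
  move=> i i' e; rewrite -(iter_l i) -(iter_l i') -(prednK l0) !iterSr.
  by rewrite e.
have order_mu i : order mu i = l.
  apply/eqP; rewrite eqn_leq; apply/andP; split; rewrite leqNgt; apply/negP => lt.
    by have := findex_iter lt; rewrite iter_l findex0 => e; rewrite -e in l0.
  have := free_mu (order mu i) i; rewrite order_gt0 lt => /(_ isT).
  by rewrite iter_order ?eqxx.
have := @fcard_order_set _ mu inj_mu l 'I_h.
rewrite card_ord => <- //; first by rewrite dvdn_mull.
  by apply/subsetP => i _; rewrite inE order_mu.
Qed.

End ClassNumber.

(** * Multiplicative dependence of units *)

Definition expprod (L : fieldExtType rat) (I : finType) (eps : I -> L) (e : I -> nat) : L :=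
  \prod_i eps i ^+ e i.

Lemma expprodD (L : fieldExtType rat) (I : finType) (eps : I -> L) (e f : I -> nat) :
  expprod eps (fun i => (e i + f i)%N) = expprod eps e * expprod eps f.
Proof. by rewrite /expprod -big_split; apply: eq_bigr => i _; rewrite exprD. Qed.

Lemma expprodMn (L : fieldExtType rat) (I : finType) (eps : I -> L) (e : I -> nat) k :
  expprod eps (fun i => (e i * k)%N) = expprod eps e ^+ k.
Proof. by rewrite /expprod -prodrXl; apply: eq_bigr => i _; rewrite exprM. Qed.

Lemma trunc_log_itv (y : algC) : 1 <= y ->
  (2 ^ trunc_log 2 (Num.truncn y))%:R <= y < (2 ^ (trunc_log 2 (Num.truncn y)).+1)%:R.
Proof.
move=> y1; have y0 : 0 <= y by apply: le_trans y1.
have t0 : (0 < Num.truncn y)%N by rewrite truncn_gt0.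
rewrite -truncn_ge_nat // -truncn_lt_nat //.
by have [-> ->] := (trunc_logP (isT : 1 < 2)%N t0, trunc_log_ltn (Num.truncn y) (isT : 1 < 2)%N).
Qed.

Section Units.
Variables (L : fieldExtType rat) (N : nat).
Hypothesis dimL : \dim {:L} = N.+1.
Variables (sg : 'I_N.+1 -> {rmorphism L -> algC}) (th : L).
Hypothesis inj_th : injective (fun k => sg k th).
Variable w : 'I_N.+1 -> L.
Hypothesis int_w : forall i, integral (w i).
Hypothesis span_w : forall x, integral x -> exists z : 'I_N.+1 -> int, x = \sum_i (z i)%:~R * w i.
Variable eps : 'I_N.+1 -> L.
Hypothesis eps_neq0 : forall i, eps i != 0.
Hypothesis int_eps : forall i, integral (eps i).
Hypothesis int_epsV : forall i, integral (eps i)^-1.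

Let expprod_neq0 e : expprod eps e != 0.
Proof. by apply/prodf_neq0 => i _; rewrite expf_neq0 //; exact: eps_neq0. Qed.

Let int_expprod e : integral (expprod eps e).
Proof. by apply: integral_prod => i _; apply: integralX. Qed.

Let int_expprodV e : integral (expprod eps e)^-1.
Proof.
by rewrite /expprod -prodfV; apply: integral_prod => i _; rewrite -exprVn; apply: integralX; exact: int_epsV.
Qed.

Let Nm_expprod e : \prod_k `|sg k (expprod eps e)| = 1.
Proof.
rewrite -normr_prod -/(Nm sg _).
have h1 := integral_Nm_ge1 dimL inj_th (int_expprod e) (expprod_neq0 e).
have h2 := integral_Nm_ge1 dimL inj_th (int_expprodV e).
rewrite invr_eq0 in h2; have {}h2 := h2 (expprod_neq0 e).
have e1 : `|Nm sg (expprod eps e)| * `|Nm sg (expprod eps e)^-1| = 1.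
  by rewrite -normrM -NmM mulfV ?expprod_neq0 // /Nm big1 ?normr1 // => k _; rewrite rmorph1.
apply/eqP; rewrite eq_le h1 andbT -e1 ler_peMr //.
Qed.

(* Pigeonhole on the sizes of the first [N] conjugates up to a factor 2 and on the class modulo
   [2 ^ N.+2]: two products agreeing on both have a quotient [u] such that [(u - 1) / 2 ^ N.+2] is
   integral with all conjugates less than 1. *)
Lemma units_dependent : exists e f : 'I_N.+1 -> nat,
  (exists i, e i != f i) /\ expprod eps e = expprod eps f.
Proof.
have [C hC] : exists C : nat, forall k i,
    1 <= (2 ^ C)%:R * `|sg k (eps i)| <= (2 ^ (2 * C))%:R.
  pose c k i := ((Num.truncn `|sg k (eps i)|) + (Num.truncn `|sg k (eps i)|^-1)).+1.
  exists (\sum_k \sum_i c k i)%N => k i; set C := (\sum__ _)%N.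
  have cC : (c k i <= C)%N by rewrite /C (bigD1 k) //= (bigD1 i) //= -addnA leq_addr.
  have gt0 : 0 < `|sg k (eps i)| by rewrite normr_gt0 fmorph_eq0.
  have b (x : algC) : 0 < x -> (Num.truncn x < c k i)%N -> x <= (2 ^ C)%:R.
    move=> x0 h; apply: ltW; apply: lt_le_trans (real_truncnS_gt (gtr0_real x0)) _.
    by rewrite ler_nat; apply: leq_trans h (leq_trans cC (ltnW (ltn_expl _ _))).
  have b1 : `|sg k (eps i)| <= (2 ^ C)%:R by apply: b => //; rewrite ltnS leq_addr.
  have b2 : `|sg k (eps i)|^-1 <= (2 ^ C)%:R.
    by apply: b; rewrite ?invr_gt0 // ltnS leq_addl.
  apply/andP; split; first by rewrite -ler_pdivrMr // mul1r.
  by rewrite mul2n -addnn expnD natrM ler_pM2l // ltr0n expn_gt0.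
(* [2 ^ C] bounds all conjugates of the [eps i] and of their inverses. For exponents below [B], the
   factor [K] lifts the conjugates of a product above 1, and their dyadic levels take at most
   [2 * C * N.+1 * B + 1 <= D * B] values. So [B ^ N.+1] products face at most
   [(D * B) ^ N * mu ^ N.+1] boxes, which dictates [B]. *)
pose mu := (2 ^ N.+2)%N.
pose D := ((2 * C * N.+1).+1)%N.
pose B := (D ^ N * mu ^ N.+1).+1.
pose K := (2 ^ (C * N.+1 * B))%N.
have bnd (e : 'I_N.+1 -> nat) k : (forall i, e i < B)%N ->
    1 <= K%:R * `|sg k (expprod eps e)| <= (2 ^ (2 * C * N.+1 * B))%:R.
  move=> he; set s := (\sum_i e i)%N.
  have sB : (s <= N.+1 * B)%N.
    by rewrite -[X in (X * B)%N]card_ord -sum_nat_const; apply: leq_sum => i _; apply: ltnW.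
  have e1 : (2 ^ (C * s))%:R * `|sg k (expprod eps e)| = \prod_i ((2 ^ C)%:R * `|sg k (eps i)|) ^+ e i.
    rewrite /expprod rmorph_prod normr_prod.
    under [RHS]eq_bigr => i _ do rewrite exprMn.
    rewrite big_split /=; congr (_ * _); last first.
      by apply: eq_bigr => i _; rewrite rmorphXn normrX.
    by rewrite prodrXr expnM natrX.
  have -> : K%:R = (2 ^ (C * (N.+1 * B - s)))%:R * (2 ^ (C * s))%:R :> algC.
    by rewrite -natrM -expnD -mulnDr subnK // mulnA.
  rewrite -mulrA e1; apply/andP; split.
    apply: mulr_ege1; first by rewrite ler1n expn_gt0.
    apply: le_trans (_ : \prod_(i < N.+1) 1 <= _); first by rewrite big1.
    by apply: ler_prod => i _; rewrite ler01 exprn_ege1 //; case/andP: (hC k i).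
  have le2 : \prod_i ((2 ^ C)%:R * `|sg k (eps i)|) ^+ e i <= (2 ^ (2 * C * s))%:R.
    rewrite expnM [X in _ <= X]natrX /s -prodrXr; apply: ler_prod => i _.
    by rewrite exprn_ge0 ?mulr_ge0 // lerXn2r ?nnegrE ?mulr_ge0 //; case/andP: (hC k i).
  apply: le_trans (ler_wpM2l _ le2) _; first by [].
  rewrite -natrM -expnD ler_nat leq_pexp2l //.
  by have := leq_mul (leqnn C) sB; rewrite mulnBr -!mulnA; lia.
pose x (e : {ffun 'I_N.+1 -> 'I_B}) := expprod eps (fun i => e i : nat).
pose lev e k := trunc_log 2 (Num.truncn (K%:R * `|sg k (x e)|)).
have lev_lt e k : (lev e k < (2 * C * N.+1 * B).+1)%N.
  have /andP[h1 h2] := bnd _ k (fun i => ltn_ord (e i)).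
  have /andP[h3 h4] := trunc_log_itv h1.
  by have := le_trans h3 h2; rewrite ler_nat leq_exp2l.
have [c hc] := choice (fun e : {ffun 'I_N.+1 -> 'I_B} => intcomb_mod span_w (expn_gt0 2 N.+2) (int_expprod (fun i => e i : nat))).
pose F (e : {ffun 'I_N.+1 -> 'I_B}) :
    {ffun 'I_N -> 'I_(2 * C * N.+1 * B).+1} * {ffun 'I_N.+1 -> 'I_mu} :=
  ([ffun k => Ordinal (lev_lt e (lift ord_max k))], c e).
have [e [f [nef]]] : exists e f, e != f /\ F e = F f.
  apply: pigeonhole; rewrite card_prod !card_ffun !card_ord.
  apply: (@leq_ltn_trans ((D * B) ^ N * mu ^ N.+1)).
    rewrite leq_mul2r; apply/orP; right.
    have le : ((2 * C * N.+1 * B).+1 <= D * B)%N by rewrite -addn1 /D [X in (_ <= X)%N]mulSn addnC leq_add2r.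
    have pw (a b j : nat) : (a <= b -> a ^ j <= b ^ j)%N.
      by move=> ab; elim: j => // j IH; rewrite !expnS leq_mul.
    exact: pw.
  rewrite expnMn -mulnA [(B ^ N * _)%N]mulnC mulnA [X in (_ < X)%N]expnS.
  by rewrite ltn_pmul2r // expn_gt0.
case=> hlev hres.
have K0 : 0 < K%:R :> algC by rewrite ltr0n expn_gt0.
have ratio e1 e2 k : lev e1 k = lev e2 k -> `|sg k (x e1 / x e2)| <= 2.
  move=> el; have /andP[h1 _] := bnd _ k (fun i => ltn_ord (e1 i)).
  have /andP[h2 _] := bnd _ k (fun i => ltn_ord (e2 i)).
  have /andP[_ h3] := trunc_log_itv h1; have /andP[h4 _] := trunc_log_itv h2.
  rewrite -/(lev e1 k) el expnS natrM in h3.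
  have h5 := lt_le_trans h3 (ler_wpM2l (ler0n _ 2) h4).
  rewrite rmorphM fmorphV normrM normfV ler_pdivrMr ?normr_gt0 ?fmorph_eq0 //; last exact: expprod_neq0.
  by rewrite -(ler_pM2l K0) mulrCA; apply: ltW.
pose u := x e / x f.
have u0 k : 0 < `|sg k u|.
  by rewrite normr_gt0 fmorph_eq0 mulf_neq0 ?invr_eq0 //; exact: expprod_neq0.
have hu k : k != ord_max -> `|sg k u| <= 2 /\ `|sg k u|^-1 <= 2.
  case: (unliftP ord_max k) => [j -> _|-> /eqP//].
  have := congr1 (fun g : {ffun 'I_N -> 'I_(2 * C * N.+1 * B).+1} => val (g j)) hlev.
  rewrite !ffunE /= => el; split; first exact: ratio.
  by rewrite -normfV -fmorphV invf_div; apply: ratio.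
have Nu : \prod_k `|sg k u| = 1.
  transitivity ((\prod_k `|sg k (x e)|) / \prod_k `|sg k (x f)|); last by rewrite !Nm_expprod divr1.
  by rewrite -prodfV -big_split; apply: eq_bigr => k _; rewrite rmorphM fmorphV normrM normfV.
have hu2 k : `|sg k u| <= (2 ^ N.+1)%:R.
  have [->|nk] := eqVneq k ord_max; last first.
    by apply: le_trans (proj1 (hu _ nk)) _; rewrite ler_nat expnS leq_pmulr // expn_gt0.
  (* The conjugate whose level was not recorded is controlled by the norm, which is 1 in absolute
     value. *)
  have Nu' : `|sg ord_max u| = \prod_(k < N.+1 | k != ord_max) `|sg k u|^-1.
    rewrite prodfV; move: Nu; rewrite (bigD1 ord_max) //=; set P := \prod_(_ < _ | _) _ => e1.
    have P0 : P != 0 by apply: contra_eq_neq e1 => ->; rewrite mulr0 eq_sym oner_neq0.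
    by apply: (mulIf P0); rewrite mulVf.
  rewrite Nu'; apply: le_trans (_ : \prod_(k < N.+1 | k != ord_max) 2 <= _).
    by apply: ler_prod => j nj; rewrite invr_ge0 normr_ge0; case: (hu _ nj).
  rewrite prodr_const natrX; apply: ler_weXn2l; first by rewrite ler1n.
  by rewrite -[X in (_ <= X)%N](card_ord N.+1) max_card.
have [ye hye] := hc e; have [yf hyf] := hc f.
pose z := \sum_i (ye i)%:~R * w i - \sum_i (yf i)%:~R * w i.
have mu0 : mu%:R != 0 :> L by rewrite ext_natr_eq0 -lt0n expn_gt0.
have hz : x e - x f = mu%:R * z.
  by rewrite [x e]hye [x f]hyf hres opprD addrACA subrr add0r mulrBr.
have intz : integral z.
  by apply: integralB; apply: integral_sum => i _; apply: integralM; try exact: integral_int; exact: int_w.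
pose v := z / x f.
have uv : u - 1 = mu%:R * v.
  by rewrite /v mulrA -hz mulrBl mulfV //; exact: expprod_neq0.
have hv k : `|sg k v| < 1.
  have mu0C : 0 < mu%:R :> algC by rewrite ltr0n expn_gt0.
  rewrite -(ltr_pM2l mu0C) mulr1.
  have -> : mu%:R * `|sg k v| = `|sg k u - 1|.
    by have := congr1 (sg k) uv; rewrite rmorphB rmorph1 [sg k (_ * v)]rmorphM rmorph_nat => ->; rewrite normrM normr_nat.
  (* The choice of [mu] comes from [2 ^ N.+1 + 1 < 2 ^ N.+2]. *)
  apply: le_lt_trans (ler_normB _ _) _; rewrite normr1.
  apply: le_lt_trans (lerD (hu2 k) (lexx 1)) _.
  rewrite natr1 ltr_nat /mu [(2 ^ N.+2)%N]expnS mul2n -addnn -addn1 ltn_add2l.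
  by rewrite expnS mul2n -addnn; have := expn_gt0 2 N; lia.
have v0 : v = 0.
  apply: (integral_small dimL inj_th); first by apply: integralM => //; exact: int_expprodV.
  rewrite /Nm normr_prod (bigD1 ord_max) //=; apply: le_lt_trans (hv ord_max).
  rewrite ler_piMr //; apply: le_trans (_ : \prod_(k < N.+1 | k != ord_max) 1 <= _).
    by apply: ler_prod => k _; rewrite normr_ge0 ltW.
  by rewrite big1.
exists (fun i => e i : nat), (fun i => f i : nat); split.
  apply: contrapT => h; case/eqP: nef; apply/ffunP => i; apply: val_inj.
  by apply/eqP; apply: contrapT => /negP hi; apply: h; exists i.
move: uv; rewrite v0 mulr0 => /eqP; rewrite subr_eq0 => /eqP u1.
by apply: (mulIf (invr_neq0 (expprod_neq0 (fun i => f i : nat)))); rewrite mulfV //; exact: expprod_neq0.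
Qed.

Hypothesis real_emb : exists k, forall x, sg k x \is Num.real.

(** A real embedding leaves no roots of unity other than 1 and -1. *)
Lemma pow_pm1 (z : L) q : (0 < q)%N -> z ^+ q = 1 \/ z ^+ q = -1 -> z = 1 \/ z = -1.
Proof.
move=> q0 h; have [k hk] := real_emb; have zr := hk z.
have nz : `|sg k z| = 1.
  have /eqP : `|sg k z| ^+ q = 1.
    by rewrite -normrX -rmorphXn; case: h => ->; rewrite ?rmorphN rmorph1 ?normrN normr1.
  by rewrite pexprn_eq1 // => /orP[/eqP q00|/eqP //]; rewrite q00 in q0.
have := real_eqr_norml 1 zr; rewrite nz eqxx ler01 andbT => /esym/orP[/eqP e|/eqP e]; [left|right].
  by apply: (fmorph_inj (sg k)); rewrite rmorph1.
by apply: (fmorph_inj (sg k)); rewrite rmorphN rmorph1.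
Qed.

(** If the two exponent vectors differ modulo [q], the residues of [e - f], written
    [e + (q - 1) * f] to stay in [nat], give the relation. Otherwise both are divided by [q]: the
    common remainders cancel, the new products agree up to a [q]-th root of 1 or -1, that is up to
    sign, and the sum of the exponents has decreased. This is why the descent carries a sign. *)
Lemma units_relation (q : nat) : (1 < q)%N ->
  exists (e : 'I_N.+1 -> nat) (g : L),
    [/\ forall i, (e i < q)%N, exists i, e i != 0%N &
        expprod eps e = g ^+ q \/ expprod eps e = - g ^+ q].
Proof.
move=> q1; have q0 : (0 < q)%N by apply: ltn_trans q1.
suff desc n (e f : 'I_N.+1 -> nat) : (\sum_i (e i + f i) < n)%N -> (exists i, e i != f i) ->
    expprod eps e = expprod eps f \/ expprod eps e = - expprod eps f ->
  exists (e : 'I_N.+1 -> nat) (g : L),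
    [/\ forall i, (e i < q)%N, exists i, e i != 0%N &
        expprod eps e = g ^+ q \/ expprod eps e = - g ^+ q].
  by have [e [f [nef hef]]] := units_dependent; apply: (desc _ e f (ltnSn _)) => //; left.
elim: n e f => // n IH e f les nef hef.
have splitq (a : 'I_N.+1 -> nat) : expprod eps a =
    expprod eps (fun i => (a i %/ q)%N) ^+ q * expprod eps (fun i => (a i %% q)%N).
  rewrite -expprodMn -expprodD /expprod; apply: eq_bigr => i _.
  by rewrite -divn_eq.
have [[i hi]|nmod] := pselect (exists i, e i != f i %[mod q]).
  pose a i := (e i + (q - 1) * f i)%N.
  exists (fun i => (a i %% q)%N), (expprod eps f / expprod eps (fun i => (a i %/ q)%N)); split.
  - by move=> j; rewrite ltn_mod.
  - exists i; apply: contra hi => /eqP h; rewrite -(eqn_modDr ((q - 1) * f i)) -/(a i) h.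
    by rewrite -[X in (X + _)%N]mul1n -mulnDl subnKC // modnMr.
  have P0 := expf_neq0 q (expprod_neq0 (fun i => (a i %/ q)%N)).
  have h1 : expprod eps a = expprod eps e * expprod eps f ^+ (q - 1).
    rewrite expprodD -expprodMn; congr (_ * _); apply: eq_bigr => j _.
    by rewrite mulnC.
  have h2 : expprod eps f ^+ q = expprod eps f * expprod eps f ^+ (q - 1).
    by rewrite -exprS subn1 prednK.
  rewrite expr_div_n h2; move: (splitq a); rewrite h1.
  set Q := expprod eps (fun i => (a i %/ q)%N) ^+ q in P0 *; set R := expprod eps (fun i => (a i %% q)%N) => e1.
  have -> : R = expprod eps e * expprod eps f ^+ (q - 1) / Q by rewrite e1 mulrAC mulfV // mul1r.
  by case: hef => ->; [left | right; rewrite !mulNr].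
have emod i : (e i %% q = f i %% q)%N.
  by apply: contrapT => h; apply: nmod; exists i; apply/eqP.
pose e' i := (e i %/ q)%N; pose f' i := (f i %/ q)%N.
have nef' : exists i, e' i != f' i.
  case: nef => i hi; exists i; apply: contra hi => /eqP h.
  by rewrite (divn_eq (e i) q) (divn_eq (f i) q) -/(e' i) h emod.
apply: (IH e' f' _ nef').
  apply: (@leq_trans (\sum_i (e i + f i))%N); last by rewrite -ltnS.
  case: nef' => i hi.
  rewrite (bigD1 i) //= [X in (_ < X)%N](bigD1 i) //= -addSn leq_add //; last first.
    by apply: leq_sum => j _; rewrite leq_add // leq_div.
  have pos : (0 < e' i)%N \/ (0 < f' i)%N.
    by case: (posnP (e' i)) hi => [-> hi|]; [right; rewrite lt0n eq_sym | left].
  have lt (a : nat) : (0 < a %/ q)%N -> (a %/ q < a)%N.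
    by move=> h; rewrite ltn_Pdiv //; case: a h; rewrite ?div0n.
  case: pos => [/lt h|/lt h].
    by rewrite -addSn leq_add // leq_div.
  by rewrite -addnS leq_add // leq_div.
have : (expprod eps e' / expprod eps f') ^+ q = 1 \/ (expprod eps e' / expprod eps f') ^+ q = -1.
  move: hef; rewrite (splitq e) (splitq f).
  have -> : expprod eps (fun i => (e i %% q)%N) = expprod eps (fun i => (f i %% q)%N).
    by apply: eq_bigr => i _; rewrite emod.
  rewrite expr_div_n -mulNr => -[] /(mulIf (expprod_neq0 _)) ->.
    by left; rewrite mulfV // expf_neq0.
  by right; rewrite mulNr mulfV // expf_neq0.
move/(pow_pm1 q0) => -[] e1; [left|right].
  by rewrite -[LHS](divfK (expprod_neq0 f')) e1 mul1r.
by rewrite -[LHS](divfK (expprod_neq0 f')) e1 mulN1r.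
Qed.

End Units.

(** * Embeddings of a simple extension *)

Section FieldOfPoly.
Variables (L : fieldExtType rat) (z : L) (f : {poly rat}).
Hypothesis irr_f : irreducible_poly f.
Hypothesis root_f : root (map_poly (in_alg L) f) z.
Hypothesis gen_z : <<1; z>>%VS = fullv.

Lemma poly_gen (y : L) : exists p : {poly rat}, (map_poly (in_alg L) p).[z] = y.
Proof.
have : y \in <<1; z>>%VS by rewrite gen_z memvf.
by case/Fadjoin_polyP => p /polyOver1P[q ->] ->; exists q.
Qed.

Lemma poly_ker (q : {poly rat}) : (map_poly (in_alg L) q).[z] = 0 -> f %| q.
Proof.
move=> q0; apply: contraT => ndvd.
have : coprimep (map_poly (in_alg L) f) (map_poly (in_alg L) q).
  by rewrite coprimep_map irreducible_poly_coprime.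
by move/coprimep_root => /(_ _ root_f); rewrite q0 eqxx.
Qed.

(** The image of [y] is the value at [rho] of any polynomial expressing [y] in [z]; by [poly_ker]
    the choice does not matter, and so [phi] is a ring morphism. *)
Lemma emb_exists (rho : algC) : root (map_poly ratr f) rho ->
  exists s : {rmorphism L -> algC}, s z = rho.
Proof.
move=> rrho; have [P hP] := choice poly_gen.
pose phi y := (map_poly ratr (P y)).[rho].
have eq0 (q : {poly rat}) : (map_poly (in_alg L) q).[z] = 0 -> (map_poly ratr q).[rho] = 0.
  by move=> /poly_ker/dvdpP[r ->]; rewrite rmorphM hornerM (rootP rrho) mulr0.
have phiE (q : {poly rat}) y : (map_poly (in_alg L) q).[z] = y -> phi y = (map_poly ratr q).[rho].
  move=> hq; apply/eqP; rewrite -subr_eq0 /phi -hornerN -hornerD -rmorphB; apply/eqP/eq0.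
  by rewrite rmorphB hornerD hornerN hP hq subrr.
have phiB : zmod_morphism phi.
  move=> x y; rewrite [phi x]/phi [phi y]/phi -hornerN -hornerD -rmorphB; apply: phiE.
  by rewrite rmorphB hornerD hornerN !hP.
have phiM : monoid_morphism phi.
  split=> [|x y]; first by rewrite (phiE 1) ?rmorph1 ?hornerC.
  rewrite [phi x]/phi [phi y]/phi -hornerM -rmorphM; apply: phiE.
  by rewrite rmorphM hornerM !hP.
pose phiA := GRing.isZmodMorphism.Build _ _ phi phiB.
pose phiMm := GRing.isMonoidMorphism.Build _ _ phi phiM.
pose s : {rmorphism L -> algC} := HB.pack phi phiA phiMm.
exists s; rewrite [LHS](phiE 'X); first by rewrite map_polyX hornerX.
by rewrite map_polyX hornerX.
Qed.

Lemma emb_ext (A : fieldType) (s t : {rmorphism L -> A}) : s z = t z -> s =1 t.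
Proof.
move=> st y; have [p <-] := poly_gen y; rewrite -!horner_map -!map_poly_comp st; congr (_.[_]).
apply: eq_map_poly => r /=.
have := fmorph_eq_rat (GRing.RMorphism.clone _ _ (s \o (in_alg L)) _) r.
have := fmorph_eq_rat (GRing.RMorphism.clone _ _ (t \o (in_alg L)) _) r.
by move=> /= -> ->.
Qed.
End FieldOfPoly.

(** * Roots of the polynomials defining the fields *)

Lemma prod_ge_pair (I : finType) (F : I -> algC) (j k : I) : j != k ->
  (forall i, i != j -> 1 <= F i) -> 0 <= F j -> F j * F k <= \prod_i F i.
Proof.
move=> jk h1 h0; rewrite (bigD1 j) //= ler_wpM2l // (bigD1 k) 1?eq_sym //=.
have h1k : 1 <= F k by apply: h1; rewrite eq_sym.
rewrite ler_peMr //; first by apply: le_trans h1k.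
apply: le_trans (_ : \prod_(i | (i != j) && (i != k)) 1 <= _); first by rewrite big1.
by apply: ler_prod => i /andP[ij _]; rewrite ler01 h1.
Qed.

Section Roots.
Variables (m : nat) (c : 'I_m.+1 -> nat) (A : nat) (dl : int).
Hypothesis m_gt0 : (0 < m)%N.
Hypothesis sep_c : forall i j : 'I_m.+1, (i < j)%N -> (c i + 3 <= c j)%N.
Hypothesis le_c : forall i : 'I_m.+1, i != ord_max -> (c i <= A)%N.
Let b := c ord_max.
Hypothesis big_b : (2 * (A + 2) ^ m.+1 < b)%N.
Hypothesis norm_dl : `|dl|%N = 1%N.

(** In this section [A] is a bound on the small points, not their product. The gap 3 keeps a number
    within 1 of one point at distance at least 2 from every other. *)
Definition unitpoly : {poly int} := \prod_(k < m.+1) ('X - ((c k)%:R)%:P) + dl%:P.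
Local Notation f := unitpoly.

Lemma large_point_ge : (2 * A + 4 <= b)%N.
Proof.
apply: leq_trans (ltnW big_b); rewrite expnS.
have : (0 < (A + 2) ^ m)%N by rewrite expn_gt0 addn2.
by nia.
Qed.

Let b_gt0 : 0 < b%:R :> algC.
Proof. by rewrite ltr0n; apply: leq_trans large_point_ge; rewrite addn4. Qed.

Let dl_norm : `|dl%:~R| = 1 :> algC.
Proof. by rewrite -intr_norm -natr_absz norm_dl. Qed.

Lemma unitpolyC (F : comNzRingType) (x : F) : (map_poly intr f).[x] = \prod_k (x - (c k)%:R) + dl%:~R.
Proof.
rewrite rmorphD rmorph_prod /= map_polyC hornerD hornerC horner_prod; congr (_ + _).
by apply: eq_bigr => k _; rewrite rmorphB /= map_polyX map_polyC /= hornerXsubC rmorph_nat.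
Qed.

Lemma unitpoly_point k : (map_poly intr f).[(c k)%:R] = dl%:~R :> algC.
Proof. by rewrite unitpolyC (bigD1 k) //= subrr mul0r add0r. Qed.

Lemma unitpoly_size_monic : size f = m.+2 /\ f \is monic.
Proof.
pose P : {poly int} := \prod_(k < m.+1) ('X - ((c k)%:R)%:P).
have szP : size P = m.+2 by rewrite /P -big_enum size_prod_XsubC size_enum_ord.
have lt : (size dl%:P < size P)%N by rewrite szP size_polyC; case: (dl != 0).
split; first by rewrite size_polyDl.
by rewrite monicE lead_coefDl // lead_coef_prod_XsubC.
Qed.

Lemma size_unitpoly : size f = m.+2. Proof. by case: unitpoly_size_monic. Qed.
Lemma monic_unitpoly : f \is monic. Proof. by case: unitpoly_size_monic. Qed.

Lemma point_sep i k : i != k -> 3 <= `|(c i)%:R - (c k)%:R| :> algC.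
Proof.
wlog lt : i k / (i < k)%N.
  move=> W ik; case: (ltngtP i k) => [l|l|/val_inj e]; first exact: W.
    by rewrite distrC; apply: W => //; rewrite eq_sym.
  by rewrite e eqxx in ik.
move=> _; have h := sep_c lt; rewrite distrC -natrB; last by apply: leq_trans h; rewrite leq_addr.
by rewrite normr_nat ler_nat leq_subRL ?(leq_trans (leq_addr _ _) h).
Qed.

(** This supplies the large factor that pushes a root towards [c k]; the summand 1 pays for the
    passage from [c k] to the root. *)
Lemma point_far k : exists i, i != k /\ b%:R / 2 + 1 <= `|(c k)%:R - (c i)%:R| :> algC.
Proof.
have h i : i != ord_max -> b%:R / 2 + 1 <= `|b%:R - (c i)%:R| :> algC.
  move=> /le_c le; have bA := large_point_ge.
  rewrite -natrB ?normr_nat; last by lia.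
  rewrite -(ler_pM2r (ltr0n _ 2)) mulrDl divfK ?pnatr_eq0 // mul1r -natrD -natrM ler_nat.
  by lia.
have [->|nk] := eqVneq k ord_max; last first.
  by exists ord_max; rewrite eq_sym nk distrC; split=> //; apply: h.
have n0 : ord0 != ord_max :> 'I_m.+1 by rewrite -val_eqE /= eq_sym -lt0n.
by exists ord0; rewrite n0; split=> //; apply: h.
Qed.

(** The distances from [x] to the points have product 1. One of them, to [c k] say, is at most 1;
    the others are then at least 2, and one is at least [b / 2]. *)
Lemma root_near (x : algC) : root (map_poly intr f) x -> exists k, `|x - (c k)%:R| <= 2 / b%:R.
Proof.
rewrite rootE unitpolyC addr_eq0 => /eqP /(congr1 (fun y => `|y|)).
rewrite normrN dl_norm normr_prod => Px.
have [k hk] : exists k, `|x - (c k)%:R| <= 1.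
  apply: contrapT => h; have h1 k : 1 < `|x - (c k)%:R|.
    by rewrite real_ltNge ?real1 ?normr_real //; apply/negP => le; apply: h; exists k.
  have n0 : ord0 != ord_max :> 'I_m.+1 by rewrite -val_eqE /= eq_sym -lt0n.
  have := prod_ge_pair n0 (fun i _ => ltW (h1 i)) (normr_ge0 _).
  rewrite Px => le; have lt : 1 < `|x - (c ord0)%:R| * `|x - (c ord_max)%:R| by apply: mulr_egt1.
  by have := lt_le_trans lt le; rewrite ltxx.
have far i : i != k -> `|(c k)%:R - (c i)%:R| - 1 <= `|x - (c i)%:R|.
  move=> ik; rewrite lerBlDl; apply: le_trans (ler_distD x _ _) _.
  by rewrite lerD2r distrC.
exists k; have [j [jk hj]] := point_far k.
have := @prod_ge_pair _ (fun i => `|x - (c i)%:R|) k j; rewrite eq_sym jk Px => /(_ isT) H.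
have {H} H : `|x - (c k)%:R| * `|x - (c j)%:R| <= 1.
  apply: H => // i ik; apply: le_trans (far i ik).
  rewrite lerBrDr; apply: le_trans (point_sep (_ : k != i)); last by rewrite eq_sym.
  by rewrite -[1 + 1]/(2%:R) ler_nat.
rewrite -invf_div -[X in _ <= X]mul1r ler_pdivlMr ?divr_gt0 //.
apply: le_trans H; rewrite ler_wpM2l //.
by apply: le_trans (far j jk); rewrite lerBrDr.
Qed.

(** Were no root attached to [c k], all roots would be at distance at least 2 from it, and [f] would
    be at least 4 in absolute value at [c k], where it equals [dl]. So every point receives a root,
    and by counting exactly one. *)
Lemma roots_exist : exists rho : 'I_m.+1 -> algC,
  map_poly intr f = \prod_k ('X - (rho k)%:P) /\ forall k, `|rho k - (c k)%:R| <= 2 / b%:R.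
Proof.
have [r Dr] := closed_field_poly_normal (map_poly intr f : {poly algC}).
rewrite (monicP _) ?monic_map ?monic_unitpoly // scale1r in Dr.
have szr : size r = m.+1.
  have : size (map_poly intr f : {poly algC}) = m.+2.
    by rewrite size_map_inj_poly ?size_unitpoly //; exact: intr_inj.
  by rewrite Dr size_prod_XsubC => -[].
pose ro (j : 'I_m.+1) := r`_j.
have Dro : map_poly intr f = \prod_j ('X - (ro j)%:P) by rewrite Dr (big_nth 0) szr big_mkord.
have near j : exists k, `|ro j - (c k)%:R| <= 2 / b%:R.
  apply: root_near; rewrite Dro /root horner_prod (bigD1 j) //=.
  by rewrite hornerXsubC subrr mul0r.
have [pi hpi] := choice near.
have b2 : 2 / b%:R <= 1 :> algC.
  by rewrite ler_pdivrMr // mul1r ler_nat; apply: leq_trans large_point_ge; rewrite addn4.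
have surj k : exists j, pi j = k.
  apply: contrapT => h; have npi j : pi j != k by apply/eqP => e; apply: h; exists j.
  have h2 j : 2 <= `|(c k)%:R - ro j|.
    have := point_sep (npi j); have -> : 3 = 1 + 2 :> algC by rewrite -natr1 addrC.
    move=> h3; rewrite -(lerD2l 1); apply: le_trans h3 _.
    apply: le_trans (ler_distD (ro j) _ _) _; rewrite lerD // 1?[`|ro j - _|]distrC //.
    by rewrite distrC; apply: le_trans (hpi j) b2.
  have : `|\prod_j ((c k)%:R - ro j)| = 1.
    transitivity (`|(map_poly intr f).[(c k)%:R]| : algC); last by rewrite unitpoly_point.
    rewrite Dro horner_prod; congr (`|_|).
    by apply: eq_bigr => j _; rewrite hornerXsubC.
  rewrite normr_prod => e.
  have n0 : ord0 != ord_max :> 'I_m.+1 by rewrite -val_eqE /= eq_sym -lt0n.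
  have := @prod_ge_pair _ (fun j => `|(c k)%:R - ro j|) _ _ n0.
  have h1 j : 1 <= `|(c k)%:R - ro j| by apply: le_trans (h2 j); rewrite ler1n.
  rewrite e => /(_ (fun i _ => h1 i) (normr_ge0 _)) le.
  by have := le_trans (ler_pM (ler0n _ 2) (ler0n _ 2) (h2 _) (h2 _)) le; rewrite -natrM -[X in _ <= X]/(1%:R) ler_nat.
have [g hg] := choice surj.
have g_inj : injective g by move=> x y e; rewrite -(hg x) -(hg y) e.
exists (ro \o g); split; first by rewrite Dro (reindex_inj g_inj).
by move=> k /=; rewrite -{2}(hg k).
Qed.

Variable rho : 'I_m.+1 -> algC.
Hypothesis f_rho : map_poly intr f = \prod_k ('X - (rho k)%:P).
Hypothesis near_rho : forall k, `|rho k - (c k)%:R| <= 2 / b%:R.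

Let near1 : 2 / b%:R <= 2^-1 :> algC.
Proof.
rewrite ler_pdivrMr // ler_pdivlMl ?ltr0n // -natrM ler_nat.
by apply: leq_trans large_point_ge; rewrite leq_addl.
Qed.

Lemma near_unique x i k : `|x - (c i)%:R| <= 2 / b%:R -> `|x - (c k)%:R| <= 2 / b%:R :> algC ->
  i = k.
Proof.
move=> hi hk; apply/eqP; apply: contraT => /point_sep h3.
have : `|(c i)%:R - (c k)%:R| <= 1 :> algC.
  apply: le_trans (ler_distD x _ _) _; rewrite distrC.
  apply: le_trans (lerD (le_trans hi near1) (le_trans hk near1)) _.
  by rewrite -mulr2n -[2^-1 *+ 2]mulr_natl mulfV ?pnatr_eq0.
by move/(le_trans h3); rewrite -[X in _ <= X]/(1%:R) ler_nat.
Qed.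

Lemma rho_inj : injective rho.
Proof.
by move=> i k e; apply: (@near_unique (rho i)); [|rewrite e]; apply: near_rho.
Qed.

Lemma root_rho x : root (map_poly intr f) x -> exists k, x = rho k.
Proof.
by rewrite f_rho /root horner_prod => /prodf_eq0[k _]; rewrite hornerXsubC subr_eq0 => /eqP ->; exists k.
Qed.

Lemma rho_root k : root (map_poly intr f) (rho k).
Proof.
by rewrite f_rho /root horner_prod (bigD1 k) //= hornerXsubC subrr mul0r.
Qed.

(** The complex conjugate of a root is a root close to the same real point, hence the same root. *)
Lemma rho_real k : rho k \is Num.real.
Proof.
have cn j : ((c j)%:R : algC)^* = (c j)%:R by rewrite rmorph_nat.
have [j hj] : exists j, (rho k)^* = rho j.
  apply: root_rho; have := rho_root k; rewrite !rootE !unitpolyC => /eqP/(congr1 (fun y => y^*)).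
  rewrite rmorphD rmorph_int rmorph_prod rmorph0 => <-; apply/eqP; congr (_ + _).
  by apply: eq_bigr => j _; rewrite rmorphB rmorph_nat.
apply/CrealP; rewrite hj; congr rho; apply: (@near_unique (rho j)); first exact: near_rho.
by rewrite -hj -(cn k) -rmorphB norm_conjC.
Qed.

Lemma rho_bound k i : k != ord_max -> i != ord_max -> `|(c i)%:R - rho k| <= (A + 1)%:R.
Proof.
move=> hk hi; apply: le_trans (ler_distD (c k)%:R _ _) _; rewrite natrD lerD //; last first.
  rewrite distrC; apply: le_trans (le_trans (near_rho k) near1) _.
  by rewrite invf_le1 ?ler1n.
have [l|l] := leqP (c i) (c k).
  by rewrite distrC -natrB // normr_nat ler_nat; apply: leq_trans (leq_subr _ _) (le_c hk).
by rewrite -natrB ?(ltnW l) // normr_nat ler_nat; apply: leq_trans (leq_subr _ _) (le_c hi).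
Qed.

(* A nonconstant factor omitting the large root has a root near some small point [c i], so it is
   less than 1 in absolute value at [c i]; but it divides [f (c i)], which is a unit. *)
Lemma unitpoly_factor (p r : {poly int}) (s t : seq algC) : f = p * r ->
    map_poly intr p = (lead_coef p)%:~R *: \prod_(z <- s) ('X - z%:P) ->
    `|lead_coef p|%N = 1%N -> perm_eq (s ++ t) (codom rho) ->
  rho ord_max \notin s -> s = [::].
Proof.
move=> fpr ps lp st nmax; case: s ps st nmax => // z s ps st nmax; exfalso.
have us : uniq (z :: s).
  have : uniq (codom rho) by rewrite map_inj_uniq ?enum_uniq //; exact: rho_inj.
  by rewrite -(perm_uniq st) cat_uniq => /andP[].
have ins y : y \in z :: s -> exists2 k, k != ord_max & y = rho k.
  move=> ys; have : y \in codom rho by rewrite -(perm_mem st) mem_cat ys.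
  case/codomP => k hk; exists k => //; apply: contraNneq nmax => <-.
  by rewrite -hk.
have [i ni zi] := ins _ (mem_head z s).
have val1 : `|(map_poly intr p).[(c i)%:R]| = 1 :> algC.
  have : (map_poly intr f).[(c i)%:R] = dl%:~R :> algC by apply: unitpoly_point.
  have ev (q : {poly int}) : (map_poly intr q).[(c i)%:R] = (q.[(c i)%:R])%:~R :> algC.
    by rewrite -[(c i)%:R](rmorph_nat (intr : int -> algC)) horner_map.
  rewrite !ev fpr hornerM => /intr_inj e.
  have := norm_dl; rewrite -e abszM => /eqP; rewrite muln_eq1 => /andP[/eqP h _].
  by rewrite -intr_norm -natr_absz h.
have hs : `|\prod_(y <- s) ((c i)%:R - y)| <= ((A + 2) ^ m.+1)%:R.
  have szs : (size s <= m.+1)%N.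
    have := perm_size st; rewrite size_cat size_codom card_ord /= => e.
    by rewrite -e; apply: leq_trans (leq_addr _ _); exact: leqnSn.
  rewrite normr_prod; apply: le_trans (_ : \prod_(y <- s) (A + 2)%:R <= _); last first.
    rewrite big_const_seq count_predT iter_mulr_1 -natrX ler_nat.
    by apply: leq_pexp2l => //; rewrite addn2.
  rewrite [X in X <= _]big_seq [X in _ <= X]big_seq; apply: ler_prod => y ys.
  rewrite normr_ge0 /=; have [|k nk ->] := ins y; first by rewrite inE ys orbT.
  by apply: le_trans (rho_bound nk ni) _; rewrite ler_nat leq_add2l.
have lp1 : `|(lead_coef p)%:~R| = 1 :> algC by rewrite -intr_norm -natr_absz lp.
move: val1; rewrite ps hornerZ normrM lp1 mul1r big_cons hornerM hornerXsubC horner_prod.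
under eq_bigr => y _ do rewrite hornerXsubC.
rewrite normrM => val1.
have : 1 <= 2 / b%:R * ((A + 2) ^ m.+1)%:R :> algC.
  by rewrite -[X in X <= _]val1 ler_pM // zi distrC; apply: near_rho.
by rewrite mulrAC ler_pdivlMr // mul1r -natrM ler_nat leqNgt big_b.
Qed.

(** By Gauss's lemma a factorisation may be taken over the integers. The large root belongs to only
    one of the two factors, and [unitpoly_factor] makes the other one constant. *)
Lemma unitpoly_irreducible : irreducible_poly (map_poly intr f : {poly rat}).
Proof.
split; first by rewrite size_map_inj_poly ?size_unitpoly //; exact: intr_inj.
move=> q sq /dvdpP_rat_int[p [a a0 qp] [r fpr]].
have fn0 : f != 0 by rewrite -size_poly_eq0 size_unitpoly.
have lc : lead_coef p * lead_coef r = 1.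
  by rewrite -lead_coefM -fpr (monicP monic_unitpoly).
have [lp lr] : `|lead_coef p|%N = 1%N /\ `|lead_coef r|%N = 1%N.
  have /eqP : (`|lead_coef p| * `|lead_coef r|)%N = 1%N by rewrite -abszM lc.
  by rewrite muln_eq1 => /andP[/eqP -> /eqP ->].
have [s Ds] := closed_field_poly_normal (map_poly intr p : {poly algC}).
have [t Dt] := closed_field_poly_normal (map_poly intr r : {poly algC}).
rewrite lead_coef_map_inj ?rmorph0 // in Ds; last exact: intr_inj.
rewrite lead_coef_map_inj ?rmorph0 // in Dt; last exact: intr_inj.
have st : perm_eq (s ++ t) (codom rho).
  apply: prod_XsubC_eq; rewrite big_cat /= big_map big_enum /= -f_rho fpr rmorphM /= Ds Dt.
  by rewrite -scalerAl -scalerAr scalerA -rmorphM lc scale1r.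
have ts : perm_eq (t ++ s) (codom rho) by rewrite perm_catC.
have : rho ord_max \notin s \/ rho ord_max \notin t.
  have us : uniq (s ++ t).
    by rewrite (perm_uniq st) map_inj_uniq ?enum_uniq //; exact: rho_inj.
  case: (boolP (rho ord_max \in s)) => [hs|]; [right|by left].
  apply/negP => ht; move: us; rewrite cat_uniq => /and3P[_ /hasP[]].
  by exists (rho ord_max).
case.
  move/(unitpoly_factor fpr Ds lp st) => s0; exfalso; move: sq; rewrite qp size_scale //.
  have := size_map_inj_poly (@intr_inj algC) (rmorph0 _) p; rewrite Ds s0 big_nil.
  rewrite size_map_inj_poly ?rmorph0 //; last exact: intr_inj.
  rewrite size_scale ?size_poly1; first by move=> <-.
  by rewrite intr_eq0; apply: contra_eq_neq lp => ->.
have frp : f = r * p by rewrite mulrC.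
move/(unitpoly_factor frp Dt lr ts) => t0.
have sr : size r = 1%N.
  have := size_map_inj_poly (@intr_inj algC) (rmorph0 _) r; rewrite Dt t0 big_nil.
  rewrite size_scale ?size_poly1; first by move=> <-.
  by rewrite intr_eq0; apply: contra_eq_neq lr => ->.
have /size_poly1P [k k0 hk] : size r == 1%N by rewrite sr.
rewrite qp fpr hk rmorphM /= map_polyC mulrC mul_polyC eqp_sym.
apply: (eqp_trans (y := map_poly intr p)); first by rewrite eqp_scale // intr_eq0.
by rewrite eqp_sym eqp_scale.
Qed.
End Roots.

(** * Power residue obstruction *)

Section Lift.
Variable p : nat.
Hypothesis p_pr : prime p.

Lemma Fp_int_eq0 (z : int) : (z%:~R == 0 :> 'F_p) = (p %| `|z|)%N.
Proof.
have -> : (z%:~R == 0 :> 'F_p) = (`|z|%:R == 0 :> 'F_p).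
  by case: (intP z) => [|n|n] //; rewrite ?mulrNz ?oppr_eq0 abszN.
by rewrite (dvdn_pcharf (pchar_Fp p_pr)).
Qed.

Definition liftFp (h : {poly 'F_p}) : {poly int} := map_poly (fun a : 'F_p => (val a)%:Z) h.

Lemma liftFpK h : map_poly intr (liftFp h) = h.
Proof.
apply/polyP => i; rewrite coef_map coef_map_id0 //=.
exact: natr_Zp.
Qed.

Lemma Fp_poly_eq0 (P : {poly int}) : map_poly intr P = 0 :> {poly 'F_p} ->
  exists G : {poly int}, P = p%:Z *: G.
Proof.
move=> P0; exists (map_poly (fun z => (z %/ p)%Z) P); apply/polyP => i.
rewrite coefZ coef_map_id0 ?div0z //.
have /eqP : (P`_i)%:~R = 0 :> 'F_p by have /polyP/(_ i) := P0; rewrite coef_map coef0.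
by rewrite Fp_int_eq0 => h; rewrite mulrC divzK // dvdzE.
Qed.
End Lift.

(** * Reduction modulo a prime at a simple root *)

Section ResidueTest.
Variables (L : fieldExtType rat) (z : L) (f : {poly int}).
Hypothesis mon_f : f \is monic.
Hypothesis irr_f : irreducible_poly (map_poly intr f : {poly rat}).
Hypothesis root_f : root (map_poly intr f) z.
Hypothesis gen_z : <<1; z>>%VS = fullv.
Variables (p : nat) (x : 'F_p).
Hypothesis p_pr : prime p.
Hypothesis fx0 : (map_poly intr f).[x] = 0.
Hypothesis dfx : (map_poly intr f^`()).[x] != 0.

Let evL (P : {poly int}) : L := (map_poly intr P).[z].
Let evp (P : {poly int}) : 'F_p := (map_poly intr P).[x].

Let evLM P Q : evL (P * Q) = evL P * evL Q.
Proof. by rewrite /evL rmorphM hornerM. Qed.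
Let evpM P Q : evp (P * Q) = evp P * evp Q.
Proof. by rewrite /evp rmorphM hornerM. Qed.

Lemma map_in_alg_intr (P : {poly int}) : map_poly (in_alg L) (map_poly intr P) = map_poly intr P.
Proof.
by rewrite -map_poly_comp; apply: eq_map_poly => a /=; rewrite -[RHS](rmorph_int (in_alg L)).
Qed.

Let root_f' : root (map_poly (in_alg L) (map_poly intr f)) z.
Proof. by rewrite map_in_alg_intr. Qed.

(** As [f] is monic, an integer polynomial vanishing at [z] is a multiple of [f] over the integers.
    So [evp] depends only on [evL]: it is a ring morphism from [Z[z]] to ['F_p]. *)
Lemma ev_ker P : evL P = 0 -> evp P = 0.
Proof.
rewrite /evL -map_in_alg_intr => /(poly_ker irr_f root_f'); rewrite dvdp_rat_int.
case/(Pdiv.IdomainMonic.dvdpP mon_f) => Q ->.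
by rewrite evpM [evp f]fx0 mulr0.
Qed.

Lemma clear_denominator (b : L) : exists (d : nat) (B : {poly int}), (0 < d)%N /\ d%:R * b = evL B.
Proof.
have [P <-] := poly_gen gen_z b; have [B [a a0 ->]] := rat_poly_scale P.
have -> : (map_poly (in_alg L) (a%:~R^-1 *: map_poly intr B)).[z] = (a%:~R)^-1 * evL B.
  by rewrite map_polyZ hornerZ map_in_alg_intr fmorphV rmorph_int.
have aL : a%:~R != 0 :> L by rewrite -(rmorph_int (in_alg L)) fmorph_eq0 intr_eq0.
(* The square keeps the denominator positive whatever the sign of [a]. *)
exists (absz ((a : int) * a)), ((a : int) *: B); rewrite absz_gt0 mulf_neq0 //; split=> //.
rewrite pmulrn gez0_abs -?expr2 ?sqr_ge0 // expr2 intrM mulrA mulfK //.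
by rewrite /evL map_polyZ hornerZ.
Qed.

Hypothesis int_z : integral z.

Let int_evL P : integral (evL P).
Proof. exact: integral_horner. Qed.

(* Take for [H] a lift of [f / (X - x)]. *)
Lemma cofactor_exists : exists H : {poly int}, evp H != 0 /\
  forall B, evp B = 0 -> exists C, evL (H * B) = p%:R * evL C.
Proof.
have fac (P : {poly int}) : evp P = 0 -> exists h : {poly 'F_p}, map_poly intr P = h * ('X - x%:P).
  by move=> P0; apply/factor_theorem; rewrite rootE; apply/eqP.
have [h hf] := fac _ fx0.
pose X1 : {poly int} := 'X - (val x)%:Z%:P.
have X1E : map_poly intr X1 = 'X - x%:P :> {poly 'F_p}.
  by rewrite rmorphB /= map_polyX map_polyC /= [_%:~R](natr_Zp x).
exists (liftFp h); split.
  rewrite /evp liftFpK; move: dfx; rewrite -deriv_map hf derivM derivB derivX derivC subr0 mulr1.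
  by rewrite hornerD hornerM hornerXsubC subrr mulr0 add0r.
move=> B B0; have [b hb] := fac _ B0.
have [G1 hG1] : exists G, f - liftFp h * X1 = p%:Z *: G.
  by apply: (Fp_poly_eq0 p_pr); rewrite rmorphB rmorphM /= liftFpK X1E hf subrr.
have [G2 hG2] : exists G, B - liftFp b * X1 = p%:Z *: G.
  by apply: (Fp_poly_eq0 p_pr); rewrite rmorphB rmorphM /= liftFpK X1E hb subrr.
have eB : B = liftFp b * X1 + p%:Z *: G2 by rewrite -hG2 addrC subrK.
have eX : liftFp h * X1 = f - p%:Z *: G1 by rewrite -hG1 opprB addrC subrK.
exists (liftFp h * G2 - liftFp b * G1).
have -> : liftFp h * B = liftFp b * f + p%:Z%:P * (liftFp h * G2 - liftFp b * G1).
  rewrite eB mulrDr mulrCA eX -!mul_polyC; ring.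
rewrite {1}/evL rmorphD hornerD [X in X + _]evLM [evL f](rootP root_f) mulr0 add0r.
by rewrite [LHS]evLM {1}/evL map_polyC hornerC.
Qed.

(** If [p ^ k.+1 * b] is the value of [B], integrality of [b] forces [B] to vanish at [x]. Then
    [H * B] is divisible by [p], so each factor [H] removes one [p] from the denominator. *)
Lemma local_integral (H : {poly int}) k (b : L) (B : {poly int}) :
    (forall B, evp B = 0 -> exists C, evL (H * B) = p%:R * evL C) ->
    integral b -> p%:R ^+ k * b = evL B ->
  exists r C, evL H ^+ r * b = evL C.
Proof.
move=> hH; have p0 : p%:R != 0 :> L by rewrite ext_natr_eq0 -lt0n prime_gt0.
elim: k b B => [|k IH] b B intb eB; first by exists 0, B; rewrite !expr0 !mul1r in eB *.
have B0 : evp B = 0.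
  have [P [mP rP]] := intb; set m := (size P).-1.
  (* The monic equation of [b] multiplied by [p ^ (k.+1 * m)]: modulo [p] only its leading term
     [B ^ m] survives. *)
  pose T := \sum_(i < size P) (P`_i * (p%:Z ^+ (k.+1 * (m - i))))%:P * B ^+ i.
  have evT (A : comRingType) (y : A) : (map_poly intr T).[y] =
     \sum_(i < size P) (P`_i)%:~R * p%:R ^+ (k.+1 * (m - i)) * (map_poly intr B).[y] ^+ i.
    rewrite /T rmorph_sum horner_sum; apply: eq_bigr => i _ /=.
    rewrite [map_poly _ (_ * _)]rmorphM /= map_polyC hornerM hornerC /=.
    by rewrite [map_poly _ (B ^+ i)]rmorphXn horner_exp rmorphM rmorphXn /= -pmulrn.
  have szP : size P = m.+1 by rewrite prednK // lt0n size_poly_eq0 monic_neq0.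
  have T0 : evL T = 0.
    rewrite /evL evT -/(evL B) -eB.
    transitivity (p%:R ^+ (k.+1 * m) * (map_poly intr P).[b]); last by rewrite (rootP rP) mulr0.
    rewrite (@horner_coef_wide _ (size P)) ?size_poly // mulr_sumr; apply: eq_bigr => i _.
    have -> : (k.+1 * m = k.+1 * (m - i) + k.+1 * i)%N by rewrite -mulnDr subnK // -ltnS -szP.
    by rewrite coef_map /= exprMn -exprM exprD; ring.
  have := ev_ker T0; rewrite /evp evT szP big_ord_recr /= big1 => [|i _].
    rewrite add0r subnn muln0 expr0 mulr1 -[P`_m]/(lead_coef P) (monicP mP) mul1r.
    by move/eqP; rewrite expf_eq0 => /andP[_ /eqP].
  by rewrite pchar_Fp_0 // expr0n muln_eq0 /= subn_eq0 leqNgt ltn_ord mulr0 mul0r.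
have [C hC] := hH _ B0.
have hb : p%:R ^+ k * (evL H * b) = evL C.
  by apply: (mulfI p0); rewrite -hC evLM -eB exprS; ring.
have [|r [D hD]] := IH _ _ _ hb; first exact: integralM.
by exists r.+1, D; rewrite -hD exprSr mulrA.
Qed.

(** The element [b] need not lie in [Z[z]], but it is a fraction whose denominator, a power of [H]
    times an integer prime to [p], does not vanish at [x]. The reduction of that fraction is the
    required root. *)
Lemma residue_power (M : {poly int}) (b : L) (q : nat) : (0 < q)%N -> b ^+ q = evL M ->
  exists y : 'F_p, y ^+ q = evp M.
Proof.
move=> q0 bM; have intb : integral b by apply: (integral_root_exp q0); rewrite bM.
have [H [H0 hH]] := cofactor_exists.
have [d [B [d0 hB]]] := clear_denominator b.
have [d1 cop ed] := pfactor_coprime p_pr d0; set k := logn p d in ed.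
have hd : p%:R ^+ k * (d1%:R * b) = evL B by rewrite -hB ed natrM natrX; ring.
have [|r [C hC]] := local_integral hH _ hd.
  by apply: integralM => //; exact: integral_nat.
have d1n : d1%:R != 0 :> 'F_p by rewrite -unitfE unitFpE // -prime_coprime.
have evX P n : evL (P ^+ n) = evL P ^+ n by rewrite /evL rmorphXn horner_exp.
have evpX P n : evp (P ^+ n) = evp P ^+ n by rewrite /evp rmorphXn horner_exp.
have e : evL (C ^+ q - H ^+ (r * q) * (d1 ^ q)%N%:Z%:P * M) = 0.
  have -> (P Q : {poly int}) : evL (P - Q) = evL P - evL Q by rewrite /evL rmorphB hornerD hornerN.
  rewrite !evLM !evX -hC -bM [evL _%:P]/evL map_polyC hornerC /= -pmulrn natrX exprM !exprMn.
  by rewrite mulrA subrr.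
have := ev_ker e.
have -> (P Q : {poly int}) : evp (P - Q) = evp P - evp Q by rewrite /evp rmorphB hornerD hornerN.
move/eqP; rewrite subr_eq0 !evpM !evpX [evp _%:P]/evp map_polyC hornerC /= -pmulrn natrX => /eqP e2.
exists (evp C / (evp H ^+ r * d1%:R)); rewrite expr_div_n e2 exprMn -exprM.
by rewrite mulrAC mulfV ?mul1r // mulf_neq0 // !expf_neq0.
Qed.

End ResidueTest.

(** * Auxiliary primes and parameters *)

Lemma Fp_fermat (p : nat) (x : 'F_p) : prime p -> x != 0 -> x ^+ p.-1 = 1.
Proof.
move=> p_pr x0; apply: (mulfI x0); rewrite -exprS prednK ?prime_gt0 // mulr1.
by have := expf_card x; rewrite card_Fp.
Qed.

(** Otherwise [y] would be a double root of ['X^M - 1], whose derivative vanishes only at 0 when [p]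
    does not divide [M]. *)
Lemma Cyclotomic_double_root (p M d : nat) (y : 'F_p) : prime p -> (0 < M)%N ->
    (d %| M)%N -> d != M -> ~~ (p %| M)%N -> y != 0 ->
    (map_poly intr (Cyclotomic M)).[y] = 0 -> (map_poly intr (Cyclotomic d)).[y] != 0.
Proof.
move=> p_pr M0 dM dnM npM y0 rM; apply/eqP => rd.
have [uD _ inD] := divisors_correct M0.
have [R hR] : exists R : {poly int}, Cyclotomic M * (Cyclotomic d * R) = 'X^M - 1.
  exists (\prod_(e <- rem d (rem M (divisors M))) Cyclotomic e).
  rewrite -prod_Cyclotomic // [RHS](big_rem M) ?inD //=; congr (_ * _).
  by rewrite [RHS](big_rem d) // mem_rem_uniq // !inE dnM inD.
have L0 : (map_poly intr (Cyclotomic M * (Cyclotomic d * R))^`()).[y] = 0.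
  by rewrite derivM rmorphD !rmorphM hornerD !hornerM /= rM rd !(mul0r, mulr0) addr0.
move: L0; rewrite hR derivB derivC subr0 derivXn rmorphMn /= map_polyXn hornerMn hornerXn.
move/eqP; rewrite -mulr_natr mulf_eq0 expf_eq0 (negPf y0) andbF /=.
by rewrite -(dvdn_pcharf (pchar_Fp p_pr)) (negPf npM).
Qed.

(* Take a prime divisor [p] of [Phi_M y], where [y] is a multiple of [M * K`!]: then [y] has order
   exactly [M] modulo [p]. *)
Lemma prime_1mod (M K : nat) : (0 < M)%N -> exists p, [/\ prime p, (K < p)%N & (M %| p.-1)%N].
Proof.
move=> M0; pose Phi := Cyclotomic M.
have Phi0 : `|Phi.[0]|%N = 1%N.
  have := congr1 (fun P : {poly int} => P.[0]) (prod_Cyclotomic M0).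
  have [uD _ inD] := divisors_correct M0.
  rewrite (big_rem M) ?inD //= hornerM hornerD hornerXn hornerN hornerC expr0n eqn0Ngt M0 sub0r.
  by move/(congr1 absz)/eqP; rewrite abszM muln_eq1 => /andP[/eqP].
have szPhi : (1 < size Phi)%N by rewrite size_Cyclotomic ltnS totient_gt0.
(* [Q] has finitely many roots, so some [Y k] gives [Phi] a value other than 0, 1 and -1, which
   therefore has a prime divisor. *)
pose Q := Phi * (Phi - 1) * (Phi + 1).
have szc (c : {poly int}) : (size c <= 1)%N -> Phi + c != 0.
  move=> hc; rewrite -size_poly_eq0 size_polyDl ?(leq_ltn_trans hc szPhi) //.
  by rewrite -lt0n (ltn_trans _ szPhi).
have Q0 : Q != 0.
  rewrite !mulf_neq0 //; first by rewrite -[Phi]addr0 szc // size_poly0.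
    by rewrite szc // size_polyN size_poly1.
  by rewrite szc // size_poly1.
pose Y k := (k.+1 * (M * K`!))%N.
have MK0 : (0 < M * K`!)%N by rewrite muln_gt0 M0 fact_gt0.
have [k hk] : exists k, ~~ root Q (Y k)%:Z.
  apply: contrapT => h.
  suff : (size [seq (Y k)%:Z | k <- iota 0 (size Q)] < size Q)%N by rewrite size_map size_iota ltnn.
  apply: max_poly_roots => //.
    by apply/allP => _ /mapP[k _ ->]; apply: contrapT => /negP hk; apply: h; exists k.
  rewrite map_inj_uniq ?iota_uniq // => i j [] /eqP.
  by rewrite /Y eqn_pmul2r // => /eqP [].
pose v := Phi.[(Y k)%:Z].
have [v0 v1] : v != 0 /\ `|v|%N != 1%N.
  move: hk; rewrite rootE !hornerM !hornerD hornerN hornerC -/v !mulf_eq0 !negb_or.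
  move=> /andP[/andP[v0]]; rewrite subr_eq0 addr_eq0 => v1 v2; split=> //.
  by move: v1 v2; case: (intP v) => [|n|n] //; rewrite ?abszN /= ?eqr_opp => h1 h2.
have v2 : (1 < `|v|)%N by case: (`|v|%N) v1 (absz_eq0 v) => [|[]] //; rewrite (negPf v0).
pose p := pdiv `|v|; have p_pr : prime p by apply: pdiv_prime.
pose y : 'F_p := (Y k)%:R.
have ry : (map_poly intr Phi).[y] = 0.
  have -> : y = ((Y k)%:Z)%:~R by [].
  by rewrite horner_map /= -/v; apply/eqP; rewrite Fp_int_eq0 // pdiv_dvd.
(* [Phi] vanishes at [y] modulo [p] but is a unit at 0. So [p] does not divide [Y k], a multiple of
   [M] and of the factorial of [K]; this gives both [K < p] and [p] prime to [M]. *)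
have y0 : y != 0.
  apply/eqP => y0; move: ry; rewrite y0 -(rmorph0 (intr : int -> 'F_p)) horner_map /= => /eqP.
  by rewrite Fp_int_eq0 // Phi0 dvdn1 => /eqP p1; rewrite p1 in p_pr.
have npY : ~~ (p %| Y k)%N by rewrite (dvdn_pcharf (pchar_Fp p_pr)).
have npM : ~~ (p %| M)%N.
  by apply: contra npY => h; rewrite /Y dvdn_mull // dvdn_mulr.
exists p; split=> //.
  rewrite ltnNge; apply: contra npY => h; rewrite /Y dvdn_mull // dvdn_mull //.
  by rewrite dvdn_fact // prime_gt0.
have [uD _ inD] := divisors_correct M0.
have yM : y ^+ M = 1.
  apply/eqP; rewrite -subr_eq0.
  have := congr1 (fun P : {poly int} => (map_poly intr P).[y]) (prod_Cyclotomic M0).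
  rewrite (big_rem M) ?inD //= rmorphM hornerM ry mul0r rmorphB /= map_polyXn rmorph1.
  by rewrite hornerD hornerXn hornerN hornerC => <-.
have [d yd dM] := prim_order_exists M0 yM.
have d0 := prim_order_gt0 yd.
have dE : d = M.
  apply/eqP; apply: contraT => dnM.
  have := congr1 (fun P : {poly int} => (map_poly intr P).[y]) (prod_Cyclotomic d0).
  rewrite rmorphB /= map_polyXn rmorph1 hornerD hornerXn hornerN hornerC (prim_expr_order yd) subrr.
  rewrite rmorph_prod horner_prod big_tnth => /eqP/prodf_eq0[i _ /eqP].
  have [_ _ inDd] := divisors_correct d0.
  have : tnth (in_tuple (divisors d)) i \in divisors d by apply: mem_tnth.
  set e := tnth _ _; rewrite inDd => ed re.
  have eM : e != M by apply: contra dnM => /eqP eM; rewrite eqn_dvd dM -eM.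
  by have := Cyclotomic_double_root p_pr M0 (dvdn_trans ed dM) eM npM y0 ry; rewrite re eqxx.
by rewrite -dE (prim_order_dvd yd) Fp_fermat.
Qed.

Lemma Fp_prim_root (p : nat) : prime p -> exists z : 'F_p, p.-1.-primitive_root z.
Proof.
move=> p_pr; pose rs := [seq x <- enum 'F_p | x != 0].
have szrs : size rs = p.-1.
  have := count_predC (pred1 (0 : 'F_p)) (enum 'F_p).
  rewrite -cardE card_Fp // count_uniq_mem ?enum_uniq // mem_enum => e.
  apply: (@addnI 1); rewrite [RHS]add1n prednK ?prime_gt0 // -[RHS]e size_filter.
  by congr (_ + _)%N.
have p1 : (0 < p.-1)%N by have := prime_gt1 p_pr; case: (p) => [|[]].
have : has p.-1.-primitive_root rs.
  apply: has_prim_root => //; last by rewrite szrs.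
    apply/allP => x; rewrite mem_filter => /andP[x0 _]; apply/unity_rootP; exact: Fp_fermat.
  by apply: filter_uniq; apply: enum_uniq.
by case/hasP => z _ hz; exists z.
Qed.

(** The sign matches the one in the relation between units. All primes [q] dividing [l] are treated
    at once, since the field is chosen before [q] is known. *)
Definition nonresidue (p l : nat) (g : 'F_p) := forall (q e : nat) (y : 'F_p),
  prime q -> (q %| l)%N -> g ^+ e = y ^+ q \/ g ^+ e = - y ^+ q -> (q %| e)%N.

(** A power [z ^ (1 + l * k)] of a primitive root has exponent 1 modulo every [q] dividing [l]. The
    values [k < 3] give three distinct elements, and the quadratic polynomial has at most two roots.
    The factor 4 makes room for these exponents below [p.-1] and makes [p.-1 / q] even, which
    removes the sign. *)
Lemma nonresidue_exists (p l : nat) (u v : 'F_p) : prime p -> (0 < l)%N -> (4 * l %| p.-1)%N ->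
  exists g : 'F_p, [/\ g != 0, g ^+ 2 + u * g + v != 0 & nonresidue l g].
Proof.
move=> p_pr l0 hl; have [z pz] := Fp_prim_root p_pr.
have p1 : (0 < p.-1)%N by apply: prim_order_gt0 pz.
have z0 : z != 0 by apply/eqP => z0; have := prim_expr_order pz; rewrite z0 expr0n gtn_eqF // => /eqP; rewrite eq_sym oner_eq0.
have lt : (4 * l <= p.-1)%N by apply: dvdn_leq.
have [k hk] : exists k : 'I_3, (z ^+ (1 + l * k)) ^+ 2 + u * z ^+ (1 + l * k) + v != 0.
  apply: contrapT => h; pose P : {poly 'F_p} := 'X^2 + (u *: 'X + v%:P).
  have szP : size P = 3%N.
    rewrite size_polyDl size_polyXn //; apply: leq_ltn_trans (size_polyD _ _) _.
    rewrite gtn_max (leq_ltn_trans (size_scale_leq _ _)) ?size_polyX //.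
    by rewrite (leq_ltn_trans (size_polyC_leq1 _)).
  have P0 : P != 0 by rewrite -size_poly_eq0 szP.
  suff : (size [seq z ^+ (1 + l * k) | k : 'I_3] < size P)%N by rewrite size_map size_enum_ord szP.
  apply: max_poly_roots => //.
    apply/allP => _ /mapP[k _ ->]; apply: contrapT => /negP hk; apply: h; exists k.
    by move: hk; rewrite rootE !hornerE.
  rewrite map_inj_uniq ?enum_uniq // => i j /eqP; rewrite (eq_prim_root_expr pz).
  have b (k3 : 'I_3) : (1 + l * k3 < p.-1)%N by case: k3 => [[|[|[|]]]] //= _; lia.
  by rewrite !modn_small // eqn_add2l eqn_pmul2l // => /eqP /val_inj.
exists (z ^+ (1 + l * k)); split=> //; first by rewrite expf_neq0.
move=> q e y q_pr ql hy.
have q0 := prime_gt0 q_pr.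
have [l' el] := dvdnP ql; have [c ec] := dvdnP hl.
pose n := (c * 4 * l')%N.
have en : (p.-1 = n * q)%N by rewrite ec el /n; ring.
have y0 : y != 0.
  apply/eqP => y0; case: hy => /eqP; rewrite y0 expr0n gtn_eqF //= ?oppr0 => h;
  by move: h; rewrite !expf_eq0 (negPf z0) !andbF.
have yp := Fp_fermat p_pr y0.
have : ((z ^+ (1 + l * k)) ^+ e) ^+ n = 1.
  have s1 : (y ^+ q) ^+ n = 1 by rewrite -exprM mulnC -en.
  case: hy => ->; rewrite // exprNn s1 mulr1 -signr_odd /n.
  by rewrite !oddM andbF.
rewrite -!exprM => /eqP; rewrite -(prim_order_dvd pz) en.
have n0 : (0 < n)%N by move: p1; rewrite en muln_gt0 => /andP[].
rewrite mulnA [X in (_ %| X)%N]mulnC dvdn_pmul2l // Gauss_dvdr //.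
by rewrite /coprime el mulnAC addnC gcdnMDl gcdn1.
Qed.

Lemma coprime_prod_ord (n q : nat) (P : nat -> nat) :
  (forall i, (i < n)%N -> coprime (P i) q) -> coprime (\prod_(i < n) P i)%N q.
Proof.
by move=> h; elim/big_ind: _ => [|x y hx hy|i _]; rewrite ?coprime1n ?coprimeMl ?hx ?hy ?h.
Qed.

Lemma crt_seq (n : nat) (P c : nat -> nat) :
  (forall i j, (i < j < n)%N -> coprime (P i) (P j)) ->
  exists r, forall j, (j < n)%N -> r = c j %[mod P j].
Proof.
elim: n => [|n IH] cop; first by exists 0.
have [|r hr] := IH; first by move=> i j /andP[ij jn]; apply: cop; rewrite ij ltnW.
have co : coprime (\prod_(i < n) P i)%N (P n).
  by apply: coprime_prod_ord => i lt; apply: cop; rewrite lt ltnSn.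
exists (chinese (\prod_(i < n) P i)%N (P n) r (c n)) => j.
rewrite ltnS leq_eqVlt => /predU1P[->|lt]; first exact: chinese_modr.
have dv : (P j %| \prod_(i < n) P i)%N by rewrite (bigD1 (Ordinal lt)) //= dvdn_mulr.
by rewrite -(modn_dvdm _ dv) (chinese_modl co) (modn_dvdm _ dv) hr.
Qed.

Lemma expn_1D (A u l : nat) : exists k, ((1 + A * u) ^ l = 1 + A * (l * u + A * k))%N.
Proof.
elim: l => [|l [k hk]]; first by exists 0; rewrite expn0 !mul0n !muln0.
by exists (k + u * (l * u + A * k))%N; rewrite expnS hk; ring.
Qed.

(* Modulo [p], [x] is a root of the defining polynomial of the field, at which the [x - a i] are [1]
   except for one which is the non-residue [g], and [x - b = - dl / g].  The condition on the
   quadratic polynomial in [g] means that the root is simple. *)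
Definition local_data (m l : nat) (a : nat -> nat) (b j : nat) : Prop :=
  exists (p : nat) (x g : 'F_p), let dl := (-1) ^+ m.+1 : 'F_p in
    [/\ prime p, nonresidue l g /\ g != 0,
        g ^+ 2 + (- dl * m.-1%:R) * g - dl != 0,
        x = (if (j < m)%N then 1 else g) /\ b%:R = x + dl / g &
        forall i, (i < m)%N ->
          (a i)%:R = x - (if i == (if (j < m)%N then j else 0%N) then g else 1)].

(** The elementary symmetric function of degree [m - 1]. Up to sign, [A + b * esym_pred m a] is the
    linear coefficient of the defining polynomial. *)
Definition esym_pred (m : nat) (a : nat -> nat) := (\sum_(i < m) \prod_(k < m | k != i) a k)%N.

(* The prescribed primes divide [A] and [b = l * u modulo A], where [t = 1 + A * u]; so the value of
   [b] modulo them can be prescribed through [u]. *)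
Lemma parameters (m l : nat) : (2 <= m)%N -> (1 <= l)%N ->
  exists (a b : nat -> nat) (u0 Q : nat), let A := (\prod_(i < m) a i)%N in
    let t s := (1 + A * (u0 + s * Q))%N in
    [/\ forall i j, (i < j)%N -> (a i + 3 <= a j)%N, (0 < A)%N /\ (0 < Q)%N,
        forall s, (A * b s + 1 = t s ^ l)%N,
        forall s, coprime (t s) (A + b s * esym_pred m a) &
        forall s j, (j <= m)%N -> local_data m l a (b s) j].
Proof.
move=> m2 l1; have m0 : (0 < m)%N by apply: ltn_trans m2.
have l4 : (0 < 4 * l)%N by rewrite muln_gt0.
have [next hnext] := choice (fun K => prime_1mod K l4).
pose pr k := iter k next (next 0%N).
have prP k : prime (pr k) /\ (4 * l %| (pr k).-1)%N.
  by rewrite /pr; case: k => [|k] /=; [case: (hnext 0%N)|case: (hnext (iter k next (next 0%N)))].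
have pr_pr k : prime (pr k) by case: (prP k).
have pr_lt i j : (i < j)%N -> (pr i < pr j)%N.
  elim: j => // j IH; rewrite ltnS leq_eqVlt => /predU1P[->|/IH lt]; first by case: (hnext (pr j)).
  by apply: ltn_trans lt _; case: (hnext (pr j)).
have pr_cop i j : (i < j)%N -> coprime (pr i) (pr j).
  by move=> /pr_lt lt; rewrite prime_coprime // dvdn_prime2 // ltn_eqF.
have hg k : exists g : nat, let gg : 'F_(pr k) := g%:R in let dl := (-1) ^+ m.+1 : 'F_(pr k) in
    [/\ gg != 0, gg ^+ 2 + (- dl * m.-1%:R) * gg - dl != 0 & nonresidue l gg].
  have [_ hd] := prP k.
  have [g hg] := nonresidue_exists (- (-1) ^+ m.+1 * m.-1%:R) (- (-1) ^+ m.+1) (pr_pr k) l1 hd.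
  by exists (val g); rewrite /= natr_Zp.
have [g {}hg] := choice hg.
pose x j : 'F_(pr j) := if (j < m)%N then 1 else (g j)%:R.
pose kap j := if (j < m)%N then j else 0%N.
have ex_nat j (y : 'F_(pr j)) : exists n : nat, n%:R = y by exists (val y); rewrite natr_Zp.
have mod_eq j (n n' : nat) : n = n' %[mod pr j] -> n%:R = n'%:R :> 'F_(pr j).
  by move=> e; rewrite -(Fp_nat_mod (pr_pr j)) e Fp_nat_mod.
pose PI := (\prod_(j < m.+1) pr j)%N.
have PI_dvd j : (j < m.+1)%N -> (pr j %| PI)%N.
  by move=> lt; rewrite /PI (bigD1 (Ordinal lt)) //= dvdn_mulr.
have PI0 : (0 < PI)%N by apply: prodn_gt0 => j; apply: prime_gt0.
have PI2 : (2 <= PI)%N by apply: leq_trans (dvdn_leq PI0 (PI_dvd 0%N isT)); apply: prime_gt1.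
have ex_r i : exists r : nat, (r < PI)%N /\ forall j, (j < m.+1)%N ->
    r%:R = x j - (if i == kap j then (g j)%:R else 1).
  have [c hc] := choice (fun j => ex_nat j (x j - (if i == kap j then (g j)%:R else 1))).
  have [|r hr] := @crt_seq m.+1 pr c; first by move=> i' j /andP[/pr_cop].
  exists (r %% PI)%N; rewrite ltn_mod PI0; split=> // j lt.
  by rewrite -hc; apply: mod_eq; rewrite modn_dvdm ?PI_dvd // hr.
have [r hr] := choice ex_r.
(* Adding a multiple of [PI] keeps the prescribed residues; the factor [m + 3] provides the gaps of
   3 and makes [a i] exceed [m]. *)
pose a i := (r i + i.+1 * (PI * (m + 3)))%N.
have a_r i j : (j < m.+1)%N -> (a i)%:R = x j - (if i == kap j then (g j)%:R else 1).
  move=> lt; rewrite -(proj2 (hr i) j lt); apply: mod_eq.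
  by apply/eqP; rewrite -[X in _ == X %[mod _]]addn0 eqn_modDl mod0n -/(dvdn _ _) mulnCA dvdn_mulr // PI_dvd.
have a_sep i j : (i < j)%N -> (a i + 3 <= a j)%N.
  move=> lt; have [h _] := hr i; rewrite /a.
  have h2 : (i.+1 * (PI * (m + 3)) + PI * (m + 3) <= j.+1 * (PI * (m + 3)))%N.
    by rewrite -mulSnr leq_mul2r ltnS lt orbT.
  by nia.
have a_big i : (m < a i)%N.
  by rewrite /a mulSn mulnDr; nia.
have a0 i : (0 < a i)%N by apply: leq_ltn_trans (a_big i).
pose A := (\prod_(i < m) a i)%N.
have A0 : (0 < A)%N by apply: prodn_gt0.
pose E := esym_pred m a.
(* Each of the [m] terms of [E] is [A / a i] with [a i > m]. *)
have EA : (E < A)%N.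
  suff h : (m.+1 * E <= m * A)%N.
    rewrite ltnNge; apply/negP => le; have := leq_trans h (leq_mul (leqnn m) le).
    rewrite mulSn -[X in (_ <= X)%N]add0n leq_add2r leqn0 => /eqP E0.
    by move: le; rewrite E0 leqNgt A0.
  rewrite /E /esym_pred big_distrr /= -[X in (_ <= X * _)%N](card_ord m) -sum_nat_const.
  apply: leq_sum => i _; rewrite /A [X in (_ <= X)%N](bigD1 i) //= leq_mul2r; apply/orP; right; exact: a_big.
(* Since [A * (A + b * E) = V + t ^ l * E], a prime dividing both [t] and [A + b * E] divides [V].
   If it divides [PI] it divides [A], otherwise it divides [W]; as [u] is chosen divisible by [W],
   [t] is 1 modulo both [A] and [W], a contradiction. *)
pose V := (A * A - E)%N.
have V0 : (0 < V)%N by rewrite subn_gt0; apply: leq_trans EA _; rewrite leq_pmulr.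
pose W := (V`_(\pi(PI)^'))%N.
have W0 : (0 < W)%N by apply: part_gt0.
have copW j : (j < m.+1)%N -> coprime (pr j) W.
  move=> lt; rewrite prime_coprime //; apply/negP => dv.
  have := part_pnat (\pi(PI)^') V; rewrite /pnat => /andP[_ /allP/(_ (pr j))].
  rewrite -/W mem_primes pr_pr W0 dv => /(_ isT).
  by rewrite !inE /= mem_primes pr_pr PI0 PI_dvd.
pose tgt j : 'F_(pr j) := (x j + (-1) ^+ m.+1 / (g j)%:R) / l%:R.
have [c hc] := choice (fun j => ex_nat j (tgt j)).
have [u1 hu1] : exists u1, forall j, (j < m.+1)%N -> u1 = c j %[mod pr j].
  by apply: crt_seq => i j /andP[/pr_cop].
have coPW : coprime PI W by apply: coprime_prod_ord => j; apply: copW.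
pose u0 := chinese PI W u1 0.
(* For [j < m], any [a i] with [i] other than [j] vanishes modulo [pr j], and such an [i] exists as
   [m >= 2]; for [j = m], [a 0] does. *)
have A_pr j : (j < m.+1)%N -> (pr j %| A)%N.
  move=> lt; have [i im hi] : exists2 i, (i < m)%N & (a i)%:R = 0 :> 'F_(pr j).
    case: (boolP (j < m)%N) => jm; last first.
      by exists 0%N => //; rewrite a_r // /x /kap (negPf jm) eqxx subrr.
    pose i := if j == 0%N then 1%N else 0%N.
    have ij : i != j by rewrite /i; case: (j) => [|[]].
    exists i; first by rewrite /i; case: eqP.
    by rewrite a_r // /x /kap jm (negPf ij) subrr.
  rewrite /A (bigD1 (Ordinal im)) //= dvdn_mulr //.
  by rewrite (dvdn_pcharf (pchar_Fp (pr_pr j))); apply/eqP.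
have exb s : exists b, let u := (u0 + s * (PI * W))%N in
    (A * b + 1 = (1 + A * u) ^ l)%N /\ exists k, (b = l * u + A * k)%N.
  have [k hk] := expn_1D A (u0 + s * (PI * W)) l.
  by exists (l * (u0 + s * (PI * W)) + A * k)%N; rewrite /= hk addnC; split=> //; exists k.
have [b hb] := choice exb.
exists a, b, u0, (PI * W)%N; split=> //.
- by rewrite muln_gt0 PI0.
- by move=> s; case: (hb s).
- move=> s; have [eb _] := hb s; rewrite /= -/A -/E in eb *; set t := (1 + _)%N in eb *.
  have t0 : (0 < t)%N by [].
  have tu : (W %| t.-1)%N.
    rewrite /t add1n /= dvdn_mull // dvdn_add //; last by rewrite mulnA dvdn_mull.
    by rewrite /dvdn (chinese_modr coPW) mod0n.
  rewrite /coprime; apply/eqP; apply: contrapT => /eqP ne.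
  set d := gcdn _ _ in ne; have d0 : (0 < d)%N by rewrite gcdn_gt0 t0.
  have q_pr : prime (pdiv d) by apply: pdiv_prime; rewrite ltn_neqAle eq_sym ne.
  set q := pdiv d in q_pr.
  have qt : (q %| t)%N by apply: dvdn_trans (pdiv_dvd d) (dvdn_gcdl _ _).
  have qF : (q %| A + b s * E)%N by apply: dvdn_trans (pdiv_dvd d) (dvdn_gcdr _ _).
  have qV : (q %| V)%N.
    have e : (A * (A + b s * E) = V + t ^ l * E)%N.
      rewrite -eb /V mulnDr mulnDl mul1n mulnA; have : (E <= A * A)%N by rewrite -subn_gt0 in V0; lia.
      by lia.
    have qtE : (q %| t ^ l * E)%N by rewrite dvdn_mulr // -(prednK l1) expnS dvdn_mulr.
    by rewrite -(dvdn_addl _ qtE) -e dvdn_mull.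
  have nq : ~~ (q %| t.-1)%N.
    apply/negP => h; have : (q %| 1)%N by rewrite -(@dvdn_addr t.-1) // addn1 prednK.
    by rewrite dvdn1 => /eqP q1; rewrite q1 in q_pr.
  case: (boolP (q %| PI)%N) => [qPI|nqPI].
    have : (q %| A)%N.
      have [j lt qj] : exists2 j, (j < m.+1)%N & (q %| pr j)%N.
        apply: contrapT => h; move: qPI; apply/negP.
        rewrite -prime_coprime // coprime_sym; apply: coprime_prod_ord => j lt.
        by rewrite coprime_sym prime_coprime //; apply/negP => qj; apply: h; exists j.
      by apply: dvdn_trans qj (A_pr _ lt).
    by move=> qA; move: nq; rewrite /t add1n /= dvdn_mulr.
  suff qW : (q %| W)%N by move: nq; rewrite (dvdn_trans qW tu).
  move: qV; rewrite -(partnC \pi(PI) V0) Euclid_dvdM // => /orP[qp|//].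
  have := part_pnat \pi(PI) V; rewrite /pnat => /andP[_ /allP/(_ q)].
  rewrite mem_primes q_pr part_gt0 qp => /(_ isT).
  by rewrite mem_primes (negPf nqPI) !andbF.
- move=> s j jm; have [_ [k ek]] := hb s.
  have [g0 gq gn] := hg j.
  exists (pr j), (x j), (g j)%:R; split=> //; last by move=> i im; rewrite a_r.
  split=> //; rewrite ek natrD !natrM.
  have l0 : l%:R != 0 :> 'F_(pr j).
    rewrite -(dvdn_pcharf (pchar_Fp (pr_pr j))); apply/negP => dv; have [_ dl] := prP j.
    have := dvdn_trans (dvdn_trans dv (dvdn_mull 4 (dvdnn l))) dl.
    have p1 := prime_gt1 (pr_pr j).
    by rewrite gtnNdvd // ?ltn_predL -?subn1 ?subn_gt0 // prime_gt0.
  have -> : A%:R = 0 :> 'F_(pr j).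
    by apply/eqP; rewrite -(dvdn_pcharf (pchar_Fp (pr_pr j))) A_pr.
  rewrite mul0r addr0.
  have -> : (u0 + s * (PI * W))%:R = tgt j.
    rewrite -hc; apply: mod_eq; apply/eqP.
    rewrite -(hu1 _ (jm : (j < m.+1)%N)) -(modn_dvdm u1 (PI_dvd _ (jm : (j < m.+1)%N))).
    rewrite -(chinese_modl coPW u1 0) (modn_dvdm _ (PI_dvd _ (jm : (j < m.+1)%N))) -/u0.
    by rewrite -[X in _ == X %[mod _]]addn0 eqn_modDl mod0n mulnCA -/(dvdn _ _) dvdn_mulr // PI_dvd.
  by rewrite /tgt mulrCA mulfV // mulr1.
Qed.

(** * The fields and their class groups *)

(** In each term of the Leibniz expansion every conjugate occurs once, with exponent at most [m]; as
    only one conjugate is large, [b] enters to the power [m] only. *)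
Lemma norm_det_powers_le (m : nat) (rho : 'I_m.+1 -> algC) (B b : nat) :
    (0 < B)%N -> (forall k, k != ord_max -> `|rho k| <= B%:R) -> `|rho ord_max| <= b.+1%:R ->
  `|\det (\matrix_(i, k < m.+1) rho k ^+ i)| <= ((m.+1)`! * (B ^ m) ^ m * b.+1 ^ m)%:R.
Proof.
move=> B0 hB hb; rewrite /determinant; apply: le_trans (ler_norm_sum _ _ _) _.
pose u (k : 'I_m.+1) := (if k == ord_max then b.+1 else B).
have hu k : `|rho k| <= (u k)%:R.
  by rewrite /u; case: eqP => [->|/eqP]; [|apply: hB].
have u0 k : (0 < u k)%N by rewrite /u; case: ifP.
have Pu : (\prod_k u k ^ m = (B ^ m) ^ m * b.+1 ^ m)%N.
  rewrite big_ord_recr /= {2}/u eqxx; congr (_ * _)%N.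
  under eq_bigr => i _.
    have -> : u (widen_ord (leqnSn m) i) = B.
      by rewrite /u -val_eqE /= ltn_eqF.
    over.
  by rewrite prod_nat_const card_ord.
apply: le_trans (_ : \sum_(s : {perm 'I_m.+1}) (\prod_k u k ^ m)%:R <= _); last first.
  by rewrite sumr_const card_Sn -mulrnA Pu mulnC mulnA.
apply: ler_sum => s _; rewrite normrM normrX normrN1 expr1n mul1r normr_prod natr_prod.
rewrite [X in _ <= X](reindex_inj (@perm_inj _ s)) /=; apply: ler_prod => i _.
rewrite mxE normr_ge0 normrX natrX /=.
apply: le_trans (_ : (u (s i))%:R ^+ i <= _).
  by rewrite lerXn2r ?nnegrE ?normr_ge0.
by rewrite ler_weXn2l ?ler1n // -ltnS.
Qed.

Section Field.
Variables (m : nat) (a : nat -> nat) (b : nat).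
Hypothesis m_gt0 : (0 < m)%N.
Hypothesis sep_a : forall i j, (i < j)%N -> (a i + 3 <= a j)%N.
Hypothesis big_b : (2 * (a m + 2) ^ m.+1 < b)%N.

(** The first [m] terms of [a] are the small points; the next term [a m] serves as the bound on
    them. *)
Definition pts (k : 'I_m.+1) : nat := if (k < m)%N then a k else b.
Definition fpoly : {poly int} := unitpoly pts ((-1) ^+ m.+1).

Lemma pts_max : pts ord_max = b. Proof. by rewrite /pts ltnn. Qed.

Lemma pts_small (k : 'I_m.+1) : k != ord_max -> pts k = a k.
Proof.
move=> nk; rewrite /pts ifT // ltn_neqAle -ltnS ltn_ord andbT.
by apply: contra nk => /eqP e; apply/eqP/val_inj.
Qed.

Lemma pts_le (k : 'I_m.+1) : k != ord_max -> (pts k <= a m)%N.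
Proof.
move=> nk; rewrite pts_small //.
have lt : (k < m)%N.
  rewrite ltn_neqAle -ltnS ltn_ord andbT.
  by apply: contra nk => /eqP e; apply/eqP/val_inj.
by apply: leq_trans (sep_a lt); rewrite leq_addr.
Qed.

Lemma pts_sep (i j : 'I_m.+1) : (i < j)%N -> (pts i + 3 <= pts j)%N.
Proof.
move=> ij; have im : (i < m)%N by apply: leq_trans ij _; rewrite -ltnS.
rewrite {1}/pts im /pts; case: ifP => [_|_]; first exact: sep_a.
apply: leq_trans (ltnW big_b); have := sep_a im.
by have : (0 < (a m + 2) ^ m)%N; [rewrite expn_gt0 addn2 | rewrite expnS; nia].
Qed.

Let big_pts : (2 * (a m + 2) ^ m.+1 < pts ord_max)%N.
Proof. by rewrite pts_max. Qed.

Let norm_dl : `|(-1) ^+ m.+1 : int|%N = 1%N.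
Proof. by rewrite abszX exp1n. Qed.

Lemma field_exists : exists (L : fieldExtType rat) (th : L) (sg : 'I_m.+1 -> {rmorphism L -> algC}),
  [/\ \dim {:L} = m.+1, <<1; th>>%VS = fullv, root (map_poly intr fpoly) th,
      forall k, `|sg k th - (pts k)%:R| <= 2 / b%:R & forall x, sg ord_max x \is Num.real].
Proof.
have [rho [f_rho near]] := roots_exist m_gt0 pts_sep pts_le big_pts norm_dl.
have irr := unitpoly_irreducible m_gt0 pts_sep pts_le big_pts norm_dl f_rho near.
have near' := near; rewrite pts_max in near'.
have [L dimL [th rth gen]] := irredp_FAdjoin irr.
rewrite size_map_inj_poly ?size_unitpoly //= in dimL; last exact: intr_inj.
have ex k : exists s : {rmorphism L -> algC}, s th = rho k.
  apply: (emb_exists irr rth gen).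
  have -> : map_poly ratr (map_poly intr fpoly) = map_poly intr fpoly :> {poly algC}.
    by rewrite -map_poly_comp; apply: eq_map_poly => z /=; rewrite rmorph_int.
  exact: (rho_root f_rho).
have [sg hsg] := choice ex.
exists L, th, sg; split=> //.
- by rewrite -map_in_alg_intr.
- by move=> k; rewrite hsg.
- move=> x; have [p <-] := poly_gen gen x.
  rewrite -horner_map -map_poly_comp hsg rpred_horner //.
    apply/polyOverP => i; rewrite coef_map /=.
    have := fmorph_eq_rat (GRing.RMorphism.clone _ _ (sg ord_max \o (in_alg L)) _) p`_i.
    by move=> /= ->; apply: Creal_Crat; apply: Crat_rat.
  exact: (rho_real m_gt0 pts_sep big_pts norm_dl f_rho near).
Qed.
End Field.

(** * The ideal generated by [th] and [t] *)

Section TwoGenerated.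
Variables (L : fieldExtType rat) (th w t u v : L) (l : nat).
Hypothesis int_th : integral th.
Hypothesis int_w : integral w.
Hypothesis int_t : integral t.
Hypothesis int_u : integral u.
Hypothesis int_v : integral v.
Hypothesis l_gt0 : (0 < l)%N.
Hypothesis th_neq0 : th != 0.
Hypothesis th_w : th * w = t ^+ l.
Hypothesis bezout : u * th + v * w = 1.

Definition two_gen (x : L) : Prop :=
  exists r s, [/\ integral r, integral s & x = r * th + s * t].

Lemma two_gen_ideal : ideal two_gen.
Proof.
have i0 := integral0 L; have i1 := integral1 L; split.
- by move=> _ [r [s [hr hs ->]]]; apply: integralD; apply: integralM.
- by exists 0, 0; rewrite !mul0r addr0.
- move=> _ _ [r [s [hr hs ->]]] [r' [s' [hr' hs' ->]]]; exists (r + r'), (s + s').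
  by split; try exact: integralD; ring.
- move=> c _ hc [r [s [hr hs ->]]]; exists (c * r), (c * s).
  by split; try exact: integralM; ring.
- by exists th; split=> //; exists 1, 0; rewrite mul1r mul0r addr0.
Qed.

(** Modulo [th], the elements of the [l]-th power are multiples of [t ^+ l = th * w]. Conversely
    [1 - (u * th) ^+ l.-1] is a multiple of [1 - u * th = v * w]; multiplied by [th], this writes
    [th] as a combination of [th ^+ l] and [t ^+ l]. *)
Lemma two_gen_exp : ideal_exp two_gen l = smul th (@integral L).
Proof.
have i0 := integral0 L; have i1 := integral1 L.
have sub k x : ideal_exp two_gen k x -> exists r s, [/\ integral r, integral s & x = r * th + s * t ^+ k].
  elim: k x => [|k IH] x; first by move=> hx; exists 0, x; rewrite mul0r add0r expr0 mulr1.
  rewrite ideal_expS.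
  apply: (@mul_ind _ _ _ (fun x => exists r s, [/\ integral r, integral s & x = r * th + s * t ^+ k.+1])).
  - by exists 0, 0; rewrite !mul0r addr0.
  - move=> _ _ [r [s [hr hs ->]]] [r' [s' [hr' hs' ->]]]; exists (r + r'), (s + s').
    by split; try exact: integralD; ring.
  - move=> _ y [r [s [hr hs ->]]] /IH[r' [s' [hr' hs' ->]]].
    exists (r * (r' * th + s' * t ^+ k) + s * t * r'), (s * s'); split.
    + apply: integralD; last by do 2!apply: integralM => //.
      by apply: integralM => //; apply: integralD; apply: integralM => //; exact: integralX.
    + exact: integralM.
    + by rewrite exprS; ring.
have [sI I0 ID IM _] := ideal_exp_ideal l two_gen_ideal.
have powI x k : two_gen x -> ideal_exp two_gen k (x ^+ k).
  by move=> hx; elim: k => [|k IH]; rewrite ?expr0 // exprS; apply: mul_mem.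
apply: pred_ext => x; split.
  move=> /sub[r [s [hr hs ->]]]; exists (r + s * w); split.
    by apply: integralD => //; exact: integralM.
  by rewrite -th_w; ring.
case=> y [hy ->]; rewrite mulrC; apply: (IM) => //.
pose S := \sum_(i < l.-1) 1 ^+ (l.-1.-1 - i) * (u * th) ^+ i.
have intS : integral S.
  apply: integral_sum => i _; rewrite expr1n mul1r; apply: integralX; exact: integralM.
have eS : 1 - (u * th) ^+ l.-1 = v * w * S.
  have -> : v * w = 1 - u * th by rewrite -bezout [u * th + _]addrC addrK.
  by rewrite -{1}(expr1n L l.-1) subrXX.
have -> : th = u ^+ l.-1 * th ^+ l + (v * S) * t ^+ l.
  have el : th ^+ l = th * th ^+ l.-1 by rewrite -exprS prednK.
  transitivity (th * ((u * th) ^+ l.-1 + v * w * S)); first by rewrite -eS addrC subrK mulr1.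
  by rewrite -th_w el exprMn; ring.
apply: ID; apply: (IM); try apply: powI.
- exact: integralX.
- by exists 1, 0; rewrite mul1r mul0r addr0.
- exact: integralM.
- by exists 0, 1; rewrite mul1r mul0r add0r.
Qed.

(* If [I ^ k = (be)] then [th ^ k] and [be ^ l] differ by a unit; take a [gcd(k, l)]-th root. *)
Lemma two_gen_principal k : (0 < k < l)%N -> principal (ideal_exp two_gen k) ->
  exists (q k' : nat) (e g : L), [/\ prime q, (q %| l)%N /\ ~~ (q %| k')%N,
    integral e /\ integral e^-1, e != 0 /\ g != 0 & th ^+ k' = e * g ^+ q].
Proof.
move=> /andP[k0 kl] /principalE[be hbe].
have i1 := integral1 L.
have be0 : be != 0.
  have [_ _ _ _ [x [hx nx]]] := ideal_exp_ideal k two_gen_ideal.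
  by apply: contra nx => /eqP b0; move: hx; rewrite hbe b0 => -[y [_ ->]]; rewrite mul0r.
have e1 : smul (be ^+ l) (@integral L) = smul (th ^+ k) (@integral L).
  rewrite -(ideal_expM_smul l two_gen_ideal hbe) mulnC.
  by rewrite (ideal_expM_smul k two_gen_ideal two_gen_exp).
have [y [hy ey]] : smul (th ^+ k) (@integral L) (be ^+ l).
  by rewrite -e1; exists 1; rewrite mulr1.
have [y' [hy' ey']] : smul (be ^+ l) (@integral L) (th ^+ k).
  by rewrite e1; exists 1; rewrite mulr1.
pose d := gcdn k l; have d0 : (0 < d)%N by rewrite gcdn_gt0 k0.
pose k' := (k %/ d)%N; pose l' := (l %/ d)%N.
have ek : k = (k' * d)%N by rewrite divnK // dvdn_gcdl.
have el : l = (l' * d)%N by rewrite divnK // dvdn_gcdr.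
have l'1 : (1 < l')%N.
  rewrite ltnNge; apply/negP => le; have : (l <= d)%N.
    by rewrite {1}el -[X in (_ <= X)%N]mul1n leq_mul2r le orbT.
  by rewrite leqNgt (leq_ltn_trans (dvdn_leq k0 (dvdn_gcdl k l)) kl).
pose q := pdiv l'; have q_pr : prime q by apply: pdiv_prime.
have ql' : (q %| l')%N by apply: pdiv_dvd.
have cop : coprime k' l'.
  rewrite /coprime -(eqn_pmul2r d0) muln_gcdl mul1n.
  by rewrite -ek -el.
pose e := th ^+ k' / be ^+ l'.
have e0 : e != 0 by rewrite mulf_neq0 ?invr_eq0 ?expf_neq0.
have ed : e ^+ d = y'.
  rewrite expr_div_n -!exprM -ek -el ey' mulrAC mulfV ?mul1r // expf_neq0 //.
have edV : e^-1 ^+ d = y.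
  rewrite invf_div expr_div_n -!exprM -ek -el ey mulrAC mulfV ?mul1r // expf_neq0 //.
exists q, k', e, (be ^+ (l' %/ q)%N); split=> //.
- rewrite el dvdn_mulr //; split=> //; apply/negP => qk'.
  have : (q %| gcdn k' l')%N by rewrite dvdn_gcd qk'.
  by rewrite (eqP cop) dvdn1 => /eqP q1; rewrite q1 in q_pr.
- by split; apply: (integral_root_exp d0); rewrite ?ed ?edV.
- by rewrite e0 expf_neq0.
- by rewrite -exprM divnK // /e mulfVK // expf_neq0.
Qed.

End TwoGenerated.

Lemma esym_predS (n : nat) (c : nat -> nat) :
  esym_pred n.+1 c = (esym_pred n c * c n + \prod_(i < n) c i)%N.
Proof.
rewrite /esym_pred big_ord_recr /=; congr (_ + _)%N.
  rewrite big_distrl; apply: eq_bigr => i _.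
  rewrite big_mkcond big_ord_recr /= -val_eqE /= gtn_eqF ?ltn_ord // [in RHS]big_mkcond /=.
  by congr (_ * _)%N; apply: eq_bigr => k _; rewrite -!val_eqE.
rewrite big_mkcond big_ord_recr /= eqxx muln1; apply: eq_bigr => k _.
by rewrite -val_eqE /= ltn_eqF.
Qed.

Lemma prod_XsubC_linear (n : nat) (c : nat -> nat) : exists r : {poly int},
  \prod_(i < n) ('X - ((c i)%:R)%:P) =
  ((-1) ^+ n)%:P * (((\prod_(i < n) c i)%:R)%:P - ((esym_pred n c)%:R)%:P * 'X) + 'X^2 * r :> {poly int}.
Proof.
elim: n => [|n [r hr]].
  by exists 0; rewrite /esym_pred !big_ord0 expr0 !polyC0 polyC1; ring.
exists (((-1) ^+ n * (esym_pred n c)%:R * (-1))%:P + ('X - ((c n)%:R)%:P) * r).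
rewrite [(\prod_(i < n.+1) c i)%N]big_ord_recr big_ord_recr hr esym_predS /= !natrD !natrM [(-1) ^+ n.+1]exprS.
by rewrite !(polyCD, polyCM, polyCN, polyC1); ring.
Qed.

(** * A single field of the family *)

Section Family.
Variables (m l : nat) (a : nat -> nat) (b t : nat).
Hypothesis m_ge2 : (2 <= m)%N.
Hypothesis l_gt0 : (0 < l)%N.
Hypothesis sep_a : forall i j, (i < j)%N -> (a i + 3 <= a j)%N.
Hypothesis big_b : (2 * (a m + 2) ^ m.+1 < b)%N.
Let A := (\prod_(i < m) a i)%N.
Hypothesis b_t : (A * b + 1 = t ^ l)%N.
Hypothesis cop_t : coprime t (A + b * esym_pred m a).
Hypothesis loc : forall j, (j <= m)%N -> local_data m l a b j.
Variables (L : fieldExtType rat) (th : L) (sg : 'I_m.+1 -> {rmorphism L -> algC}).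
Hypothesis dimL : \dim {:L} = m.+1.
Hypothesis gen_th : <<1; th>>%VS = fullv.
Hypothesis root_th : root (map_poly intr (fpoly m a b)) th.
Hypothesis near_th : forall k, `|sg k th - (pts a b k)%:R| <= 2 / b%:R.
Hypothesis real_sg : forall x, sg ord_max x \is Num.real.

Let m_gt0 : (0 < m)%N. Proof. exact: ltn_trans m_ge2. Qed.
Let dl : int := (-1) ^+ m.+1.
Let norm_dl : `|dl|%N = 1%N. Proof. by rewrite abszX exp1n. Qed.
Let big_pts : (2 * (a m + 2) ^ m.+1 < pts a b (@ord_max m))%N.
Proof. by rewrite (pts_max m a). Qed.
Let pts_sepm := pts_sep m_gt0 sep_a big_b.

Lemma inj_sg_th : injective (fun k => sg k th).
Proof.
move=> i k e; have n := near_th; apply: (near_unique m_gt0 pts_sepm big_pts norm_dl (x := sg i th)).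
  by rewrite pts_max.
by rewrite pts_max; move: e => /= ->.
Qed.

Lemma int_th : integral th.
Proof. by exists (fpoly m a b); split=> //; exact: monic_unitpoly. Qed.

Lemma prod_th : \prod_(k < m.+1) (th - (pts a b k)%:R) = - dl%:~R.
Proof.
by move: root_th; rewrite rootE unitpolyC addr_eq0 => /eqP.
Qed.

Lemma int_sub (k : 'I_m.+1) : integral (th - (pts a b k)%:R).
Proof. by apply: integralB; [exact: int_th | exact: integral_nat]. Qed.

Lemma sub_neq0 (k : 'I_m.+1) : th - (pts a b k)%:R != 0.
Proof.
apply/eqP => e; have := prod_th; rewrite (bigD1 k) //= e mul0r => /eqP.
by rewrite eq_sym oppr_eq0 rmorphXn /= expf_eq0 rmorphN rmorph1 oppr_eq0 oner_eq0 andbF.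
Qed.

Lemma int_subV (k : 'I_m.+1) : integral (th - (pts a b k)%:R)^-1.
Proof.
have dl2 : dl%:~R * dl%:~R = 1 :> L.
  by rewrite -rmorphM /= /dl -exprD addnn -signr_odd odd_double expr0.
have -> : (th - (pts a b k)%:R)^-1 = - dl%:~R * \prod_(j < m.+1 | j != k) (th - (pts a b j)%:R).
  apply: (mulfI (sub_neq0 k)); rewrite mulfV ?sub_neq0 // mulrCA.
  have := prod_th; rewrite (bigD1 k) //= => ->.
  by rewrite mulrNN dl2.
apply: integralM; first by apply: integralN; exact: integral_int.
by apply: integral_prod => j _; exact: int_sub.
Qed.

(** The cofactor [w] of [th] in [t ^ l] is congruent modulo [th] to the integer
    [F0 = A + b * esym_pred m a]. As [F0] is prime to [t ^ l = th * w], a Bezout relation between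
    these integers becomes one between [th] and [w]. *)
Lemma th_bezout : exists w u v : L, [/\ integral w, integral u, integral v,
  th * w = t%:R ^+ l & u * th + v * w = 1].
Proof.
have [r hr] := prod_XsubC_linear m a.
pose s : L := (-1) ^+ m; pose F0 := (A + b * esym_pred m a)%N.
have s2 : s * s = 1 by rewrite -expr2 sqrr_sign.
have ints : integral s by apply: integralX; apply: integralN; exact: integral1.
pose R := (map_poly intr r).[th].
have intR : integral R by apply: integral_horner; exact: int_th.
pose h2 := - s * (esym_pred m a)%:R + (th - b%:R) * R.
have inth2 : integral h2.
  apply: integralD; first by apply: integralM; [exact: integralN | exact: integral_nat].
  by apply: integralM => //; apply: integralB; [exact: int_th | exact: integral_nat].
pose w := s * th * h2 + F0%:R.
have intw : integral w.
  apply: integralD; last exact: integral_nat.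
  by do 2!apply: integralM => //; exact: int_th.
have thw : th * w = t%:R ^+ l.
  have eG : \prod_(i < m) (th - (a i)%:R) = s * (A%:R - (esym_pred m a)%:R * th) + th ^+ 2 * R.
    pose ev (P : {poly int}) : L := (map_poly intr P).[th].
    have evD P Q : ev (P + Q) = ev P + ev Q by rewrite /ev rmorphD hornerD.
    have evN P : ev (- P) = - ev P by rewrite /ev rmorphN hornerN.
    have evM P Q : ev (P * Q) = ev P * ev Q by rewrite /ev rmorphM hornerM.
    have evX : ev 'X = th by rewrite /ev map_polyX hornerX.
    have evC c : ev c%:P = c%:~R by rewrite /ev map_polyC hornerC.
    have := congr1 ev hr; rewrite evD !evM evD evN evM !evC !evX -/(ev r) rmorphXn /= rmorphN rmorph1 !rmorph_nat.
    rewrite [th ^+ 2]expr2 => <-.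
    rewrite /ev rmorph_prod horner_prod; apply: eq_bigr => i _.
    by rewrite rmorphB /= map_polyX map_polyC hornerXsubC /= rmorph_nat.
  have := prod_th; rewrite big_ord_recr /= (pts_max m a).
  rewrite (eq_bigr (fun i : 'I_m => th - (a i)%:R)) => [|i _]; last first.
    by rewrite pts_small // -val_eqE /= ltn_eqF.
  rewrite eG /dl rmorphXn /= rmorphN rmorph1 [(-1) ^+ m.+1]exprS mulN1r opprK -/s => e.
  have e2 : 1 = (A%:R - (esym_pred m a)%:R * th) * (th - b%:R) + s * th ^+ 2 * R * (th - b%:R).
    have : s * s = (s * s) * ((A%:R - (esym_pred m a)%:R * th) * (th - b%:R)) + s * th ^+ 2 * R * (th - b%:R).
      by rewrite -[X in _ * X = _]e; ring.
    by rewrite s2 mul1r.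
  rewrite -natrX -b_t natrD natrM /w /h2 /F0 natrD natrM [X in _ = _ + X]e2.
  rewrite (_ : th * _ = - (s * s) * (esym_pred m a)%:R * th ^+ 2 + s * th ^+ 2 * R * (th - b%:R) +
    th * (A%:R + b%:R * (esym_pred m a)%:R)); last by ring.
  by rewrite s2; ring.
have [[y z] hyz] : exists yz : int * int, yz.1 * F0%:Z + yz.2 * (t ^ l)%N%:Z = 1.
  have [y [z hyz]] := Bezoutz F0%:Z (t ^ l)%N%:Z; exists (y, z); rewrite hyz /=.
  by apply/eqP; rewrite -/(coprimez _ _) coprimezE /= coprime_sym coprimeXl.
exists w, (z%:~R * 0 - y%:~R * s * h2), (y%:~R + z%:~R * th).
have inty := integral_int L y; have intz := integral_int L z.
split=> //.
- by apply: integralB; do ?apply: integralM => //; exact: integral0.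
- by apply: integralD => //; apply: integralM => //; exact: int_th.
have e := congr1 (fun i : int => i%:~R : L) hyz.
rewrite /= rmorphD !rmorphM /= -!pmulrn natrX -thw rmorph1 in e.
by rewrite -[RHS]e /w; ring.
Qed.

(** The congruences in [local_data] factor the reduction of [f - dl] completely, so that [x] is seen
    to be a simple root of [f] modulo [p], as [residue_power] requires. *)
Lemma family_residue (j : nat) : (j <= m)%N ->
  exists (p : nat) (x g : 'F_p),
    [/\ prime p, nonresidue l g, x = (if (j < m)%N then 1 else g) &
     (forall i, (i < m)%N -> x - (a i)%:R = (if i == (if (j < m)%N then j else 0%N) then g else 1)) /\
     forall (M : {poly int}) (y : L) q, (0 < q)%N -> y ^+ q = (map_poly intr M).[th] ->
       exists z : 'F_p, z ^+ q = (map_poly intr M).[x]].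
Proof.
move=> jm; have [p [x [g /= [p_pr [gn g0] gq [ex eb] ea]]]] := loc jm.
set kap := (if (j < m)%N then j else 0%N) in ea *.
have km : (kap < m)%N by rewrite /kap; case: ifP.
exists p, x, g; split=> //; split=> [i im|M y q q0 hy].
  by rewrite ea // opprB addrC subrK.
have irr : irreducible_poly (map_poly intr (fpoly m a b) : {poly rat}).
  have [rho [f_rho near]] := roots_exist m_gt0 pts_sepm (@pts_le m a b sep_a) big_pts norm_dl.
  exact: (unitpoly_irreducible m_gt0 pts_sepm (@pts_le m a b sep_a) big_pts norm_dl f_rho near).
pose d : 'F_p := (-1) ^+ m.+1.
have fE : map_poly intr (fpoly m a b) =
    ('X - (x - g)%:P) * ('X - (x - 1)%:P) ^+ m.-1 * ('X - (x + d / g)%:P) + d%:P.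
  rewrite rmorphD rmorph_prod /= map_polyC /= rmorphXn /= rmorphN rmorph1 big_ord_recr /=.
  rewrite rmorphB /= map_polyX map_polyC /= (pts_max m a) rmorph_nat eb; congr (_ * _ + _).
  transitivity (\prod_(i < m) ('X - (if i == Ordinal km then x - g else x - 1)%:P)).
    apply: eq_bigr => i _; rewrite rmorphB /= map_polyX map_polyC /=.
    have -> : pts a b (widen_ord (leqnSn m) i) = a i by rewrite pts_small // -val_eqE /= ltn_eqF.
    by rewrite rmorph_nat ea // -val_eqE /=; case: (_ == _).
  rewrite (bigD1 (Ordinal km)) //= eqxx; congr (_ * _).
  rewrite (eq_bigr (fun=> 'X - (x - 1)%:P)) => [|i /negPf -> //].
  rewrite prodr_const; congr (_ ^+ _).
  by rewrite cardC1 card_ord.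
have e1 : x - (x - 1) = 1 by ring.
have e2 : x - (x - g) = g by ring.
have e3 : x - (x + d / g) = - (d / g) by ring.
have [||z hz] := residue_power (monic_unitpoly _ _) irr root_th gen_th p_pr _ _ int_th q0 hy (x := x).
- rewrite fE !(hornerE, horner_exp) e1 e2 e3 expr1n mulr1.
  by rewrite mulrN mulrCA mulfV // mulr1 addNr.
- rewrite -deriv_map fE derivD derivC addr0 !derivM deriv_exp !derivXsubC.
  rewrite !(hornerE, hornerMn, horner_exp) e1 e2 e3 !expr1n; apply: contra gq => /eqP e.
  rewrite -/d; apply/eqP.
  (* The quadratic expression of [local_data] is [g] times the derivative of [f] at [x]. *)
  transitivity (g * ((1 + g * m.-1%:R) * - (d / g) + g)); first by field.
  have -> : (1 + g * m.-1%:R) * - (d / g) + g = 0; last by rewrite mulr0.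
  by rewrite -[RHS]e -mulr_natr; ring.
by exists z.
Qed.

Lemma family_basis : exists w : 'I_m.+1 -> L, [/\ forall i, integral (w i),
  embmx sg w \in unitmx & forall x, integral x -> exists z : 'I_m.+1 -> int, x = \sum_i (z i)%:~R * w i].
Proof.
have [|//|w [hw uw spw _]] := @integral_basis _ _ dimL sg th inj_sg_th (fun i => th ^+ i).
- by move=> i; apply: integralX; exact: int_th.
- exact: embmx_powers_unit inj_sg_th.
by exists w.
Qed.

Lemma family_class : has_class_of_order L l /\ exists h, class_number L h /\ (l %| h)%N.
Proof.
have [w [u [v [iw iu iv thw bz]]]] := th_bezout.
have it : integral (t%:R : L) by exact: integral_nat.
have ith := int_th.
have th0 : th != 0.
  apply/eqP => th0; move: thw => /esym/eqP; rewrite th0 mul0r expf_eq0 l_gt0 /= ext_natr_eq0 => /eqP t0.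
  by move: b_t; rewrite t0 exp0n // addn1.
pose I := two_gen th (t%:R : L).
have iI : ideal I by apply: two_gen_ideal.
have Il : ideal_exp I l = smul th (@integral L) by apply: (two_gen_exp ith iw it iu iv l_gt0 th0 thw bz).
have [wb [iwb uwb spwb]] := family_basis.
have npr k : (0 < k < l)%N -> ~ principal (ideal_exp I k).
  move=> hk pk.
  have [q [k' [e [g [q_pr [ql qk'] [ie ieV] [e0 g0] ek]]]]] :=
    two_gen_principal ith iw it iu iv l_gt0 th0 thw bz hk pk.
  (* The unknown unit [e] takes the last place, instead of [th - b]. *)
  pose eps (i : 'I_m.+1) := if i == ord_max then e else th - (pts a b i)%:R.
  have eps0 i : eps i != 0 by rewrite /eps; case: ifP => // _; exact: sub_neq0.
  have ieps i : integral (eps i) by rewrite /eps; case: ifP => // _; exact: int_sub.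
  have iepsV i : integral (eps i)^-1 by rewrite /eps; case: ifP => // _; exact: int_subV.
  have [f [y [f_lt [i0 fi0] rel]]] := units_relation dimL inj_sg_th iwb spwb eps0 ieps iepsV
    (ex_intro _ ord_max real_sg) (prime_gt1 q_pr).
  pose F (i : nat) := f (inord i).
  (* Multiplying the relation by [(g ^+ F m) ^+ q] turns [e ^+ F m] into [th ^+ (k' * F m)]: the
     left side becomes the value at [th] of an integer polynomial. *)
  pose M : {poly int} := (\prod_(i < m) ('X - ((a i)%:R)%:P) ^+ F i) * 'X ^+ (k' * F m).
  pose y' := y * g ^+ F m.
  have relM : (map_poly intr M).[th] = y' ^+ q \/ (map_poly intr M).[th] = - y' ^+ q.
    have eM : (map_poly intr M).[th] = expprod eps f * (g ^+ F m) ^+ q.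
      rewrite rmorphM rmorphXn /= map_polyX hornerM hornerXn rmorph_prod horner_prod.
      rewrite /expprod big_ord_recr /= /eps eqxx exprM ek exprMn mulrA -!exprM [(q * _)%N]mulnC.
      congr (_ * _ * _); last by congr (_ ^+ f _); apply: val_inj; rewrite /= inordK.
      apply: eq_bigr => i _; rewrite rmorphXn /= rmorphB /= map_polyX map_polyC /= horner_exp hornerXsubC.
      have nm : widen_ord (leqnSn m) i != ord_max by rewrite -val_eqE /= ltn_eqF.
      rewrite (negPf nm) pts_small // rmorph_nat; congr (_ ^+ f _).
      by apply: val_inj; rewrite /= inordK // ltnS ltnW.
    by rewrite eM /y' exprMn; case: rel => ->; [left | right; rewrite mulNr].
  have main j : (j <= m)%N -> exists (p : nat) (x gg : 'F_p), [/\ nonresidue l gg,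
     x = (if (j < m)%N then 1 else gg) &
     exists z : 'F_p, gg ^+ F (if (j < m)%N then j else 0%N) * x ^+ (k' * F m) = z ^+ q \/
                      gg ^+ F (if (j < m)%N then j else 0%N) * x ^+ (k' * F m) = - z ^+ q].
    move=> jm; have [p [x [gg [p_pr gn ex [exa test]]]]] := family_residue jm.
    exists p, x, gg; split=> //; set kap := (if (j < m)%N then j else 0%N) in exa *.
    have km : (kap < m)%N by rewrite /kap; case: ifP.
    have evM : (map_poly intr M).[x] = gg ^+ F kap * x ^+ (k' * F m).
      rewrite rmorphM rmorphXn /= map_polyX hornerM hornerXn rmorph_prod horner_prod; congr (_ * _).
      rewrite (bigD1 (Ordinal km)) //= rmorphXn /= rmorphB /= map_polyX map_polyC horner_exp hornerXsubC /=.
      rewrite rmorph_nat exa // eqxx big1 ?mulr1 // => i /negPf ni.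
      rewrite rmorphXn /= rmorphB /= map_polyX map_polyC horner_exp hornerXsubC /=.
      rewrite rmorph_nat exa //; move: ni; rewrite -val_eqE /= => ->.
      by rewrite expr1n.
    have q0 := prime_gt0 q_pr.
    case: relM => relM.
      by have [z hz] := test M y' q q0 (esym relM); exists z; left; rewrite -evM hz.
    have relM' : y' ^+ q = (map_poly intr (- M)).[th] by rewrite rmorphN hornerN relM opprK.
    have [z hz] := test (- M) y' q q0 relM'.
    by exists z; right; rewrite -evM hz rmorphN hornerN opprK.
  (* For [j < m] the element [th] reduces to 1, and only the exponent [F j] is visible. The last
     prime sees [F 0] and [k' * F m] together, so it is used once [F 0] is known to vanish. *)
  have F0 j : (j < m)%N -> F j = 0%N.
    move=> jm; have [p [x [gg [gn ex [z hz]]]]] := main j (ltnW jm).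
    move: ex hz; rewrite jm => ->; rewrite expr1n mulr1 => hz.
    have := gn q _ z q_pr ql hz; apply: contraTeq; rewrite -lt0n => lt.
    by rewrite gtnNdvd // /F.
  have Fm : F m = 0%N.
    have [p [x [gg [gn ex [z hz]]]]] := main m (leqnn m).
    move: ex hz; rewrite ltnn => ->; rewrite F0 // expr0 mul1r => hz.
    have := gn q _ z q_pr ql hz; rewrite Euclid_dvdM // (negPf qk') /=.
    by apply: contraTeq; rewrite -lt0n => lt; rewrite gtnNdvd // /F.
  case/eqP: fi0; have -> : f i0 = F i0 by rewrite /F inord_val.
  have : (i0 <= m)%N by rewrite -ltnS.
  by rewrite leq_eqVlt => /predU1P[->|/F0].
have pl : principal (ideal_exp I l) by apply/principalE; exists th.
split; first by exists I.
have [h hh] := class_number_exists dimL inj_sg_th iwb uwb spwb.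
by exists h; split=> //; apply: (dvdn_class_number iwb spwb hh iI l_gt0 pl npr).
Qed.

Lemma family_disc : exists d : rat, is_disc L d /\
  `|ratr d| <= ((m.+1`! * ((a m).+1 ^ m) ^ m * b.+1 ^ m) ^ 2)%:R :> algC.
Proof.
have int_pow i : integral (th ^+ i) by apply: integralX; exact: int_th.
have [d [hd le]] := is_disc_exists dimL inj_sg_th (fun i : 'I_m.+1 => int_pow i) (embmx_powers_unit inj_sg_th).
exists d; split=> //; apply: le_trans le _; rewrite natrX lerXn2r ?nnegrE ?normr_ge0 //.
have b2 : 2 / b%:R <= 1 :> algC.
  have : (2 * (a m + 2) <= b)%N.
    by apply: leq_trans (ltnW big_b); rewrite leq_mul2l /= expnS leq_pmulr // expn_gt0 addn2.
  move=> h; rewrite ler_pdivrMr ?ltr0n ?mul1r ?ler_nat; last by lia.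
  by lia.
have bnd k : `|sg k th| <= (pts a b k).+1%:R.
  rewrite -[sg k th](subrK (pts a b k)%:R) -natr1 addrC; apply: le_trans (ler_normD _ _) _.
  by rewrite normr_nat lerD2l; apply: le_trans (near_th k) b2.
have -> : embmx sg (fun i : 'I_m.+1 => th ^+ i) = \matrix_(i, k < m.+1) (sg k th) ^+ i.
  by apply/matrixP => i k; rewrite !mxE rmorphXn.
apply: norm_det_powers_le => // [k nk|]; last by rewrite -[X in X.+1](pts_max m a b).
apply: le_trans (bnd k) _; rewrite ler_nat ltnS.
exact: (pts_le b sep_a nk).
Qed.

End Family.

(** * Counting *)

Lemma ratr_norm_le (d : rat) (k : nat) : `|ratr d| <= k%:R :> algC -> `|d| <= k%:R.
Proof.
by rewrite -ratr_norm -(rmorph_nat (@ratr algC)) ler_rat.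
Qed.

Lemma nf_iso_refl L : nf_iso L L.
Proof. by exists (GRing.RMorphism.clone _ _ (@idfun L) _); exists id. Qed.

Lemma nf_iso_sym L1 L2 : nf_iso L1 L2 -> nf_iso L2 L1.
Proof.
move=> [f [g fK gK]].
have gB : zmod_morphism g.
  by move=> x y; apply: (can_inj fK); rewrite rmorphB !gK.
have gM : monoid_morphism g.
  by split=> [|x y]; apply: (can_inj fK); rewrite ?rmorph1 ?rmorphM !gK.
pose gA := GRing.isZmodMorphism.Build _ _ g gB.
pose gMm := GRing.isMonoidMorphism.Build _ _ g gM.
by exists (HB.pack g gA gMm : {rmorphism L2 -> L1}); exists f.
Qed.

Lemma nf_iso_trans L2 L1 L3 : nf_iso L1 L2 -> nf_iso L2 L3 -> nf_iso L1 L3.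
Proof.
move=> [f bf] [g bg]; exists (GRing.RMorphism.clone _ _ (g \o f) _).
exact: bij_comp.
Qed.

(** * Comparison of two fields *)

Section Distinct.
Variables (m : nat) (a : nat -> nat) (b b' : nat).
Hypothesis m_ge2 : (2 <= m)%N.
Variable K : nat.
Hypothesis K_b : (16 * K < b)%N.
Hypothesis b_b' : (b <= b')%N.
Hypothesis b'_K : (b' + 1 <= K * b)%N.
Variables (L : fieldExtType rat) (th : L) (sg : 'I_m.+1 -> {rmorphism L -> algC}).
Hypothesis dimL : \dim {:L} = m.+1.
Hypothesis inj_th : injective (fun k => sg k th).
Variables (x y : L) (pi : 'I_m.+1 -> 'I_m.+1).
Hypothesis int_x : integral x.
Hypothesis int_y : integral y.
Hypothesis inj_pi : injective pi.
Hypothesis near_x : forall k, `|sg k x - (pts a b (pi k))%:R| <= 2 / b%:R.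
Hypothesis near_y : forall k, `|sg k y - (pts a b' (pi k))%:R| <= 2 / b'%:R.

(* The conjugates of [x - y] are at most [4 / b], except one which is at most [b' + 1]; since there
   are at least two small ones, the norm is less than 1. *)
Lemma near_eq : b = b'.
Proof.
have b0 : 0 < b%:R :> algC by rewrite ltr0n; apply: leq_ltn_trans K_b.
have b'0 : 0 < b'%:R :> algC by apply: lt_le_trans b0 _; rewrite ler_nat.
have b'b : 2 / b'%:R <= 2 / b%:R :> algC by rewrite ler_pM2l ?ltr0n // lef_pV2 ?posrE // ler_nat.
have K0 : (0 < K)%N by case: (K) b'_K => //; rewrite mul0n addn1.
have b4 : 4 / b%:R < 1 :> algC.
  by rewrite ltr_pdivrMr // mul1r ltr_nat; apply: leq_ltn_trans K_b; lia.
have sum4 k : `|sg k x - sg k y - ((pts a b (pi k))%:R - (pts a b' (pi k))%:R)| <= 4 / b%:R.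
  have -> : 4 / b%:R = 2 / b%:R + 2 / b%:R :> algC by rewrite -mulrDl -natrD.
  rewrite opprB addrACA [- _ + _]addrC [X in _ + X]addrC.
  rewrite (_ : _ + _ = (sg k x - (pts a b (pi k))%:R) - (sg k y - (pts a b' (pi k))%:R)); last by ring.
  apply: le_trans (ler_normB _ _) _; apply: lerD (near_x k) _.
  by apply: le_trans (near_y k) _.
have [j0 hj0] : exists j, pi j = ord_max.
  by have [g _ gK] := injF_bij inj_pi; exists (g ord_max); rewrite gK.
have small k : k != j0 -> `|sg k (x - y)| <= 4 / b%:R.
  move=> kj; have := sum4 k; rewrite rmorphB !pts_small ?subrr ?subr0 //;
  by apply: contra kj => /eqP e; apply/eqP/inj_pi; rewrite e.
have large : `|sg j0 (x - y)| <= (b' + 1)%:R.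
  have := sum4 j0; rewrite hj0 !pts_max rmorphB => h.
  rewrite -[X in `|X|](subrK (b%:R - b'%:R)); apply: le_trans (ler_normD _ _) _.
  rewrite natrD addrC lerD //; last by apply: le_trans h (ltW b4).
  by rewrite distrC -natrB // normr_nat ler_nat leq_subr.
have xy : x = y.
  apply/eqP; rewrite -subr_eq0; apply/eqP; apply: (integral_small dimL inj_th).
    exact: integralB.
  rewrite /Nm normr_prod (bigD1 j0) //=.
  have P1 : \prod_(k < m.+1 | k != j0) `|sg k (x - y)| <= (4 / b%:R) ^+ 2.
    apply: le_trans (_ : \prod_(k < m.+1 | k != j0) (4 / b%:R) <= _).
      by apply: ler_prod => k kj; rewrite normr_ge0 small.
    rewrite prodr_const cardC1 card_ord /=; apply: ler_wiXn2l => //.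
      by rewrite divr_ge0 // ltW.
    exact: ltW.
  have P0 : 0 <= \prod_(k < m.+1 | k != j0) `|sg k (x - y)| by apply: prodr_ge0.
  apply: le_lt_trans (ler_pM (normr_ge0 _) P0 large P1) _.
  rewrite expr_div_n mulrA ltr_pdivrMr ?exprn_gt0 // mul1r -!natrX -natrM ltr_nat.
  rewrite expnS expn1; apply: leq_ltn_trans (leq_mul b'_K (leqnn _)) _.
  have : (0 < b)%N by rewrite -(ltr_nat algC).
  by move=> ?; rewrite mulnC mulnA [X in (_ < X)%N]expnS expn1 ltn_pmul2r.
(* Now that [x = y], the integers [b] and [b'] differ by at most [4 / b < 1]. *)
have := sum4 j0; rewrite xy subrr sub0r normrN hj0 !pts_max => h.
apply/eqP; rewrite eqn_leq b_b' /= -subn_eq0 -leqn0 -ltnS -(ltr_nat algC).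
rewrite natrB // -[X in X < _]ger0_norm ?subr_ge0 ?ler_nat // distrC.
exact: le_lt_trans h b4.
Qed.
End Distinct.

(** Bundling the field with its generator and embeddings lets [choice] select them together for
    every parameter. *)
Record nf_data (m : nat) := NfData {
  nf_field : fieldExtType rat;
  nf_gen : nf_field;
  nf_emb : 'I_m.+1 -> {rmorphism nf_field -> algC} }.

Definition nf_good (m : nat) (a : nat -> nat) (b : nat) (D : nf_data m) : Prop :=
  [/\ \dim {:nf_field D} = m.+1, <<1; nf_gen D>>%VS = fullv,
      root (map_poly intr (fpoly m a b)) (nf_gen D),
      forall k, `|nf_emb D k (nf_gen D) - (pts a b k)%:R| <= 2 / b%:R &
      forall x, nf_emb D ord_max x \is Num.real].

(** The conjugates of [phi th1] are roots of the polynomial of [L1], each close to one point. They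
    are distinct: an embedding of [L1] is determined by its value at [th1], and [phi] is onto, so
    two equal conjugates would identify two embeddings of [L2]. *)
Lemma root_pattern (m : nat) (a : nat -> nat) (b : nat) (L1 L2 : fieldExtType rat) (th1 : L1)
    (th2 : L2) (sg : 'I_m.+1 -> {rmorphism L2 -> algC}) (phi : {rmorphism L1 -> L2}) :
    (0 < m)%N -> (forall i j, (i < j)%N -> (a i + 3 <= a j)%N) ->
    (2 * (a m + 2) ^ m.+1 < b)%N ->
    <<1; th1>>%VS = fullv -> root (map_poly intr (fpoly m a b)) th1 -> bijective phi ->
    injective (fun k => sg k th2) ->
  exists pi : 'I_m.+1 -> 'I_m.+1, injective pi /\
    forall k, `|sg k (phi th1) - (pts a b (pi k))%:R| <= 2 / b%:R.
Proof.
move=> m0 sep big gen rt [psi psiK phiK] inj2.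
have pbig : (2 * (a m + 2) ^ m.+1 < pts a b (@ord_max m))%N by rewrite pts_max.
have ndl : `|(-1) ^+ m.+1 : int|%N = 1%N by rewrite abszX exp1n.
have psep := pts_sep m0 sep big.
have rk k : root (map_poly intr (fpoly m a b)) (sg k (phi th1)).
  have -> : map_poly intr (fpoly m a b) = map_poly (sg k \o phi) (map_poly intr (fpoly m a b)).
    by rewrite -map_poly_comp; apply: eq_map_poly => z /=; rewrite !rmorph_int.
  by rewrite [sg k (phi th1)]/((sg k \o phi) th1) fmorph_root.
have near k : exists i : 'I_m.+1, `|sg k (phi th1) - (pts a b i)%:R| <= 2 / b%:R.
  by have := root_near m0 psep (@pts_le m a b sep) pbig ndl (rk k); rewrite pts_max.
have [pi hpi] := choice near; exists pi; split=> // k k' e.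
have [rho [f_rho nrho]] := roots_exist m0 psep (@pts_le m a b sep) pbig ndl.
have uniq j i : `|sg j (phi th1) - (pts a b i)%:R| <= 2 / b%:R -> sg j (phi th1) = rho i.
  move=> h; have [i' ei'] := root_rho f_rho (rk j); rewrite ei'; congr rho.
  apply: (near_unique m0 psep pbig ndl (x := rho i')); first exact: nrho.
  by rewrite -ei' pts_max.
apply: inj2; rewrite -(phiK th2).
have e2 : (sg k \o phi) th1 = (sg k' \o phi) th1.
  by rewrite /= (uniq _ _ (hpi k)) (uniq _ _ (hpi k')) e.
exact: (emb_ext gen (s := GRing.RMorphism.clone _ _ (sg k \o phi) _)
  (t := GRing.RMorphism.clone _ _ (sg k' \o phi) _) e2 (psi th2)).
Qed.

(** Each parameter in the range from [S + 1] to [2 * S] is sent to the representative of its field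
    and to the pattern of its conjugates there. By [near_eq] this map is injective, which bounds [S]
    by [h * m.+1 ^ m.+1]. *)
Lemma many_fields (m l : nat) : (2 <= m)%N -> (1 <= l)%N ->
  exists C S1 : nat, (0 < C)%N /\ forall S, (S1 <= S)%N ->
    exists (h : nat) (K : 'I_h -> fieldExtType rat),
      [/\ (S <= h * m.+1 ^ m.+1)%N, forall i j, i != j -> ~ nf_iso (K i) (K j) &
      forall i, [/\ \dim {:K i} = m.+1,
        exists d : rat, is_disc (K i) d /\ `|d| <= ((C * S) ^ (2 * m * l))%:R,
        exists h, class_number (K i) h /\ (l %| h)%N & has_class_of_order (K i) l]].
Proof.
move=> m2 l1; have m0 : (0 < m)%N by apply: ltn_trans m2.
have [a [b [u0 [Q [sep [A0 Q0] bt cop loc]]]]] := parameters m2 l1.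
set A := (\prod_(i < m) a i)%N in A0 bt cop.
pose t s := (1 + A * (u0 + s * Q))%N.
pose T := (2 * (a m + 2) ^ m.+1)%N.
have b_ge s : (s <= b s)%N.
  have : (A * s + 1 <= A * b s + 1)%N.
    rewrite bt -/(t s); apply: (@leq_trans (t s)); last by rewrite -[X in (X <= _)%N]expn1 leq_pexp2l.
    by rewrite /t addnC leq_add2l leq_mul2l; apply/orP; right; nia.
  by rewrite leq_add2r leq_pmul2l.
have exD s : exists D : nf_data m, (T < s)%N -> nf_good a (b s) D.
  (* For [s <= T] nothing is asked, and the rational field is a placeholder. *)
  have [lt|_] := ltnP T s; last by exists (@NfData m rat^o 0 (fun _ => GRing.RMorphism.clone _ _ (@ratr algC) _)).
  have [L [th [sg H]]] := field_exists m0 sep (leq_trans lt (b_ge s)).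
  by exists (NfData th sg).
have [D hD] := choice exD.
(* Within the range [t] at most doubles, so [A * b + 1 = t ^ l] grows by a factor of at most
   [2 ^ l]; the remaining 4 absorbs the added units. *)
pose K0 := (2 ^ (l + 2))%N.
pose C2 := (1 + A * (u0 + 2 * Q))%N.
pose C1 := (m.+1`! * ((a m).+1 ^ m) ^ m)%N.
exists ((C1 * C1) * C2)%N, (T + 16 * K0 + 1)%N; split.
  by rewrite !muln_gt0 fact_gt0 !expn_gt0.
move=> S hS.
have S0 : (0 < S)%N by lia.
pose s (i : 'I_S) := (S + i.+1)%N.
have sT i : (T < s i)%N by rewrite /s; lia.
have sK i : (16 * K0 < b (s i))%N by apply: leq_trans (b_ge _); rewrite /s; lia.
have sS i : (S < s i <= 2 * S)%N by have := ltn_ord i; rewrite /s; lia.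
have good i := hD _ (sT i).
have big i : (T < b (s i))%N by apply: leq_trans (sT i) (b_ge _).
have b_mono i j : (s i <= s j)%N -> (b (s i) <= b (s j))%N.
  move=> le; have : (A * b (s i) + 1 <= A * b (s j) + 1)%N.
    rewrite !bt -!/(t _) leq_exp2r // leq_add2l leq_pmul2l // leq_add2l leq_mul2r.
    by rewrite le orbT.
  by rewrite leq_add2r leq_pmul2l.
have ratio i j : (b (s j) + 1 <= K0 * b (s i))%N.
  have t2 : (t (s j) <= 2 * t (s i))%N.
    have : (u0 + s j * Q <= 2 * (u0 + s i * Q))%N.
      rewrite mulnDr leq_add ?leq_pmull // mulnA leq_mul2r; apply/orP; right.
      by have /andP[_ h1] := sS j; have /andP[h2 _] := sS i; lia.
    by move=> /(leq_mul (leqnn A)); rewrite /t mulnCA; lia.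
  have h1 : (A * b (s j) + 1 <= 2 ^ l * (A * b (s i) + 1))%N.
    by rewrite !bt -!/(t _) -expnMn leq_exp2r.
  have P0 : (0 < 2 ^ l)%N by rewrite expn_gt0.
  have h2 : (A <= A * b (s i))%N by rewrite leq_pmulr //; apply: leq_ltn_trans (big i).
  rewrite -(leq_pmul2l A0) /K0 expnD mulnDr muln1 mulnCA.
  move: h1 h2; rewrite mulnDr muln1; set Z := (A * b (s i))%N; set P := (2 ^ l)%N in P0 *.
  have := leq_mul P0 (leqnn Z); have : (0 < Z)%N by rewrite /Z muln_gt0 A0; apply: leq_ltn_trans (big i).
  move=> Z0; have := leq_mul (leqnn P) Z0; rewrite -mulnA [(2 ^ 2 * Z)%N]mulnC mulnA.
  by lia.
pose E (i j : 'I_S) := nf_iso (nf_field (D (s i))) (nf_field (D (s j))).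
have [h [rep [_ rinj rcov]]] := @finite_classes _ E (fun=> True) _ (fun i : 'I_S => i)
  (fun i => nf_iso_refl _) (fun i j => @nf_iso_sym _ _) (fun j i k => @nf_iso_trans _ _ _)
  ltac:(by move=> i j _ _ ->; exact: nf_iso_refl).
exists h, (fun i => nf_field (D (s (rep i)))); split.
- have hpat i : exists kp : 'I_h * {ffun 'I_m.+1 -> 'I_m.+1},
      let D' := D (s (rep kp.1)) in
      exists y : nf_field D', integral y /\ injective kp.2 /\
        forall k, `|nf_emb D' k y - (pts a (b (s i)) (kp.2 k))%:R| <= 2 / (b (s i))%:R.
    have [k [phi bphi]] := rcov i I; have [_ gen rt _ _] := good i.
    have [dim' _ _ near' _] := good (rep k).
    have inj' := inj_sg_th m2 sep (big (rep k)) near'.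
    have [pi [ipi npi]] := root_pattern m0 sep (big i) gen rt bphi inj'.
    exists (k, [ffun j => pi j]), (phi (nf_gen (D (s i)))); split; last first.
      by split=> [x y /=|j /=]; rewrite !ffunE; [apply: ipi | apply: npi].
    have [P [mP rP]] := int_th rt; exists P; split=> //.
    have -> : map_poly intr P = map_poly phi (map_poly intr P).
      by rewrite -map_poly_comp; apply: eq_map_poly => z /=; rewrite rmorph_int.
    by rewrite fmorph_root.
  have [kp hkp] := choice hpat.
  have ikp : injective kp.
    suff W i j : (s i <= s j)%N -> kp i = kp j -> i = j.
      move=> i j e; have [le|lt] := leqP (s i) (s j); first exact: W.
      by apply/esym/W => //; exact: ltnW.
    move=> le e; have [y [iy [ipi ny]]] := hkp j; have [x [ix [_ nx]]] := hkp i.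
    move: x ix nx; rewrite e => x ix nx.
    have [dim' _ _ near' _] := good (rep (kp j).1).
    have inj' := inj_sg_th m2 sep (big (rep (kp j).1)) near'.
    have eb : b (s i) = b (s j).
      exact: (near_eq m2 (sK i) (b_mono _ _ le) (ratio i j) dim' inj' ix iy ipi nx ny).
    have et : (t (s i) ^ l = t (s j) ^ l)%N by rewrite -!bt eb.
    have : t (s i) = t (s j) by apply/eqP; rewrite -(eqn_exp2r _ _ l1) et.
    move/eqP; rewrite /t eqn_add2l eqn_pmul2l // eqn_add2l eqn_pmul2r // /s eqn_add2l eqSS.
    by move/eqP/val_inj.
  by have := leq_card kp ikp; rewrite card_prod card_ffun !card_ord.
- by move=> i j /eqP ij e; apply: ij; apply: rinj.
- move=> i; have [dim gen rt near real] := good (rep i).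
  have [cl cn] := family_class m2 l1 sep (big (rep i)) (bt _) (cop _) (loc (s (rep i))) dim gen rt near real.
  split=> //.
  have [d [hd ld]] := family_disc m2 l1 sep (big (rep i)) (bt _) (cop _) dim rt near.
  exists d; split=> //; apply: le_trans (ratr_norm_le ld) _; rewrite ler_nat.
  have hb : ((b (s (rep i))).+1 <= (C2 * S) ^ l)%N.
    apply: (@leq_trans (A * b (s (rep i)) + 1)); first by rewrite addn1 ltnS leq_pmull.
    rewrite bt -/(t _) leq_exp2r // /C2 mulnDl mul1n /t leq_add // -mulnA leq_pmul2l //.
    rewrite mulnDl leq_add ?leq_pmulr // mulnAC leq_mul2r; apply/orP; right.
    by have /andP[_ h1] := sS (rep i); rewrite mulnC in h1 *.
  rewrite -/C1 -mulnA; apply: (@leq_trans ((C1 * C1) ^ (2 * m * l) * (C2 * S) ^ (2 * m * l))).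
    rewrite expnMn -mulnn leq_mul //.
      rewrite -[X in (X <= _)%N]expn1 leq_pexp2l //; last by rewrite !muln_gt0 l1 m0.
      by rewrite !muln_gt0 fact_gt0 !expn_gt0.
    have -> : (2 * m * l = l * (m * 2))%N by ring.
    by rewrite expnM -expnM leq_exp2r // muln_gt0 m0.
  by rewrite -expnMn mulnA.
Qed.

Theorem theorem1p1 (R : realType) (n l : nat) :
  (3 <= n)%N -> (1 <= l)%N ->
  let mu : R := (2 * (n - 1) * l)%:R^-1 in
  exists X0 c : R, 0 < X0 /\ 0 < c /\
    forall X : R, X0 < X ->
      exists (N : nat) (K : 'I_N -> fieldExtType rat),
        c * X `^ mu <= N%:R /\
        (forall i j, i != j -> ~ nf_iso (K i) (K j)) /\
        (forall i, [/\ \dim {:K i} = n,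
           (exists d : rat, is_disc (K i) d /\ `|ratr d| <= X),
           (exists h, class_number (K i) h /\ (l %| h)%N) &
           has_class_of_order (K i) l]).
Proof.
case: n => // m m2 l1; rewrite subn1 ltnS /= in m2 *.
set e := (2 * m * l)%N; set mu : R := e%:R^-1.
have e0 : (0 < e)%N by rewrite !muln_gt0 l1 (ltn_trans _ m2).
have [C [S1 [C0 many]]] := many_fields m2 l1.
pose M := (m.+1 ^ m.+1)%N.
have M0 : (0 < M)%N by rewrite expn_gt0.
(* In [c], the 2 pays for rounding to [S], by [S + 1 <= 2 * S], and [M] for the parameters sharing a
   field. *)
pose X0 : R := ((C * (S1 + 2)) ^ e)%:R; pose c : R := (2 * C * M)%:R^-1.
exists X0, c; split; first by rewrite ltr0n expn_gt0 muln_gt0 C0 addn2.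
split; first by rewrite invr_gt0 ltr0n !muln_gt0 C0 M0.
move=> X hX; have X_gt0 : 0 < X by apply: le_lt_trans hX.
pose Y := X `^ mu.
have Y0 : 0 <= Y by apply: powR_ge0.
have Ye : Y ^+ e = X.
  by rewrite -powR_mulrn // /Y -powRrM mulVf ?pnatr_eq0 -?lt0n // powRr1 // ltW.
have CY : (C * (S1 + 2))%:R <= Y.
  by rewrite -(ler_pXn2r e0) ?nnegrE // Ye -natrX ltW.
have CR : 0 < C%:R :> R by rewrite ltr0n.
(* The largest [S] for which the discriminant bound [(C * S) ^ e] stays below [X]. *)
pose S := Num.truncn (Y / C%:R).
have YC0 : 0 <= Y / C%:R by rewrite divr_ge0.
have [S_le S_gt] : S%:R <= Y / C%:R /\ Y / C%:R < S%:R + 1.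
  by have /andP[h1 h2] := truncn_itv YC0; rewrite natr1.
have S1S : (S1 + 2 <= S)%N.
  by rewrite /S truncn_ge_nat // ler_pdivlMr // -natrM mulnC.
have [h [K [hS niso good]]] := many S (leq_trans (leq_addr _ _) S1S).
exists h, K; split; last split=> // i.
- have S2 : 2 <= S%:R :> R by rewrite ler_nat; apply: leq_trans S1S; rewrite leq_addl.
  have hY : Y <= 2 * C%:R * S%:R.
    rewrite -mulrA mulrCA -ler_pdivrMl // mulrC; apply: le_trans (ltW S_gt) _; lra.
  rewrite /c mulrC ler_pdivrMr ?ltr0n ?muln_gt0 ?C0 ?M0 //.
  apply: le_trans hY _; rewrite -!natrM ler_nat mulnCA leq_pmul2l ?muln_gt0 ?C0 //.
- have [dim [d [hd ld]] cn co] := good i; split=> //; exists d; split=> //.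
  rewrite -ratr_norm; apply: le_trans (_ : ((C * S) ^ e)%:R <= _).
    by rewrite -(rmorph_nat (@ratr R)) ler_rat.
  rewrite -Ye natrX lerXn2r ?nnegrE // natrM mulrC -ler_pdivlMr //.
Qed.
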